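(* Let $(u,0,\mu)\in\mathcal D$ and put $F(x)=\mu((-\infty,x])$. For $n\in\mathbb N$ let $(u_n,\rho_n,\mu_n)\in\mathcal D$ be given by $$u_n(x)=\int_{\mathbb R} n\phi(n(x-y))u(y)\,dy,$$ $$\rho_n(x)=\Big(\frac1{n^2}+\int_{\mathbb R} n\phi'(y)F\big(x-\tfrac{y}{n}\big)dy-\Big(\int_{\mathbb R}\phi(y)u_x\big(x-\tfrac{y}{n}\big)dy\Big)^2\Big)^{1/2}=\frac1n+\bar\rho_n(x),$$ $$\mu_n=\big(u_{n,x}^2(x)+\bar\rho_n^2(x)\big)\,dx .$$ Let $(y,U,h,0)=L((u,0,\mu))$ and $(y_n,U_n,h_n,r_n)=L((u_n,\rho_n,\mu_n))$. Then, as $n\to\infty$, $$(y_n,U_n,h_n,r_n)\to(y,U,h,0)\quad\text{in } E.$$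
   Context: $L^2_{\rm const}(\mathbb R)$ is the set of $\rho\in L^1_{\rm loc}(\mathbb R)$ of the form $\rho=\bar\rho+k$ with $\bar\rho\in L^2(\mathbb R)$, $k\in\mathbb R$; the pair $(\bar\rho,k)$ is uniquely determined by $\rho$. The set $\mathcal D$ (Eulerian coordinates) consists of all triples $(u,\rho,\mu)$ such that $u\in H^1(\mathbb R)$, $\rho=\bar\rho+k\in L^2_{\rm const}(\mathbb R)$, and $\mu$ is a positive finite Radon measure on $\mathbb R$ whose absolutely continuous part is $\mu_{\rm ac}=(u_x^2+\bar\rho^2)\,dx$. $\phi\in C_c^\infty(\mathbb R)$ is a fixed Friedrichs mollifier with $\phi(x)=\phi(-x)\ge0$, $\|\phi\|_{L^1}=1$, $\phi'(x)>0$ for $x\in(-1,0)$, and $\operatorname{supp}\phi=[-1,1]$. It is known that the triples $(u_n,\rho_n,\mu_n)$ in the claim are well defined and belong to $\mathcal D$. $V=\{f\in C_b(\mathbb R): f_\xi\in L^2(\mathbb R)\}$ with $\|f\|_V=\|f\|_{L^\infty}+\|f_\xi\|_{L^2}$, where $C_b(\mathbb R)=C(\mathbb R)\cap L^\infty(\mathbb R)$. $E=V\times H^1(\mathbb R)\times L^2(\mathbb R)\times L^2(\mathbb R)\times\mathbb R$ with norm $$\|(\zeta,U,h,\bar r,k)\|_E=\|\zeta\|_V+\|U\|_{H^1}+\|h\|_{L^2}+\|\bar r\|_{L^2}+|k|.$$ A tuple $(\zeta,U,h,\bar r,k)\in E$ is identified with $(y,U,h,r)$, where $y=\zeta+\mathrm{Id}$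 and $r=\bar r+k y_\xi$; convergence of tuples $(y,U,h,r)$ in $E$ means convergence of the corresponding $(\zeta,U,h,\bar r,k)$ in the norm of $E$. The map $L$ sends $(u,\rho,\mu)\in\mathcal D$, $\rho=\bar\rho+k$, to $(y,U,h,r)$ given by $$y(\xi)=\sup\{y\mid \mu((-\infty,y))+y<\xi\},\quad h(\xi)=1-y_\xi(\xi),\quad U(\xi)=u(y(\xi)),\quad r(\xi)=\rho(y(\xi))\,y_\xi(\xi)$$ (with $r=0$ where $y_\xi=0$); here $\bar r(\xi)=\bar\rho(y(\xi))y_\xi(\xi)$ and the constant $k$ in $E$ is the constant $k$ of $\rho$. It is known that $L$ takes values in (the subset $\mathcal F_0$ of Lagrangian coordinates in) $E$. *)

(* Defs.v *)
From HB Require Import structures.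
From mathcomp Require Import all_boot all_order all_algebra.
From mathcomp Require Import all_classical all_reals all_analysis.
Set Implicit Arguments.
Unset Strict Implicit.
Unset Printing Implicit Defensive.
Import Order.TTheory GRing.Theory Num.Theory.
Import numFieldNormedType.Exports.
Local Open Scope classical_set_scope.
Local Open Scope ring_scope.

Section Defs.
Context {R : realType}.
Implicit Types (f g u rho phi : R -> R).

Local Notation leb := (@lebesgue_measure R).

(* Elements of spaces of classes modulo a.e. equality are represented by
   functions R -> R; all the operations below respect a.e. equality, except
   that members of H^1 and V are represented by their continuous
   representative, as needed to make sense of u(y(xi)). *)

Definition L2 f : Prop := f \in Lfun leb 2%:E.

Definition normL2 f : \bar R := ('N[leb]_(2%:E)[EFin \o f])%E.

Definition normLinf f : \bar R := ('N[leb]_(+oo)[EFin \o f])%E.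

Definition smooth f : Prop :=
  forall (n : nat) (x : R), derivable (derive1n n f) x 1.

Definition Ccinfty f : Prop :=
  smooth f /\ compact (closure [set x | f x != 0]).

(* Distributional derivative, tested against C_c^oo. *)
Definition is_wderiv f g : Prop :=
  [/\ locally_integrable [set: R] f, locally_integrable [set: R] g &
      forall phi, Ccinfty phi ->
        \int[leb]_x (f x * derive1 phi x) = - \int[leb]_x (g x * phi x)].

(* f_x as a representative of its a.e. class (which is unique); the value is
   the default 0 only if f has no locally integrable weak derivative. *)
Definition wderiv f : R -> R := xget (cst 0) [set g | is_wderiv f g].

Definition H1 f : Prop :=
  [/\ continuous f, L2 f & exists2 g, is_wderiv f g & L2 g].

Definition normH1 f : \bar R :=
  ((normL2 f ^+ 2 + normL2 (wderiv f) ^+ 2) `^ (2^-1))%E.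

(* rho in L^2_const : rho = rhobar + k; k is unique since a constant function
   in L^2(R) is zero, so kpart makes no actual choice. *)
Definition L2const rho : Prop := exists k : R, L2 (fun x => rho x - k).

Definition kpart rho : R := xget 0 [set k : R | L2 (fun x => rho x - k)].

Definition barpart rho : R -> R := fun x => rho x - kpart rho.

(* f dx is the absolutely continuous part in the Lebesgue decomposition of mu:
   mu = f dx + mus with mus singular with respect to Lebesgue measure. *)
Definition ac_part_density (mu : set (measurableTypeR R) -> \bar R) f : Prop :=
  exists mus : {measure set (measurableTypeR R) -> \bar R},
    (exists N : set (measurableTypeR R),
      [/\ measurable N, leb N = 0%E & mus (~` N) = 0%E]) /\
    forall A : set (measurableTypeR R), measurable A ->
      (mu A = \int[leb]_(x in A) (f x)%:E + mus A)%E.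

(* The set D; finite Borel measures on the real line are Radon. *)
Definition eulerian u rho
    (mu : {finite_measure set (measurableTypeR R) -> \bar R}) : Prop :=
  [/\ H1 u, L2const rho &
      ac_part_density mu (fun x => wderiv u x ^+ 2 + barpart rho x ^+ 2)].

Definition friedrichs phi : Prop :=
  [/\ Ccinfty phi,
      (forall x, phi x = phi (- x)) /\ (forall x, 0 <= phi x),
      ('N[leb]_(1%E)[EFin \o phi])%E = 1%E,
      forall x, -1 < x < 0 -> 0 < derive1 phi x &
      closure [set x | phi x != 0] = `[-1, 1]%classic].

(* V = {f in C_b : f_xi in L^2}. *)
Definition inV f : Prop :=
  [/\ continuous f, [bounded f x | x in [set: R]] &
      exists2 g, is_wderiv f g & L2 g].

Definition normV f : \bar R := (normLinf f + normL2 (wderiv f))%E.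

(* The tuple (y, U, h, r) is stored as the corresponding
   (zeta, U, h, rbar, k); y and r are recovered by lag_y and lag_r. *)
Record lagrangian := Lagrangian {
  lag_zeta : R -> R;
  lag_U : R -> R;
  lag_h : R -> R;
  lag_rbar : R -> R;
  lag_k : R }.

Definition lag_y (X : lagrangian) : R -> R := fun xi => lag_zeta X xi + xi.

Definition lag_r (X : lagrangian) : R -> R :=
  fun xi => lag_rbar X xi + lag_k X * wderiv (lag_y X) xi.

Definition in_lagE (X : lagrangian) : Prop :=
  [/\ inV (lag_zeta X), H1 (lag_U X), L2 (lag_h X) & L2 (lag_rbar X)].

Definition lag_sub (X Y : lagrangian) : lagrangian :=
  Lagrangian (fun x => lag_zeta X x - lag_zeta Y x)
             (fun x => lag_U X x - lag_U Y x)
             (fun x => lag_h X x - lag_h Y x)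
             (fun x => lag_rbar X x - lag_rbar Y x)
             (lag_k X - lag_k Y).

Definition normE (X : lagrangian) : \bar R :=
  (normV (lag_zeta X) + normH1 (lag_U X) + normL2 (lag_h X)
   + normL2 (lag_rbar X) + `|lag_k X|%:E)%E.

Definition cvgE (X : nat -> lagrangian) (Y : lagrangian) : Prop :=
  [/\ forall n, in_lagE (X n), in_lagE Y &
      (fun n => normE (lag_sub (X n) Y)) @ \oo --> 0%E].

Definition Ly (mu : set (measurableTypeR R) -> \bar R) : R -> R :=
  fun xi => sup [set y : R | (mu `]-oo, y[%classic + y%:E < xi%:E)%E].

(* The map L, on the underlying set function of the measure. *)
Definition Lmap u rho (mu : set (measurableTypeR R) -> \bar R) : lagrangian :=
  let y := Ly mu in
  let dy := wderiv y in
  Lagrangian (fun xi => y xi - xi)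
             (fun xi => u (y xi))
             (fun xi => 1 - dy xi)
             (fun xi => barpart rho (y xi) * dy xi)
             (kpart rho).

Lemma lag_y_Lmap u rho mu : lag_y (Lmap u rho mu) = Ly mu.
Proof. by apply/funext => xi; rewrite /lag_y /= subrK. Qed.

Lemma lag_r_Lmap u rho mu xi :
  lag_r (Lmap u rho mu) xi = rho (Ly mu xi) * wderiv (Ly mu) xi.
Proof. by rewrite /lag_r lag_y_Lmap /= -mulrDl subrK. Qed.

Definition cumul (mu : set (measurableTypeR R) -> \bar R) (x : R) : R :=
  fine (mu `]-oo, x]%classic).

Definition u_approx phi u (n : nat) : R -> R :=
  fun x => \int[leb]_y (n%:R * phi (n%:R * (x - y)) * u y).

Definition rho_approx phi u (mu : set (measurableTypeR R) -> \bar R) (n : nat) :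
    R -> R :=
  fun x => Num.sqrt
    ((n%:R ^+ 2)^-1
     + \int[leb]_y (n%:R * derive1 phi y * cumul mu (x - y / n%:R))
     - (\int[leb]_y (phi y * wderiv u (x - y / n%:R))) ^+ 2).

Definition mu_approx phi u (mu : set (measurableTypeR R) -> \bar R) (n : nat) :
    set (measurableTypeR R) -> \bar R :=
  fun A => (\int[leb]_(x in A)
    (wderiv (u_approx phi u n) x ^+ 2
     + (rho_approx phi u mu n x - n%:R^-1) ^+ 2)%:E)%E.

End Defs.

(* Main.v *)
(* Write w = u_x, let N be a null set carrying the singular part of mu, and put
   F(x) = mu(]-oo, x]).  Since y(xi) <= x iff xi <= x + F(x), the image of
   Lebesgue measure under y is dx + mu; hence y is a primitive of p = q o y and
   u o y is a primitive of (w q) o y, where q = 1_{~N} / (1 + w^2 + rhobar^2).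
   With h = 1 - p, U' = w(y) p and r = rhobar(y) p this gives the pointwise
   identity h^2 + U'^2 + r^2 = h, and the integral of h is mu(R).

   For the approximations, mu_n has density g_n - (2/n) rhobar_n, where g_n is
   the mollification of mu.  The total mass of the second term tends to 0, so
   F(x - 1/n) - e_n <= F_n(x) <= F(x + 1/n) + e_n with e_n -> 0, whence y_n -> y
   uniformly.  As |u(a) - u(b)|^2 is at most |a - b| times the integral of w^2
   between a and b, also U_n -> U uniformly and in L^2.  Consequently
   h_n - h and U_n' - U' tend weakly to 0.  The identity above yields
     |h_n - h|^2 + |U_n' - U'|^2 + |r_n|^2
        = (h_n - h) - 2 (h_n - h) h - 2 (U_n' - U') U',
   and mu_n(R) <= mu(R) makes the integral of the first term nonpositive, so the
   weak convergence is strong and r_n -> 0 in L^2. *)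
Require Import Defs.
From HB Require Import structures.
From mathcomp Require Import all_boot all_order all_algebra.
From mathcomp Require Import all_classical all_reals all_analysis.
From mathcomp Require Import measurable_realfun ess_sup_inf ring lra.
Import Order.TTheory GRing.Theory Num.Theory.
Import numFieldNormedType.Exports.
Local Open Scope classical_set_scope.
Local Open Scope ring_scope.
Set Implicit Arguments.
Unset Strict Implicit.
Unset Printing Implicit Defensive.

(** * Integral inequalities and measures with a density *)

(** [wderiv] is only a choice within an a.e. class, and y is constant on an interval wherever mu has
    an atom. Derivatives are therefore handled as densities of primitives: the chain rule along y
    becomes an identity between integrals, and [wderiv] is reached through a.e. equality. The
    function q is the density of Lebesgue measure with respect to dx + mu. It is defined at every
    point, so the quadratic identity holds everywhere. The mass of (2/n) rhobar_n is not controlled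
    by Cauchy-Schwarz, because the line has infinite length. Two bounds share the work: (1 + g_n)/n
    on a large interval, and g_n itself outside, where the tails of mu are small. Weak convergence
    is tested only against h and U'. Both are bounded by 1, so the difference quotients of their
    primitives are bounded as well and approximate them in L^2 on bounded intervals by dominated
    convergence. A bound of U_n - U by the whole energy would be uniform but not integrable in xi.
    The energy in a window of fixed width around xi gives both, since its integral over xi is a
    multiple of the total energy. *)

Section integral_tools.
Context d (T : measurableType d) (R : realType) (m : {measure set T -> \bar R}).
Implicit Types (f g k : T -> R) (D : set T).

(** From [|f| <= 1 + f ^+ 2], multiplied by the weight. With weight 1 on a bounded interval it makes
    L^2 functions locally integrable. *)
Lemma integrable_mul_of_mul_sqr D f k : measurable D -> measurable_fun D f ->
  (forall x, D x -> 0 <= k x) ->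
  m.-integrable D (EFin \o k) ->
  m.-integrable D (EFin \o (fun x => k x * f x ^+ 2)) ->
  m.-integrable D (EFin \o (fun x => k x * f x)).
Proof.
move=> mD mf k0 ik ikf.
have i2 := integrableD mD ik ikf.
apply: (le_integrable mD _ _ i2).
  apply/measurable_EFinP/measurable_funM => //.
  by apply/measurable_EFinP; case/integrableP: ik.
move=> x Dx /=; rewrite lee_fin normrM ger0_norm ?k0//.
rewrite (le_trans _ (ler_norm _))// -[X in _ <= X + _]mulr1 -mulrDr.
apply: ler_wpM2l; first exact: k0.
have := sqr_ge0 (`|f x| - 1); have := normr_ge0 (f x).
rewrite -(real_normK (num_real (f x))); nra.
Qed.

(** Expand the nonnegative integral of k (f - A/K)^2, where A/K is the k-mean of f. The weight is 1
    in the Hölder bound for primitives and [phi] in the comparison of the mollified u_x with the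
    mollified measure. *)
Lemma Rintegral_jensen D f k : measurable D -> measurable_fun D f ->
  (forall x, D x -> 0 <= k x) ->
  m.-integrable D (EFin \o k) -> 0 < \int[m]_(x in D) k x ->
  m.-integrable D (EFin \o (fun x => k x * f x ^+ 2)) ->
  (\int[m]_(x in D) (k x * f x)) ^+ 2 <=
  (\int[m]_(x in D) k x) * \int[m]_(x in D) (k x * f x ^+ 2).
Proof.
move=> mD mf k0 ik K0 ikf2.
have ikf := integrable_mul_of_mul_sqr mD mf k0 ik ikf2.
set K := \int[m]_(x in D) k x; set A := \int[m]_(x in D) (k x * f x).
set B := \int[m]_(x in D) (k x * f x ^+ 2).
have : 0 <= \int[m]_(x in D) (k x * (f x - A / K) ^+ 2).
  by apply: Rintegral_ge0 => x Dx; rewrite mulr_ge0 ?k0 ?sqr_ge0.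
have -> : \int[m]_(x in D) (k x * (f x - A / K) ^+ 2) =
    \int[m]_(x in D) ((k x * f x ^+ 2 - (2 * (A / K)) * (k x * f x)) + (A / K) ^+ 2 * k x).
  by apply: eq_Rintegral => x _; ring.
have iZ (c : R) g : m.-integrable D (EFin \o g) ->
    m.-integrable D (EFin \o (fun x => c * g x)).
  by move=> ig; exact: (integrableZl mD c ig).
rewrite RintegralD//; last 2 first.
- exact: (integrableB mD ikf2 (iZ _ _ ikf)).
- exact: iZ.
rewrite RintegralB//; last exact: iZ.
rewrite !RintegralZl// -/A -/B -/K.
have -> : B - 2 * (A / K) * A + (A / K) ^+ 2 * K = (K * B - A ^+ 2) / K.
  by field; rewrite gt_eqF.
by rewrite pmulr_lge0 ?invr_gt0// subr_ge0.
Qed.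

Import HBNNSimple.
(** Simple functions and monotone convergence carry the decomposition m1 = g m + m2 from sets to
    nonnegative functions. This is how the Lebesgue decomposition of mu is used under an
    integral. *)
Lemma ge0_integral_density (m1 m2 : {measure set T -> \bar R}) (g : T -> R) :
  measurable_fun setT g -> (forall x, 0 <= g x) ->
  (forall A, measurable A -> m1 A = (\int[m]_(x in A) (g x)%:E + m2 A)%E) ->
  forall f : T -> \bar R, measurable_fun setT f -> (forall x, (0 <= f x)%E) ->
  (\int[m1]_x f x = \int[m]_x (f x * (g x)%:E) + \int[m2]_x f x)%E.
Proof.
move=> mg' g0' mE f mf f0.
have mg : measurable_fun setT (EFin \o g) by exact/measurable_EFinP.
have g0 x : (0 <= (g x)%:E)%E by rewrite lee_fin.
pose h := nnsfun_approx measurableT mf.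
have hc x : (EFin \o h ^~ x) @ \oo --> f x by exact: cvg_nnsfun_approx.
have ndh x : {homo (EFin \o h ^~ x) : a b / (a <= b)%N >-> (a <= b)%E}.
  by move=> a b ab; rewrite /= lee_fin; exact/lefP/nd_nnsfun_approx.
have key n : (\int[m1]_x (h n x)%:E = \int[m]_x ((h n x)%:E * (g x)%:E) + \int[m2]_x (h n x)%:E)%E.
  have mi r : measurable_fun setT (fun x => (r * \1_(h n @^-1` [set r]) x)%:E).
    by apply/measurable_EFinP/measurable_funM => //; exact: measurable_indic.
  have hE : (fun x => (h n x)%:E) =
     (fun x => \sum_(r \in range (h n)) (r * \1_(h n @^-1` [set r]) x)%:E)%E.
    by apply/funext => x; rewrite fimfunE -fsumEFin.
  have gE : (fun x => (h n x)%:E * (g x)%:E)%E =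
     (fun x => \sum_(r \in range (h n)) ((r * \1_(h n @^-1` [set r]) x)%:E * (g x)%:E))%E.
    apply/funext => x; rewrite fimfunE -fsumEFin//= ge0_mule_fsuml// => r.
    exact: nnfun_muleindic_ge0.
  rewrite gE hE.
  rewrite !ge0_integral_fsum//; try by move=> *; exact: nnfun_muleindic_ge0.
  - rewrite -fsbig_split//=; apply: eq_fsbigr => r _.
    have mA : measurable (h n @^-1` [set r]) by exact: measurable_sfunP.
    under [X in (_ = X + _)%E]eq_integral => x _ do rewrite EFinM -muleA.
    (* Only a nonnegative constant is pulled out of the integrals; a negative r is not a value of
       [h n], so its level set is empty. *)
    have [r0|r0] := ltP r 0.
      have -> : h n @^-1` [set r] = set0 by rewrite preimage_nnfun0.
      rewrite !integral0_eq ?adde0// => x _; rewrite indic0 /= ?mulr0 //.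
      by rewrite !mul0e mule0.
    under [X in (X = _)%E]eq_integral => x _ do rewrite EFinM.
    under [X in (_ = _ + X)%E]eq_integral => x _ do rewrite EFinM.
    rewrite !ge0_integralZl//; last 4 first.
    + by apply: emeasurable_funM => //; apply/measurable_EFinP; exact: measurable_indic.
    + by move=> x _; rewrite mule_ge0// lee_fin.
    + by apply/measurable_EFinP; exact: measurable_indic.
    + by apply/measurable_EFinP; exact: measurable_indic.
    rewrite !integral_indic// !setIT mE// ge0_muleDr//; last first.
      exact: integral_ge0.
    congr (_ * _ + _)%E.
    rewrite integral_mkcond; apply: eq_integral => x _.
    by rewrite patchE indicE; case: ifPn; rewrite ?mul1e ?mul0e.
  - by move=> r; apply: emeasurable_funM.
  - by move=> r x _; rewrite mule_ge0// nnfun_muleindic_ge0.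
have mh n : measurable_fun setT (fun x => (h n x)%:E).
  by apply/measurable_EFinP.
transitivity (limn (fun n => \int[m1]_x (h n x)%:E)%E).
  rewrite -monotone_convergence//.
  - by apply: eq_integral => x _; apply/esym/cvg_lim => //; exact: hc.
  - by move=> n x _; rewrite lee_fin.
  - by move=> x _ a b ab; exact: ndh.
under eq_fun do rewrite key.
have cv (m' : {measure set T -> \bar R}) : (\int[m']_x (h n x)%:E)%E @[n --> \oo] --> (\int[m']_x f x)%E.
  have := @cvg_monotone_convergence _ _ _ m' _ measurableT (fun n x => (h n x)%:E) mh.
  have -> : (fun x => limn (fun n => (h n x)%:E)) = f.
    by apply/funext => x; apply/cvg_lim => //; exact: hc.
  apply.
  - by move=> n x _; rewrite lee_fin.
  - by move=> x _ a b ab; exact: ndh.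
have cv' : (\int[m]_x ((h n x)%:E * (g x)%:E))%E @[n --> \oo] --> (\int[m]_x (f x * (g x)%:E))%E.
  have := @cvg_monotone_convergence _ _ _ m _ measurableT (fun n x => (h n x)%:E * (g x)%:E)%E.
  have -> : (fun x => limn (fun n => (h n x)%:E * (g x)%:E))%E = (fun x => f x * (g x)%:E)%E.
    apply/funext => x; apply/cvg_lim => //.
    by apply: cvgeZr => //; exact: hc.
  apply.
  - by move=> n; apply: emeasurable_funM.
  - by move=> n x _; rewrite mule_ge0// lee_fin.
  - by move=> x _ a b ab; rewrite lee_wpmul2r//; exact: ndh.
apply/cvg_lim => //; apply: cvgeD => //.
by apply: ge0_adde_def; rewrite inE; apply: integral_ge0 => x _; rewrite ?mule_ge0.
Qed.

End integral_tools.

(** * Affine changes of variables and local integrability *)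

(* The measure structure of [pushforward] is indexed by a measurability proof,
   which has to be supplied through the canonical instance. *)
Definition image_measure d d' (T1 : measurableType d) (T2 : measurableType d')
    (R : realType) (m : {measure set T1 -> \bar R}) (f : T1 -> T2)
    (mf : measurable_fun [set: T1] f) : {measure set T2 -> \bar R} :=
  measure_function_pushforward__canonical__measure_function_Measure m mf.

Lemma ge0_integral_image d d' (T1 : measurableType d) (T2 : measurableType d')
    (R : realType) (m : {measure set T1 -> \bar R}) (f : T1 -> T2)
    (mf : measurable_fun [set: T1] f) (g : T2 -> \bar R) :
  measurable_fun setT g -> (forall x, (0 <= g x)%E) ->
  (\int[image_measure m mf]_x g x = \int[m]_x g (f x))%E.
Proof.
move=> mg g0; rewrite /image_measure.
by rewrite (ge0_integral_pushforward mf)//= preimage_setT.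
Qed.

Section line_tools.
Context (R : realType).
Notation mu := (@lebesgue_measure R).
Implicit Types (f g : R -> R) (a b c : R).

Lemma measurable_affine c b : measurable_fun [set: R] (fun x : R => c * x + b).
Proof. by apply: measurable_funD => //; exact: measurable_funM. Qed.

(** The image of Lebesgue measure under the affine map, multiplied by |c|, gives every interval []u,
    v]] its length, hence it is Lebesgue measure. The sign of c decides which end of the preimage is
    closed. *)
Lemma ge0_integral_affine c b (f : R -> \bar R) : c != 0 ->
  measurable_fun setT f -> (forall x, (0 <= f x)%E) ->
  (\int[mu]_x f (c * x + b)%R = (`|c|^-1)%:E * \int[mu]_x f x)%E.
Proof.
move=> c0 mf f0.
pose aff : R -> measurableTypeR R := fun x => c * x + b.
have maff : measurable_fun setT aff by exact: measurable_affine.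
pose nu : {measure set (measurableTypeR R) -> \bar R} :=
  mscale (NngNum (normr_ge0 c)) (image_measure mu maff).
have E A : measurable A -> mu A = nu A.
  move=> mA; apply: lebesgue_measure_unique => //= _ [[u v]] /= uv <-.
  rewrite /mscale/= /pushforward/= lebesgue_measure_itv/= lte_fin.
  have [c1|c1] : c > 0 \/ c < 0 by apply/orP; rewrite orbC -neq_lt.
  - have -> : aff @^-1` `]u, v]%classic = `](u - b) / c, (v - b) / c]%classic.
      apply/seteqP; split => x /=; rewrite !in_itv/= /aff;
        by rewrite ltr_pdivrMr// ler_pdivlMr// ltrBlDr lerBrDr (mulrC x).
    rewrite lebesgue_measure_itv/= lte_fin ltr_pM2r ?invr_gt0// ltrD2r.
    case: ifP => _; last by rewrite mule0.
    by rewrite -!EFinD -EFinM gtr0_norm//; congr EFin; field; rewrite gt_eqF.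
  - have -> : aff @^-1` `]u, v]%classic = `[(v - b) / c, (u - b) / c[%classic.
      apply/seteqP; split => x /=; rewrite !in_itv/= /aff;
        by rewrite ltr_ndivlMr// ler_ndivrMr// ltrBlDr lerBrDr (mulrC x) andbC.
    rewrite lebesgue_measure_itv/= lte_fin ltr_nM2r ?invr_lt0// ltrD2r.
    case: ifP => _; last by rewrite mule0.
    by rewrite -!EFinD -EFinM ltr0_norm//; congr EFin; field; rewrite lt_eqF.
have -> : (\int[mu]_x f x = \int[nu]_x f x)%E.
  by apply: eq_measure_integral => A mA _; exact: E.
rewrite ge0_integral_mscale//= ge0_integral_image//.
by rewrite muleA -EFinM mulVf ?normr_eq0// mul1e.
Qed.

Lemma integral_affine c b (f : R -> \bar R) : c != 0 ->
  mu.-integrable setT f ->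
  (\int[mu]_x f (c * x + b)%R = (`|c|^-1)%:E * \int[mu]_x f x)%E.
Proof.
move=> c0 fi; have mf := measurable_int _ fi.
rewrite integralE [in RHS]integralE muleBr//; last first.
  by apply: fin_num_adde_defr; exact: integrable_pos_fin_num.
congr (_ - _)%E.
  rewrite -(ge0_integral_affine b c0)//; last exact: measurable_funepos.
  by apply: eq_integral => x _; rewrite !funeposE.
rewrite -(ge0_integral_affine b c0)//; last exact: measurable_funeneg.
by apply: eq_integral => x _; rewrite !funenegE.
Qed.

Lemma integrable_affine c b f : c != 0 ->
  mu.-integrable setT (EFin \o f) ->
  mu.-integrable setT (EFin \o (fun x => f (c * x + b))).
Proof.
move=> c0 /integrableP[mf fi]; apply/integrableP; split.
  exact: (measurableT_comp mf (measurable_affine c b)).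
rewrite (_ : (\int[mu]_x _)%E = \int[mu]_x (abse \o (EFin \o f)) (c * x + b)%R)%E//.
rewrite ge0_integral_affine//; last 2 first.
  exact: measurableT_comp.
  by move=> x; exact: abse_ge0.
by rewrite lte_mul_pinfty// ?lee_fin ?invr_ge0.
Qed.

Lemma Rintegral_affine c b f : c != 0 ->
  mu.-integrable setT (EFin \o f) ->
  \int[mu]_x f (c * x + b) = `|c|^-1 * \int[mu]_x f x.
Proof.
move=> c0 fi; rewrite /Rintegral (@integral_affine c b (EFin \o f))//.
by rewrite fineM//; exact: integrable_fin_num.
Qed.

Lemma integrable_itv f a b : locally_integrable setT f ->
  mu.-integrable `[a, b] (EFin \o f).
Proof.
move=> [mf _ /(_ `[a, b]%classic (@subsetT _ _) (@segment_compact _ _ _)) fi].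
apply/integrableP; split => //.
exact/measurable_funTS/measurable_EFinP.
Qed.

Lemma compact_sub_itv (K : set R) : compact K -> exists M, K `<=` `[- M, M]%classic.
Proof.
move=> /compact_bounded[M [_ MP]]; exists (M + 1) => x Kx.
rewrite /= in_itv/= -ler_norml; apply: MP => //.
by rewrite ltrDl.
Qed.

Lemma locally_integrable_itv f : measurable_fun setT f ->
  (forall M, mu.-integrable `[- M, M] (EFin \o f)) -> locally_integrable setT f.
Proof.
move=> mf fi; split => //; first exact: openT.
move=> K _ cK; have [M KM] := compact_sub_itv cK.
have mK : measurable K by exact: compact_measurable.
have fK : mu.-integrable K (EFin \o f) by apply: integrableS (fi M).
by case/integrableP : fK.
Qed.

Lemma locally_integrable_of_integrable f :
  mu.-integrable setT (EFin \o f) -> locally_integrable setT f.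
Proof. by apply: open_integrable_locally; exact: openT. Qed.

Lemma locally_integrable_continuous f : continuous f -> locally_integrable setT f.
Proof.
move=> cf; apply: locally_integrable_itv; first exact: continuous_measurable_fun.
move=> M; apply: continuous_compact_integrable; first exact: segment_compact.
by apply: continuous_subspaceT.
Qed.

Lemma integrable_sqr_itv f a b : measurable_fun setT f ->
  mu.-integrable setT (EFin \o (fun x => f x ^+ 2)) -> mu.-integrable `[a, b] (EFin \o f).
Proof.
move=> mf f2.
have f2' : mu.-integrable `[a, b] (EFin \o (fun x => f x ^+ 2)).
  by apply: integrableS f2.
rewrite (_ : EFin \o f = EFin \o (fun x => 1 * f x)); last first.
  by apply/funext => x /=; rewrite mul1r.
apply: (integrable_mul_of_mul_sqr (k := fun=> 1)) => //.
- exact: measurable_funTS.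
- apply: integrable_itv; apply: locally_integrable_continuous => x; exact: cvg_cst.
- by rewrite (_ : _ \o _ = EFin \o (fun x => f x ^+ 2))//; apply/funext => x /=; rewrite mul1r.
Qed.

Lemma L2P f : L2 f <-> measurable_fun setT f /\
  mu.-integrable setT (EFin \o (fun x => f x ^+ 2)).
Proof.
split.
  move=> f2; split; last exact: Lfun2_integrable_sqr.
  by move: f2; rewrite /L2 inE => /andP[]; rewrite inE.
move=> [mf /integrableP[_ i2]]; rewrite /L2 inE; apply/andP; split; rewrite inE//=.
rewrite /finite_norm unlock poweR_lty//=.
apply: le_lt_trans i2; rewrite le_eqVlt; apply/orP; left; apply/eqP.
by apply: eq_integral => x _ /=; rewrite powR_mulrn// normrX.
Qed.

Lemma normL2E f : normL2 f = ((\int[mu]_x (f x ^+ 2)%:E) `^ 2^-1)%E.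
Proof.
rewrite /normL2 unlock; congr (_ `^ _)%E; apply: eq_integral => x _ /=.
by rewrite powR_mulrn// real_normK// num_real.
Qed.

Lemma L2_locally_integrable f : L2 f -> locally_integrable setT f.
Proof.
move=> /L2P[mf f2]; apply: locally_integrable_itv => // M.
exact: integrable_sqr_itv.
Qed.

End line_tools.

(** * Primitives and integration by parts *)

Section dominated_fubini.
Context d1 d2 (T1 : measurableType d1) (T2 : measurableType d2) (R : realType).
Variables (m1 : {sigma_finite_measure set T1 -> \bar R}).
Variables (m2 : {sigma_finite_measure set T2 -> \bar R}).
Variables (h : T1 -> T2 -> R) (A : T1 -> R) (B : T2 -> R).
Hypothesis mh : measurable_fun setT (fun z : T1 * T2 => h z.1 z.2).
Hypothesis iA : m1.-integrable setT (EFin \o A).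
Hypothesis iB : m2.-integrable setT (EFin \o B).
Hypothesis hAB : forall x y, `|h x y| <= A x * B y.

Let mh2 x : measurable_fun setT (h x).
Proof. exact: (measurableT_comp mh (measurable_pair1 x)). Qed.

Let mh1 y : measurable_fun setT (h ^~ y).
Proof. exact: (measurableT_comp mh (measurable_pair2 y)). Qed.

Let iZl (d : measure_display) (T : measurableType d) (m : {measure set T -> \bar R})
  (c : R) (C : T -> R) : m.-integrable setT (EFin \o C) ->
  m.-integrable setT (EFin \o (fun y => c * C y)).
Proof. by move=> iC; exact: (integrableZl measurableT c iC). Qed.

Lemma fubini_integrable2 x : m2.-integrable setT (EFin \o h x).
Proof.
apply: (le_integrable _ _ _ (iZl (A x) iB)) => //; first exact/measurable_EFinP.
by move=> y _ /=; rewrite lee_fin (le_trans (hAB x y))// ler_norm.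
Qed.

Lemma fubini_integrable1 y : m1.-integrable setT (EFin \o (h ^~ y)).
Proof.
apply: (le_integrable _ _ _ (iZl (B y) iA)) => //; first exact/measurable_EFinP.
by move=> x _ /=; rewrite lee_fin (le_trans (hAB x y))// mulrC ler_norm.
Qed.

(** Domination by A(x) B(y) bounds the iterated integral of |h| by a product of two finite
    integrals. *)
Lemma fubini_integrable :
  (m1 \x m2)%E.-integrable setT (fun z => (h z.1 z.2)%:E).
Proof.
have mhe : measurable_fun setT (fun z : T1 * T2 => (h z.1 z.2)%:E).
  exact/measurable_EFinP.
apply/integrable12ltyP => //=.
have iB' := integrable_abse iB; have iA' := integrable_abse iA.
apply: (@le_lt_trans _ _ (\int[m1]_x \int[m2]_y (`|A x|%:E * `|B y|%:E))%E).
  have mAB : measurable_fun setT (fun z : T1 * T2 => (`|A z.1|%:E * `|B z.2|%:E)%E).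
    apply: emeasurable_funM.
      by apply: (measurableT_comp (measurable_int _ iA')); exact: measurable_fst.
    by apply: (measurableT_comp (measurable_int _ iB')); exact: measurable_snd.
  apply: ge0_le_integral => //.
  - by move=> x _; exact: integral_ge0.
  - by apply: (measurable_fun_fubini_tonelli_F (fun z : T1 * T2 => (`|(h z.1 z.2)%:E|)%E)) => //;
      exact: measurableT_comp.
  - by apply: (measurable_fun_fubini_tonelli_F (fun z : T1 * T2 => (`|A z.1|%:E * `|B z.2|%:E)%E)).
  move=> x _; apply: ge0_le_integral => //.
  - have me2 : measurable_fun setT (EFin \o h x) by exact/measurable_EFinP.
    exact: (measurableT_comp (@abse_measurable R setT) me2).
  - by apply: emeasurable_funM => //; exact: (measurable_int _ iB').
  move=> y _; rewrite lee_fin (le_trans (hAB x y))// (le_trans (ler_norm _))//.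
  by rewrite normrM.
have mB : measurable_fun setT (fun y => `|B y|%:E) by exact: (measurable_int _ iB').
rewrite (eq_integral (fun x => `|A x|%:E * \int[m2]_y `|B y|%:E)%E); last first.
  by move=> x _; rewrite ge0_integralZl// => *; rewrite lee_fin.
rewrite ge0_integralZr//=; last 2 first.
  exact: (measurable_int _ iA').
  exact: integral_ge0.
rewrite lte_mul_pinfty//.
- exact: integral_ge0.
- by move/integrableP: iA => [_ ?]; rewrite ge0_fin_numE//; exact: integral_ge0.
- by move/integrableP: iB => [].
Qed.

Lemma Rintegral_fubini :
  \int[m1]_x (\int[m2]_y h x y) = \int[m2]_y (\int[m1]_x h x y).
Proof.
rewrite /Rintegral; congr fine.
have := Fubini fubini_integrable => /= E.
transitivity (\int[m1]_x \int[m2]_y (h x y)%:E)%E.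
  apply: eq_integral => x _; rewrite fineK//.
  by apply: integrable_fin_num => //; exact: fubini_integrable2.
rewrite E; apply: eq_integral => y _; rewrite fineK//.
by apply: integrable_fin_num => //; exact: fubini_integrable1.
Qed.

End dominated_fubini.

Lemma Rintegral_eq0 d (T : measurableType d) (R : realType)
    (m : {measure set T -> \bar R}) (D : set T) (f : T -> R) :
  (forall x, D x -> f x = 0) -> \int[m]_(x in D) f x = 0.
Proof. by move=> f0; rewrite /Rintegral integral0_eq// => x Dx; rewrite f0. Qed.

Section primitives.
Context (R : realType).
Notation mu := (@lebesgue_measure R).
Implicit Types (f g F G : R -> R) (a b c : R).

(** Absolute continuity in integrated form. Shifts, differences and composition with y preserve it
    without any pointwise derivative. *)
Definition is_primitive f g := locally_integrable setT g /\
  forall a b, a <= b -> f b - f a = \int[mu]_(x in `[a, b]) g x.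

Lemma integrable_patch (D : set R) f : measurable D ->
  mu.-integrable D (EFin \o f) -> mu.-integrable setT (EFin \o (f \_ D)).
Proof.
by move=> mD fi; rewrite -restrict_EFin; apply/integrable_restrict => //=; rewrite setTI.
Qed.

Lemma is_primitiveB f g F G : is_primitive f g -> is_primitive F G ->
  is_primitive (fun x => f x - F x) (fun x => g x - G x).
Proof.
move=> [lg fg] [lG FG]; split; first exact: locally_integrableB.
move=> a b ab; rewrite RintegralB//; [|exact: integrable_itv|exact: integrable_itv].
by rewrite -fg// -FG//; ring.
Qed.

Lemma is_primitive_id : is_primitive id (cst 1).
Proof.
split; first by apply: locally_integrable_continuous => x; exact: cvg_cst.
move=> a b ab; rewrite Rintegral_cst//= lebesgue_measure_itv/= lte_fin mul1r.
by case: ltgtP ab => //= ->; rewrite subrr.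
Qed.

(** The densities are merely locally integrable, so the formula comes from Fubini for f(s) g(x) on
    the triangle a <= s <= x <= b rather than from a product rule. *)
Lemma Rintegral_by_parts F f G g a b : a <= b ->
  is_primitive F f -> is_primitive G g ->
  mu.-integrable `[a, b] (EFin \o (fun x => F x * g x)) ->
  mu.-integrable `[a, b] (EFin \o (fun x => f x * G x)) ->
  \int[mu]_(x in `[a, b]) (F x * g x) + \int[mu]_(x in `[a, b]) (f x * G x) =
  F b * G b - F a * G a.
Proof.
move=> ab pF pG iFg ifG.
have [lf Ff] := pF; have [lg Gg] := pG.
pose f1 := f \_ `[a, b]; pose g1 := g \_ `[a, b].
have if1 : mu.-integrable setT (EFin \o f1).
  by apply: integrable_patch => //; exact: integrable_itv.
have ig1 : mu.-integrable setT (EFin \o g1).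
  by apply: integrable_patch => //; exact: integrable_itv.
have mf1 : measurable_fun setT f1 by apply/measurable_EFinP; exact: (measurable_int _ if1).
have mg1 : measurable_fun setT g1 by apply/measurable_EFinP; exact: (measurable_int _ ig1).
pose h x s := g1 x * f1 s * ((s <= x)%R : bool)%:R.
have mh : measurable_fun setT (fun z : R * R => h z.1 z.2).
  apply: measurable_funM; first apply: measurable_funM.
  - exact: (measurableT_comp mg1 measurable_fst).
  - exact: (measurableT_comp mf1 measurable_snd).
  - rewrite (_ : (fun z : R * R => _) = \1_[set z : R * R | z.2 <= z.1]); last first.
      by apply/funext => z; rewrite indicE mem_setE.
    apply: measurable_indic; rewrite -[X in measurable X]setTI.
    by apply: measurable_fun_le.
have := @Rintegral_fubini _ _ _ _ _ mu mu h (fun x => `|g1 x|) (fun x => `|f1 x|) mh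
  (integrable_abse ig1) (integrable_abse if1).
have hb x y : `|h x y| <= `|g1 x| * `|f1 y|.
  rewrite /h !normrM; case: (y <= x); first by rewrite normr1 mulr1.
  by rewrite normr0 mulr0 mulr_ge0.
move=> /(_ hb).
have -> : \int[mu]_x \int[mu]_y h x y = \int[mu]_(x in `[a, b]) (F x * g x - F a * g x).
  rewrite [RHS]Rintegral_mkcond; apply: eq_Rintegral => x _.
  rewrite patchE; case: ifPn => xab; last first.
    apply: Rintegral_eq0 => y _; by rewrite /h /g1 patchE (negbTE xab) !mul0r.
  move: (xab); rewrite mem_setE/= in_itv/= => /andP[ax xb].
  rewrite -mulrBl Ff//.
  rewrite -[X in X = _]/(\int[mu]_y (h x y)).
  rewrite [in RHS]Rintegral_mkcond mulrC -RintegralZl//; last first.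
    by apply: integrable_patch => //; exact: integrable_itv.
  apply: eq_Rintegral => s _; rewrite /h /g1 /f1 !patchE xab -mulrA; congr (_ * _).
  rewrite !mem_setE/= !in_itv/=.
  case: (leP a s) => //= as_; last by rewrite mul0r.
  case: (leP s x) => sx; last by rewrite mulr0.
  by rewrite mulr1 (le_trans sx xb).
have -> : \int[mu]_y \int[mu]_x h x y = \int[mu]_(s in `[a, b]) (G b * f s - f s * G s).
  rewrite [RHS]Rintegral_mkcond; apply: eq_Rintegral => s _.
  rewrite patchE; case: ifPn => sab; last first.
    by apply: Rintegral_eq0 => y _; rewrite /h /f1 patchE (negbTE sab) mulr0 !mul0r.
  move: (sab); rewrite mem_setE/= in_itv/= => /andP[as_ sb].
  rewrite (mulrC (f s)) -mulrBl Gg//.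
  rewrite [in RHS]Rintegral_mkcond mulrC -RintegralZl//; last first.
    by apply: integrable_patch => //; exact: integrable_itv.
  apply: eq_Rintegral => x _; rewrite /h /g1 /f1 !patchE sab mulrAC mulrC; congr (_ * _).
  rewrite !mem_setE/= !in_itv/=.
  case: (leP s x) => sx; last by rewrite mulr0.
  by rewrite mulr1 (le_trans as_ sx).
have iZ c (k : R -> R) : mu.-integrable `[a, b] (EFin \o k) ->
    mu.-integrable `[a, b] (EFin \o (fun x => c * k x)).
  by move=> ik; apply: (integrableZl _ c ik).
rewrite !RintegralB//; try by apply: iZ; exact: integrable_itv.
rewrite !RintegralZl//; try exact: integrable_itv.
by rewrite -Ff// -Gg// => E; lra.
Qed.

End primitives.

(** * Primitives, a.e. differentiation and weak derivatives *)

Section primitives_ae.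
Context (R : realType).
Notation mu := (@lebesgue_measure R).
Implicit Types (f g F G : R -> R) (a b c : R).

(** Lebesgue points of g. The limit is taken along steps 1/(k+1), the form needed for dominated
    convergence of difference quotients; it also determines the density a.e. *)
Lemma is_primitive_ae_cvg f g : is_primitive f g ->
  {ae mu, forall x, (fun k : nat => k.+1%:R * (f (x + k.+1%:R^-1) - f x)) @ \oo --> g x}.
Proof.
move=> pf; have [lg fg] := pf.
have := lebesgue_differentiation lg.
apply: filterS; first exact: (ae_filter_ringOfSetsType mu).
move=> x lx.
(* Basing the integral at x - 1 makes x an interior point; the resulting primitive differs from f by
   the constant f(x - 1). *)
have [||dF F'x] := @FTC1_lebesgue_pt R g (BLeft (x - 1)) x (x + 1) _ (integrable_itv _ _ lg) _ lx.
- by rewrite ltrDl.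
- by rewrite /= ?lte_fin ?bnd_simp; lra.
set F := fun y => _ in dF F'x.
have cF : h^-1 *: (F (h *: 1 + x) - F x) @[h --> 0^'] --> g x.
  by rewrite -F'x derive1E; exact: dF.
have c0 : (fun k : nat => k.+1%:R^-1 : R) @ \oo --> 0^'.
  have c1 := @cvg_harmonic R.
  move=> A /c1[n _ nP]; exists n => // k /nP; apply.
  by rewrite /harmonic invr_eq0 pnatr_eq0.
have := cvg_comp _ _ c0 cF; apply: cvg_trans; apply: near_eq_cvg.
apply: nearW => k /=; rewrite invrK /GRing.scale/= mulr1.
have k0 : 0 < k.+1%:R^-1 :> R by rewrite invr_gt0.
congr (_ * _); rewrite (addrC x).
have x1 : x - 1 <= x by rewrite lerBlDr lerDl.
have x2 : x - 1 <= k.+1%:R^-1 + x by rewrite (le_trans x1)// lerDr ltW.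
by rewrite /F -(fg _ _ x1) -(fg _ _ x2); ring.
Qed.

Lemma is_primitive_ae_eq f g G : is_primitive f g -> is_primitive f G ->
  {ae mu, forall x, g x = G x}.
Proof.
move=> /is_primitive_ae_cvg + /is_primitive_ae_cvg; apply: filterS2.
  exact: (ae_filter_ringOfSetsType mu).
move=> x c1 c2.
by rewrite -(cvg_lim _ c1)// -(cvg_lim _ c2).
Qed.

Lemma smooth_derivable f x : smooth f -> derivable f x 1.
Proof. by move=> /(_ 0%N x). Qed.

Lemma smooth_derive1 f : smooth f -> smooth (derive1 f).
Proof. by move=> sf n x; have := sf n.+1 x; rewrite derive1Sn. Qed.

Lemma smooth_continuous f : smooth f -> continuous f.
Proof.
by move=> sf x; apply: differentiable_continuous; apply/derivable1_diffP; exact: smooth_derivable.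
Qed.

Lemma is_primitive_derive1 f : (forall x, derivable f x 1) -> continuous (derive1 f) ->
  is_primitive f (derive1 f).
Proof.
move=> df cf; split; first exact: locally_integrable_continuous.
move=> a b; rewrite le_eqVlt => /predU1P[->|ab].
  by rewrite set_itv1 Rintegral_set1 subrr.
have cf' : {within `[a, b], continuous (derive1 f)} by exact: continuous_subspaceT.
suff dfo : derivable_oo_LRcontinuous f a b.
  have E := continuous_FTC2 ab cf' dfo (fun x _ => erefl).
  by rewrite /Rintegral E.
- have cff x : {for x, continuous f}.
    by apply: differentiable_continuous; exact/derivable1_diffP.
  split => //; first by apply: cvg_at_right_filter; exact: cff.
  by apply: cvg_at_left_filter; exact: cff.
Qed.

Lemma derive1_eq0 f (K : R) : (forall x, K <= `|x| -> f x = 0) ->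
  forall x, K < `|x| -> derive1 f x = 0.
Proof.
move=> f0 x Kx; rewrite derive1E.
rewrite (@near_eq_derive _ _ _ f (cst 0))//; first by rewrite derive_cst.
have : \forall y \near x, K < `|y|.
  by apply: (cvgr_gt _ (@norm_continuous _ _ x)).
by apply: filterS => y Ky; rewrite f0// ltW.
Qed.

Lemma Ccinfty_bounded_support f : Ccinfty f -> exists2 K, 0 < K &
  forall x, K <= `|x| -> f x = 0 /\ derive1 f x = 0.
Proof.
move=> [sf cf]; have [M MP] := compact_sub_itv cf.
have f0 x : `|M| + 1 <= `|x| -> f x = 0.
  move=> xM; apply: contrapT => /eqP fx.
  have /MP /= : closure [set x | f x != 0] x by apply: subset_closure.
  rewrite in_itv/= -ler_norml => xM'.
  by have := ler_norm M; lra.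
(* One more unit than for f alone: the derivative is known to vanish only strictly beyond
   [|M| + 1]. *)
exists (`|M| + 2); first by rewrite ltr_wpDl.
move=> x xM; split; first by apply: f0; lra.
by apply: (derive1_eq0 f0); lra.
Qed.

Lemma Rintegral_support f K : (forall x, K <= `|x| -> f x = 0) ->
  \int[mu]_x f x = \int[mu]_(x in `[- K, K]) f x.
Proof.
move=> f0; rewrite [RHS]Rintegral_mkcond; apply: eq_Rintegral => x _.
rewrite patchE; case: ifPn => //; rewrite mem_setE/= in_itv/= -ler_norml -ltNge.
by move=> /ltW /f0.
Qed.

Lemma integrableM_continuous f g a b : continuous f -> locally_integrable setT g ->
  mu.-integrable `[a, b] (EFin \o (fun x => f x * g x)).
Proof.
move=> cf lg; have ig := integrable_itv a b lg.
have [M [_ MP]] : bounded_set (f @` `[a, b]).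
  apply/compact_bounded/continuous_compact; last exact: segment_compact.
  exact: continuous_subspaceT.
apply: (le_integrable _ _ _ (integrableZl _ (M + 1) ig)) => //.
  apply/measurable_EFinP/measurable_funM; last by case: lg => + _ _; exact: measurable_funTS.
  by apply: measurable_funTS; exact: continuous_measurable_fun.
move=> x xab /=; rewrite lee_fin !normrM ler_wpM2r//.
rewrite (le_trans (MP (M + 1) _ (f x) _)) ?ler_norm// ?ltrDl//.
Qed.

(** Integration by parts on [-K, K], where the boundary terms vanish with the test function. *)
Lemma is_primitive_wderiv f g : continuous f -> is_primitive f g -> is_wderiv f g.
Proof.
move=> cf pf; have [lg fg] := pf; split => //; first exact: locally_integrable_continuous.
move=> phi cphi; have [K K0 KP] := Ccinfty_bounded_support cphi.
have [sphi _] := cphi.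
have cphi0 := smooth_continuous sphi.
have cphi1 := smooth_continuous (smooth_derive1 sphi).
rewrite !(@Rintegral_support _ K); last 2 first.
- by move=> x /KP[-> _]; rewrite mulr0.
- by move=> x /KP[_ ->]; rewrite mulr0.
have := @Rintegral_by_parts R f g phi (derive1 phi) (- K) K.
have -> : phi K = 0 by apply KP; rewrite gtr0_norm.
have -> : phi (- K) = 0 by apply KP; rewrite normrN gtr0_norm.
move=> /(_ _ pf) E; apply/eqP; rewrite -addr_eq0 E//.
- by rewrite !mulr0 subrr.
- by rewrite ge0_cp// ltW.
- exact: (is_primitive_derive1 (fun x => smooth_derivable (x := x) sphi) cphi1).
- by apply: integrableM_continuous => //; exact: locally_integrable_continuous.
- rewrite (_ : _ \o _ = EFin \o (fun x => phi x * g x)); first exact: integrableM_continuous.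
  by apply/funext => x /=; rewrite mulrC.
Qed.

End primitives_ae.

(** * Mollifiers *)

Section mollifier.
Context (R : realType) (phi : R -> R).
Notation mu := (@lebesgue_measure R).
Hypothesis hphi : friedrichs phi.
Implicit Types (f g : R -> R) (a b c x z : R).

Lemma friedrichs_smooth : smooth phi.
Proof. by case: hphi => -[]. Qed.

Lemma friedrichs_continuous : continuous phi.
Proof. exact: smooth_continuous friedrichs_smooth. Qed.

Lemma friedrichs_measurable : measurable_fun setT phi.
Proof. exact: continuous_measurable_fun friedrichs_continuous. Qed.

Lemma friedrichs_ge0 x : 0 <= phi x.
Proof. by case: hphi => _ []. Qed.

Lemma friedrichs_support x : 1 <= `|x| -> phi x = 0.
Proof.
case: hphi => _ _ _ _ supp; have S z : 1 < `|z| -> phi z = 0.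
  move=> z1; apply: contrapT => /eqP pz.
  have : closure [set x | phi x != 0] z by exact: subset_closure.
  by rewrite supp /= in_itv/= -ler_norml leNgt z1.
rewrite le_eqVlt => /predU1P[x1|]; last exact: S.
have cphi : {for x, continuous phi} by exact: friedrichs_continuous.
(* At 1 and -1 the closure of the support does not give the value. Points approaching from outside
   do, by continuity. *)
have c1 : (fun k : nat => x + Num.sg x * k.+1%:R^-1) @ \oo --> x.
  rewrite -[X in _ --> X]addr0 -[X in _ --> _ + X](mulr0 (Num.sg x)).
  by apply: cvgD; [exact: cvg_cst|apply: cvgM; [exact: cvg_cst|exact: cvg_harmonic]].
have := cvg_comp _ _ c1 cphi.
have -> : phi \o (fun k : nat => x + Num.sg x * k.+1%:R^-1) = cst 0.
  apply/funext => k /=; apply: S.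
  have : 0 < k.+1%:R^-1 :> R by rewrite invr_gt0.
  move: (k.+1%:R^-1) => e e0.
  have [x0|x0] : x = 1 \/ x = -1.
    by move: x1; case: (ger0P x) => _; [left|right; lra].
  - by rewrite x0 sgr1 mul1r gtr0_norm; lra.
  - by rewrite x0 sgrN sgr1 mulN1r ltr0_norm; lra.
by move=> /(cvg_lim (@Rhausdorff R)) <-; rewrite lim_cst.
Qed.

Lemma friedrichs_integrable : mu.-integrable setT (EFin \o phi).
Proof.
case: hphi => _ _ + _ _; rewrite Lnorm1 => N1.
apply/integrableP; split; first by apply/measurable_EFinP; exact: friedrichs_measurable.
by rewrite N1 ltry.
Qed.

Lemma friedrichs_Rintegral : \int[mu]_x phi x = 1.
Proof.
case: hphi => _ _ + _ _; rewrite Lnorm1 => N1.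
rewrite /Rintegral; rewrite (_ : (\int[mu]_x _)%E = 1%E)// -N1.
by apply: eq_integral => x _; rewrite /= ger0_norm// friedrichs_ge0.
Qed.

Lemma friedrichs_integral : (\int[mu]_x (phi x)%:E = 1)%E.
Proof.
have := friedrichs_Rintegral; rewrite /Rintegral => E.
rewrite -[LHS]fineK ?E//; exact: (integrable_fin_num _ friedrichs_integrable).
Qed.

(** A smooth step rising from 0 at -1 to 1 at 1. Test functions are built from it, so the mollifier
    supplies its own cut-offs. *)
Definition mollifier_cdf x := \int[mu]_(t in `]-oo, x]) phi t.

Lemma mollifier_cdf_derivable x : derivable mollifier_cdf x 1.
Proof.
have i1 : mu.-integrable `]-oo, (x + 1)] (EFin \o phi).
  by apply: integrableS friedrichs_integrable.
have xu : x < x + 1 by rewrite ltrDl.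
by have [] := continuous_FTC1 xu i1 (ltNyr _) (@friedrichs_continuous x).
Qed.

Lemma mollifier_cdf_derive1 x : derive1 mollifier_cdf x = phi x.
Proof.
have i1 : mu.-integrable `]-oo, (x + 1)] (EFin \o phi).
  by apply: integrableS friedrichs_integrable.
have xu : x < x + 1 by rewrite ltrDl.
by have [] := continuous_FTC1 xu i1 (ltNyr _) (@friedrichs_continuous x).
Qed.

Lemma mollifier_cdf_smooth : smooth mollifier_cdf.
Proof.
case=> [|n] x; first exact: mollifier_cdf_derivable.
rewrite derive1Sn (_ : derive1 mollifier_cdf = phi).
  exact: friedrichs_smooth.
by apply/funext => y; exact: mollifier_cdf_derive1.
Qed.

Lemma mollifier_cdf_ge0 x : 0 <= mollifier_cdf x.
Proof. by apply: Rintegral_ge0 => y _; exact: friedrichs_ge0. Qed.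

Lemma mollifier_cdf_le1 x : mollifier_cdf x <= 1.
Proof.
rewrite -friedrichs_Rintegral /mollifier_cdf Rintegral_mkcond.
apply: le_Rintegral => //.
- by apply: integrable_patch => //; apply: integrableS friedrichs_integrable.
- exact: friedrichs_integrable.
- by move=> y _; rewrite patchE; case: ifP => // _; exact: friedrichs_ge0.
Qed.

Lemma mollifier_cdf0 x : x <= -1 -> mollifier_cdf x = 0.
Proof.
move=> x1; apply: Rintegral_eq0 => y /=; rewrite in_itv/= => yx.
by apply: friedrichs_support; rewrite ler0_norm; lra.
Qed.

Lemma mollifier_cdf1 x : 1 <= x -> mollifier_cdf x = 1.
Proof.
move=> x1; rewrite -friedrichs_Rintegral /mollifier_cdf Rintegral_mkcond.
apply: eq_Rintegral => y _; rewrite patchE; case: ifPn => //.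
rewrite mem_setE/= in_itv/= -ltNge => xy.
by rewrite friedrichs_support// ger0_norm; lra.
Qed.

End mollifier.

(** * Smooth functions under affine changes of variable *)

Section smooth_tools.
Context (R : realType).
Implicit Types (f g : R -> R) (a b c x z : R).

Lemma is_derive_affine f c b x : derivable f (c * x + b) 1 ->
  is_derive x 1 (fun x => f (c * x + b)) (c * derive1 f (c * x + b)).
Proof.
move=> df.
have da : is_derive x 1 (fun x : R => c * x + b) c.
  by apply: is_derive_eq; rewrite /GRing.scale/= mulr1 addr0.
have df' : is_derive (c * x + b) 1 f (derive1 f (c * x + b)).
  by rewrite derive1E; exact/derivableP.
have := @is_derive1_comp R f (fun x => c * x + b) x _ _ df' da.
by rewrite mulrC.
Qed.

Lemma derive1n_affine f c b n : smooth f ->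
  derive1n n (fun x => f (c * x + b)) = (fun x => c ^+ n * derive1n n f (c * x + b)).
Proof.
move=> sf; elim: n => [|n IH]; first by apply/funext => x; rewrite mul1r.
rewrite derive1nS IH; apply/funext => x; rewrite derive1E.
have d1 := @is_derive_affine (derive1n n f) c b x (sf n _).
have := @is_deriveZ _ _ _ _ (c ^+ n) _ _ _ d1.
move=> /@derive_val ->; rewrite derive1nS /GRing.scale/= mulrA exprSr.
by [].
Qed.

Lemma smooth_affine f c b : smooth f -> smooth (fun x => f (c * x + b)).
Proof.
move=> sf n x; rewrite derive1n_affine//; apply: derivableM => //.
by have [] := @is_derive_affine (derive1n n f) c b x (sf n _).
Qed.

Lemma smoothB f g : smooth f -> smooth g -> smooth (fun x => f x - g x).
Proof.
move=> sf sg.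
have E n : derive1n n (fun x => f x - g x) = (fun x => derive1n n f x - derive1n n g x).
  elim: n => [//|n IH]; rewrite derive1nS IH; apply/funext => x.
  by rewrite derive1E (deriveB (sf n x) (sg n x)) -!derive1E -!derive1nS.
by move=> n x; rewrite E; apply: derivableB.
Qed.

End smooth_tools.

(** * Weak derivatives of continuous functions *)

Section weak_derivative.
Context (R : realType) (phi : R -> R).
Notation mu := (@lebesgue_measure R).
Hypothesis hphi : friedrichs phi.
Implicit Types (f g v : R -> R) (a b c x z : R).
Let Phi := mollifier_cdf phi.

Lemma continuous_affine c b : continuous (fun z : R => c * z + b).
Proof.
by move=> z; apply: cvgD; [apply: cvgM; [exact: cvg_cst|exact: cvg_id]|exact: cvg_cst].
Qed.

Lemma friedrichs_mul_integrable v : locally_integrable setT v ->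
  mu.-integrable setT (EFin \o (fun z => phi z * v z)).
Proof.
move=> lv; have := integrable_patch (measurable_itv _)
  (integrableM_continuous (-1) 1 (friedrichs_continuous hphi) lv).
apply: eq_integrable => // x _ /=; rewrite patchE; case: ifPn => //.
rewrite mem_setE/= in_itv/= -ler_norml -ltNge => /ltW x1.
by rewrite (friedrichs_support hphi x1) mul0r.
Qed.

(** [phi] is a probability density carried by [-1, 1], so an average of values within e of c stays
    within e of c. Both the convergence of mollifications and the displacement bound for the
    mollified u rest on this. *)
Lemma mollifier_average v c e : locally_integrable setT v ->
  (forall z, `|z| <= 1 -> `|v z - c| <= e) ->
  `|\int[mu]_z (phi z * v z) - c| <= e.
Proof.
move=> lv ve.
have ip := friedrichs_integrable hphi.
have ipv := friedrichs_mul_integrable lv.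
have iZ k : mu.-integrable setT (EFin \o (fun x => k * phi x)).
  by apply: (integrableZl _ k ip).
have -> : \int[mu]_z (phi z * v z) - c = \int[mu]_z (phi z * v z - c * phi z).
  by rewrite RintegralB// RintegralZl// (friedrichs_Rintegral hphi) mulr1.
have id : mu.-integrable setT (EFin \o (fun z => phi z * v z - c * phi z)).
  exact: (integrableB _ ipv (iZ c)).
apply: (le_trans (le_normr_Rintegral _ id)) => //.
rewrite -[leRHS]mulr1 -(friedrichs_Rintegral hphi) -RintegralZl//.
apply: le_Rintegral => //; first exact: (integrable_abse id).
move=> z _; rewrite (mulrC c) -mulrBr normrM (ger0_norm (friedrichs_ge0 hphi z)) mulrC.
have [z1|z1] := leP `|z| 1; first by rewrite ler_wpM2r ?ve// friedrichs_ge0.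
by rewrite (friedrichs_support hphi (ltW z1)) !mulr0.
Qed.

Lemma mollify_change_var f n a : 0 < n -> continuous f ->
  \int[mu]_x (f x * (n * phi (n * x + - (n * a)))) =
  \int[mu]_z (phi z * f (n^-1 * z + a)).
Proof.
move=> n0 cf.
have cfa : continuous (fun z => f (n^-1 * z + a)).
  by move=> z; exact: (continuous_comp (@continuous_affine _ _ _) (cf _)).
have i1 := friedrichs_mul_integrable (locally_integrable_continuous cfa).
have E := Rintegral_affine (- (n * a)) (lt0r_neq0 n0) i1.
apply: (mulfI (lt0r_neq0 (_ : 0 < n^-1))); first by rewrite invr_gt0.
rewrite gtr0_norm// in E; rewrite -E -RintegralZl//; last first.
  have := integrableZl measurableT n (integrable_affine (- (n * a)) (lt0r_neq0 n0) i1).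
  apply: eq_integrable => // x _ /=; rewrite -EFinM; congr EFin.
  rewrite (_ : n^-1 * _ + a = x); first by ring.
  by field; rewrite gt_eqF.
apply: eq_Rintegral => x _; rewrite (_ : n^-1 * (_ + _) + a = x).
  by field; rewrite gt_eqF.
by field; rewrite gt_eqF.
Qed.

Lemma mollify_cvg f a : continuous f ->
  (fun k : nat => \int[mu]_x (f x * (k.+1%:R * phi (k.+1%:R * x + - (k.+1%:R * a))))) @ \oo
  --> f a.
Proof.
move=> cf; apply/cvgrPdist_le => e e0.
have /cvgrPdist_le /(_ _ e0) := cf a.
rewrite -nbhs_ballE => -[d /= d0 dP].
near=> k; have k0 : 0 < k.+1%:R :> R by [].
rewrite mollify_change_var// distrC; apply: mollifier_average.
  apply: locally_integrable_continuous => z.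
  exact: (continuous_comp (@continuous_affine _ _ _) (cf _)).
move=> z z1; rewrite distrC; apply: dP; rewrite /ball/= opprD addrCA subrr addr0 normrN normrM.
rewrite gtr0_norm ?invr_gt0//; apply: (@le_lt_trans _ _ k.+1%:R^-1).
  by rewrite -[leRHS]mulr1 ler_wpM2l// invr_ge0.
near: k; have /cvgrPdist_lt /(_ _ d0) := @cvg_harmonic R.
apply: filterS => k; rewrite sub0r normrN gtr0_norm//.
by rewrite /harmonic invr_gt0.
Unshelve. all: by end_near. Qed.

(* A smooth approximation of the indicator of [a, b] when n is large. *)
Definition smooth_bump (n : R) a b x := Phi (n * x + - (n * a)) - Phi (n * x + - (n * b)).

Lemma smooth_bump_support n a b x : 1 <= n -> `|a| + `|b| + 1 <= `|x| ->
  smooth_bump n a b x = 0.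
Proof.
move=> n1; have := ler_norm a; have := ler_norm b; have := lerNnormlW (lexx `|a|).
have := lerNnormlW (lexx `|b|).
rewrite /smooth_bump /Phi => hb ha hb' ha'; case: (ger0P x) => x0 hx.
  by rewrite !(mollifier_cdf1 hphi) ?subrr//; nra.
by rewrite !(mollifier_cdf0 hphi) ?subrr//; nra.
Qed.

Lemma smooth_bump_derive1 n a b x : derive1 (smooth_bump n a b) x =
  n * phi (n * x + - (n * a)) - n * phi (n * x + - (n * b)).
Proof.
rewrite derive1E /smooth_bump.
have d c := @is_derive_affine R Phi n (- (n * c)) x (mollifier_cdf_derivable hphi (x := _)).
have dB := is_deriveB (d a) (d b).
by rewrite (@derive_val _ _ _ _ _ _ _ dB) !(mollifier_cdf_derive1 hphi).
Qed.

Lemma smooth_bump_Ccinfty n a b : 1 <= n -> Ccinfty (smooth_bump n a b).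
Proof.
move=> n1; split.
  by apply: smoothB; apply: smooth_affine; exact: (mollifier_cdf_smooth hphi).
pose M := `|a| + `|b| + 1.
apply: (@subclosed_compact _ _ `[- M, M]%classic).
- exact: closed_closure.
- exact: segment_compact.
- rewrite closureE => x; apply; split; first exact: itv_closed.
  move=> y /= /eqP; rewrite in_itv/= -ler_norml; case: leP => // /ltW yM.
  by rewrite smooth_bump_support.
Qed.

Lemma smooth_bump_norm n a b x : `|smooth_bump n a b x| <= 1.
Proof.
have := mollifier_cdf_ge0 hphi (n * x + - (n * a)).
have := mollifier_cdf_ge0 hphi (n * x + - (n * b)).
have := mollifier_cdf_le1 hphi (n * x + - (n * a)).
have := mollifier_cdf_le1 hphi (n * x + - (n * b)).
by rewrite /smooth_bump /Phi ler_norml => *; apply/andP; split; lra.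
Qed.

Lemma smooth_bump_cvg a b x : a < b -> x != a -> x != b ->
  (fun k : nat => smooth_bump k.+1%:R a b x) @ \oo --> (\1_`[a, b] x : R).
Proof.
move=> ab xa xb.
have cv c : x != c -> (fun k : nat => Phi (k.+1%:R * x + - (k.+1%:R * c))) @ \oo -->
    (((c < x)%R : nat)%:R : R).
  move=> xc; apply: cvg_near_cst.
  have d0 : 0 < `|x - c| by rewrite normr_gt0 subr_eq0.
  have /cvgrPdist_lt /(_ _ d0) := @cvg_harmonic R.
  apply: filterS => k; rewrite sub0r normrN gtr0_norm ?/harmonic ?invr_gt0// => kd.
  have k0 : 0 < k.+1%:R :> R by [].
  have {}kd : 1 < k.+1%:R * `|x - c| by rewrite mulrC -ltr_pdivrMr// mul1r.
  rewrite -mulrBr /Phi; case: (ltgtP c x) => [cx|xc'|cx].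
  - rewrite (mollifier_cdf1 hphi)//; move: kd; rewrite gtr0_norm ?subr_gt0//.
    exact: ltW.
  - rewrite (mollifier_cdf0 hphi)//; move: kd; rewrite ltr0_norm ?subr_lt0//.
    by rewrite mulrN => kd; rewrite lerNr ltW.
  - by move: xc; rewrite cx eqxx.
have <- : ((a < x)%R : nat)%:R - ((b < x)%R : nat)%:R = \1_`[a, b] x :> R; last first.
  by apply: cvgB; exact: cv.
rewrite indicE mem_setE in_itv/=.
case: (ltgtP a x) xa => //= ax _.
  by case: (ltgtP b x) xb => //= bx _; rewrite ?subrr ?subr0.
by rewrite ltNge (ltW (lt_trans ax ab))/= subr0.
Qed.

(** Test with [smooth_bump] at growing scale: it tends to the indicator of [a, b], while its
    derivative is an approximate identity at a minus one at b. In the limit the weak formula reads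
    f(a) - f(b) = - (integral of g over [a, b]). *)
Lemma wderiv_is_primitive f g : continuous f -> is_wderiv f g -> is_primitive f g.
Proof.
move=> cf [lf lg fg]; split => // a b; rewrite le_eqVlt => /predU1P[->|ab].
  by rewrite set_itv1 Rintegral_set1 subrr.
(* All the bumps used vanish outside [-M, M], their scales being at least 1; hence the dominating
   function below. *)
pose M := `|a| + `|b| + 1.
have mg : measurable_fun setT g by case: lg.
have mb k : measurable_fun setT (smooth_bump k.+1%:R a b).
  apply: continuous_measurable_fun; apply: smooth_continuous.
  by have [] := @smooth_bump_Ccinfty k.+1%:R a b; rewrite ?ler1n.
pose G x := `|g x| * \1_`[- M, M] x.
have iG : mu.-integrable setT (EFin \o G).
  have := integrable_patch (measurable_itv _) (integrable_abse (integrable_itv (- M) M lg)).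
  apply: eq_integrable => // x _ /=; rewrite /G patchE indicE.
  by case: ifP; rewrite ?mulr1 ?mulr0.
(* At the endpoints a and b the bumps need not tend to the indicator. *)
have aec c : {ae mu, forall x, x != c}.
  exists [set c]; split; [exact: measurable_set1|exact: lebesgue_measure_set1|].
  by move=> x /= /negP; rewrite negbK => /eqP.
have [||||iga _ cg] := @dominated_convergence _ _ _ mu _ measurableT
  (fun k x => (g x * smooth_bump k.+1%:R a b x)%:E)
  (fun x => (g x * \1_`[a, b] x)%:E) (EFin \o G) _ _ _ iG.
- by move=> k; apply/measurable_EFinP; exact: measurable_funM mg (mb k).
- by apply/measurable_EFinP/measurable_funM => //; exact: measurable_indic.
- move: (aec a) (aec b); apply: filterS2; first exact: (ae_filter_ringOfSetsType mu).
  move=> x xa xb _; apply: cvg_EFin; first exact: nearW.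
  by apply: cvgM; [exact: cvg_cst|exact: smooth_bump_cvg].
- apply: aeW => x k _ /=; rewrite lee_fin normrM /G ler_wpM2l// indicE mem_setE in_itv/= -ler_norml.
  case: (leP `|x| M) => [_|/ltW xM]; first exact: smooth_bump_norm.
  by rewrite smooth_bump_support ?normr0// ler1n.
have E k : \int[mu]_x (g x * smooth_bump k.+1%:R a b x) =
   \int[mu]_x (f x * (k.+1%:R * phi (k.+1%:R * x + - (k.+1%:R * b))))
   - \int[mu]_x (f x * (k.+1%:R * phi (k.+1%:R * x + - (k.+1%:R * a)))).
  have k0 : k.+1%:R != 0 :> R by [].
  have ip c : mu.-integrable setT (EFin \o
      (fun x => f x * (k.+1%:R * phi (k.+1%:R * x + - (k.+1%:R * c))))).
    have cfa : continuous (fun z => f (k.+1%:R^-1 * z + c)).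
      by move=> z; exact: (continuous_comp (@continuous_affine _ _ _) (cf _)).
    have i1 := friedrichs_mul_integrable (locally_integrable_continuous cfa).
    have := integrableZl measurableT k.+1%:R (integrable_affine (- (k.+1%:R * c)) k0 i1).
    apply: eq_integrable => // x _ /=; rewrite -EFinM; congr EFin.
    rewrite (_ : k.+1%:R^-1 * _ + c = x); first by ring.
    by field.
  have := fg _ (@smooth_bump_Ccinfty k.+1%:R a b _); rewrite ler1n => /(_ isT) E.
  apply: oppr_inj; rewrite -E opprB -RintegralB//.
  by apply: eq_Rintegral => x _; rewrite smooth_bump_derive1; ring.
have cE : (fun k : nat => \int[mu]_x (g x * smooth_bump k.+1%:R a b x)) @ \oo --> f b - f a.
  under eq_fun do rewrite E.
  by apply: cvgB; exact: mollify_cvg.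
rewrite Rintegral_mkcond; apply: (cvg_unique (@Rhausdorff R) cE).
have -> : \int[mu]_x (g \_ `[a, b]) x = \int[mu]_x (g x * \1_`[a, b] x).
  apply: eq_Rintegral => x _; rewrite patchE indicE.
  by case: ifP; rewrite ?mulr1 ?mulr0.
apply: fine_cvg; rewrite fineK//.
by apply: integrable_fin_num.
Qed.

(** Passage from the representative chosen by [wderiv] to an explicit density g; the norms of E that
    contain [wderiv] are evaluated through it. *)
Lemma wderivP f g : continuous f -> is_primitive f g ->
  [/\ is_wderiv f (wderiv f), is_primitive f (wderiv f) & {ae mu, forall x, wderiv f x = g x}].
Proof.
move=> cf pf; have wf := is_primitive_wderiv cf pf.
have wf' : is_wderiv f (wderiv f) by apply: (@xgetPex _ (cst 0) [set g | is_wderiv f g]); exists g.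
have pf' := wderiv_is_primitive cf wf'.
by split => //; exact: is_primitive_ae_eq pf' pf.
Qed.

End weak_derivative.

(** * The generalized inverse y of x + mu(]-oo, x]) *)

Section pseudo_inverse.
Context (R : realType) (m : {measure set (measurableTypeR R) -> \bar R}).
Notation mu := (@lebesgue_measure R).
Hypothesis mfin : (m setT < +oo)%E.
Implicit Types (a b x xi : R).
Let F := cumul m.
Let y := Ly m.

Lemma finite_measure_fin_num (A : set (measurableTypeR R)) : measurable A -> m A \is a fin_num.
Proof.
move=> mA; rewrite ge0_fin_numE//; apply: le_lt_trans mfin.
by apply: le_measure; rewrite ?inE.
Qed.
Hint Resolve finite_measure_fin_num : core.

Lemma cumul_ge0 x : 0 <= F x.
Proof. exact: fine_ge0. Qed.

Lemma cumul_le_total x : F x <= fine (m setT).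
Proof. by rewrite fine_le//; [exact: finite_measure_fin_num..|apply: le_measure; rewrite ?inE]. Qed.

Lemma fine_measure_le (A B : set (measurableTypeR R)) : measurable A -> measurable B ->
  A `<=` B -> fine (m A) <= fine (m B).
Proof.
move=> mA mB AB; rewrite fine_le//; [exact: finite_measure_fin_num..|].
by apply: le_measure; rewrite ?inE.
Qed.

Lemma cumul_homo a b : a <= b -> F a <= F b.
Proof.
move=> ab; apply: fine_measure_le => // x /=; rewrite !in_itv/= => /le_trans; exact.
Qed.

Lemma measure_oc a b : a <= b -> m `]a, b]%classic = (F b - F a)%:E.
Proof.
move=> ab; rewrite /F /cumul EFinB !fineK; [|exact: finite_measure_fin_num..].
have -> : `]-oo, b]%classic = `]-oo, a] `|` `]a, b] :> set (measurableTypeR R).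
  by rewrite -itv_bndbnd_setU//= bnd_simp.
rewrite measureU//.
  by rewrite addeAC subee ?add0e//; exact: finite_measure_fin_num.
apply/seteqP; split => // x [] /=; rewrite !in_itv/= => xa /andP[ax _].
by rewrite leNgt ax in xa.
Qed.

(** [Ly] is defined with open half-lines and [cumul] with closed ones; continuity of m from above
    joins the two. *)
Lemma cumul_right_limit x :
  (fun k : nat => fine (m `]-oo, (x + k.+1%:R^-1)%R[%classic)) @ \oo --> F x.
Proof.
pose S (k : nat) : set (measurableTypeR R) := `]-oo, (x + k.+1%:R^-1)[%classic.
have mS k : measurable (S k) by exact: measurable_itv.
have capS : \bigcap_k S k = `]-oo, x]%classic.
  apply/seteqP; split => z /=; rewrite ?in_itv/=.
    move=> zS; rewrite leNgt; apply/negP => xz.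
    have d0 : 0 < z - x by rewrite subr_gt0.
    have /cvgrPdist_lt /(_ _ d0) [n _ /(_ n (leqnn n))] := @cvg_harmonic R.
    have hn : 0 < n.+1%:R^-1 :> R by rewrite invr_gt0.
    rewrite sub0r normrN /harmonic gtr0_norm// => zn.
    have := zS n I; rewrite /S/= in_itv/=; move: zn; rewrite ltrBrDl => /lt_trans h /h.
    by rewrite ltxx.
  move=> zx k _; rewrite /S /= in_itv/= (le_lt_trans zx)// ltrDl invr_gt0.
  by [].
have := @nonincreasing_cvg_mu _ _ _ m S.
rewrite capS => /(_ _ mS _ _) h; apply: fine_cvg.
rewrite fineK; last exact: finite_measure_fin_num.
apply: h => //.
- by apply: le_lt_trans mfin; apply: le_measure; rewrite ?inE.
- move=> i j ij; apply/subsetPset => z; rewrite /S/= !in_itv/= => /lt_le_trans; apply.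
  by rewrite lerD2l lef_pV2 ?posrE// ler_nat.
Qed.

Let S xi := [set z : R | (m `]-oo, z[%classic + z%:E < xi%:E)%E].

Lemma Ly_setE xi z : S xi z <-> fine (m `]-oo, z[%classic) + z < xi.
Proof.
rewrite /S /= -{1}(@fineK _ (m _)); last exact: finite_measure_fin_num.
by rewrite -EFinD lte_fin.
Qed.

Lemma Ly_has_sup xi : has_sup (S xi).
Proof.
split.
  exists (xi - fine (m setT) - 1); apply/Ly_setE.
  have : fine (m `]-oo, (xi - fine (m setT) - 1)[%classic) <= fine (m setT).
    by apply: fine_measure_le.
  lra.
exists xi => z /Ly_setE.
have : 0 <= fine (m `]-oo, z[%classic) by exact: fine_ge0.
lra.
Qed.

(** The Galois connection between y and x + F(x), from which the monotonicity, the bounds and the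
    Lipschitz property of y are read off. From left to right, no x + 1/(k+1) belongs to the set
    below the supremum, and right continuity of F gives the limit. *)
Lemma LyP xi x : (y xi <= x) = (xi <= x + F x).
Proof.
have [ne ub] := Ly_has_sup xi.
apply/idP/idP => [yx|xiF].
  have cv : (fun k : nat => fine (m `]-oo, (x + k.+1%:R^-1)%R[%classic) + (x + k.+1%:R^-1)) @ \oo --> F x + (x + 0).
    apply: cvgD; first exact: cumul_right_limit.
    by apply: cvgD; [exact: cvg_cst|exact: cvg_harmonic].
  rewrite addr0 addrC in cv.
  rewrite -(cvg_lim (@Rhausdorff R) cv); apply: limr_ge; first by apply/cvg_ex; exists (x + F x).
  apply: nearW => k; rewrite leNgt; apply/negP => /Ly_setE Sk.
  have := ub_le_sup ub Sk; rewrite -/(Ly m xi) -/(y xi) => h.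
  have : 0 < k.+1%:R^-1 :> R by rewrite invr_gt0.
  by move: (k.+1%:R^-1) h => e h e0; lra.
apply: ge_sup => // z /Ly_setE Sz; rewrite leNgt; apply/negP => xz.
have : F x <= fine (m `]-oo, z[%classic).
  apply: fine_measure_le => // t /=; rewrite !in_itv/= => /le_lt_trans; exact.
lra.
Qed.

Lemma Ly_ge xi : xi <= y xi + F (y xi).
Proof. by rewrite -LyP. Qed.

Lemma Ly_homo : {homo y : a b / a <= b}.
Proof. by move=> a b ab; rewrite LyP (le_trans ab)// Ly_ge. Qed.

Lemma Ly_le xi : y xi <= xi.
Proof. by rewrite LyP lerDl cumul_ge0. Qed.

Lemma Ly_lower xi : xi - fine (m setT) <= y xi.
Proof. by rewrite lerBlDr (le_trans (Ly_ge xi))// lerD2l cumul_le_total. Qed.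

Lemma Ly_lipschitz a b : a <= b -> y b - y a <= b - a.
Proof.
move=> ab; rewrite lerBlDl LyP.
have := Ly_ge a; have : F (y a) <= F (y a + (b - a)) by apply: cumul_homo; rewrite lerDl subr_ge0.
lra.
Qed.

Lemma Ly_dist a b : `|y a - y b| <= `|a - b|.
Proof.
wlog ab : a b / a <= b.
  by move=> h; case: (leP a b) => [|/ltW] ab; [exact: h|rewrite distrC (distrC a); exact: h].
rewrite distrC (distrC a) !ger0_norm ?subr_ge0//; last exact: Ly_homo.
exact: Ly_lipschitz.
Qed.

Lemma Ly_continuous : continuous y.
Proof.
move=> x; apply/cvgrPdist_le => e e0; near=> z.
rewrite (le_trans (Ly_dist _ _))//; near: z.
Unshelve. all: by end_near. Qed.

Lemma Ly_measurable : measurable_fun setT (y : R -> measurableTypeR R).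
Proof. exact: continuous_measurable_fun Ly_continuous. Qed.

Lemma ge0_integral_Ly (f : R -> \bar R) : measurable_fun setT f -> (forall x, (0 <= f x)%E) ->
  (\int[mu]_xi f (y xi) = \int[mu]_x f x + \int[m]_x f x)%E.
Proof.
move=> mf f0.
rewrite -(ge0_integral_image mu Ly_measurable)// -(ge0_integral_measure_add mu m)//.
apply: eq_measure_integral => A mA _.
apply: (@measure_unique _ R (measurableTypeR R) (@ocitv R)
  (fun k => `](- k%:R), k%:R]%classic) _ _ _ _ (image_measure mu Ly_measurable)
  (measure_add mu m)) => //.
- exact: ocitvI.
- by move=> k; exact: is_ocitv.
- apply/seteqP; split => // x _; exists (Num.bound `|x|) => //=.
  have xb := archi_boundP (normr_ge0 x).
  have := ler_norm x; have := lerNnormlW (lexx `|x|).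
  by rewrite in_itv/= => h1 h2; apply/andP; split; lra.
- move=> B [[a b] /= _ <-].
  have [ab|ba] := leP a b; last first.
    have -> : `]a, b]%classic = set0 :> set (measurableTypeR R).
      by apply/seteqP; split => // x /=; rewrite in_itv/= => /andP[ax xb]; lra.
    by rewrite (measure0 (image_measure mu Ly_measurable)) (measure0 (measure_add mu m)).
  have yE : y @^-1` `]a, b]%classic = `](a + F a), (b + F b)]%classic.
    by apply/seteqP; split => x /=; rewrite !in_itv/= !ltNge !LyP.
  pose L c d := mu `]c, d]%classic.
  have E : (L (a + F a)%R (b + F b)%R = L a b + m `]a, b]%classic)%E.
    have E1 c d : L c d = (if c < d then (d - c)%:E else 0%E).
      by rewrite /L lebesgue_measure_itv/= lte_fin; case: ifP.
    rewrite (measure_oc ab).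
    rewrite E1.
    rewrite E1.
    have := cumul_homo ab; rewrite -/F; move: ab; rewrite le_eqVlt => /predU1P[->|ab] FF.
      by rewrite !ltxx subrr adde0.
    have abF : a + F a < b + F b by lra.
    by rewrite ab abF -!EFinD; congr EFin; ring.
  by rewrite /pushforward yE /measure_add/= /msum !big_ord_recl big_ord0 adde0/=.
(* The exhausting intervals have finite image measure because xi - m(R) <= y(xi) <= xi. *)
- move=> k; rewrite /= /pushforward.
  apply: (@le_lt_trans _ _ (mu `[(- k%:R)%R, (k%:R + fine (m setT))%R]%classic)).
    apply: le_measure; rewrite ?inE//.
      by rewrite -[X in measurable X]setTI; exact: Ly_measurable.
    move=> x /=; rewrite !in_itv/= => /andP[x1 x2].
    by have := Ly_lower x; have := Ly_le x; lra.
  by rewrite lebesgue_measure_itv/=; case: ifP; rewrite ?ltry.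
Qed.

End pseudo_inverse.

(** A Lévy-type comparison: an error d in position and e in mass. In x + F(x) the summand x has
    slope 1, so a mass error e is absorbed by moving a further distance e. *)
Lemma Ly_close (R : realType) (m1 m2 : {measure set (measurableTypeR R) -> \bar R}) (d e : R) :
  (m1 setT < +oo)%E -> (m2 setT < +oo)%E -> 0 <= d -> 0 <= e ->
  (forall x, cumul m1 (x - d) - e <= cumul m2 x <= cumul m1 (x + d) + e) ->
  forall xi, `|Ly m1 xi - Ly m2 xi| <= d + e.
Proof.
move=> f1 f2 d0 e0 h xi.
have A : Ly m2 xi <= Ly m1 xi + (d + e).
  rewrite LyP//.
  have /andP[+ _] := h (Ly m1 xi + (d + e)); have := Ly_ge f1 xi.
  have : cumul m1 (Ly m1 xi) <= cumul m1 (Ly m1 xi + (d + e) - d) by apply: cumul_homo => //; lra.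
  lra.
have B : Ly m1 xi <= Ly m2 xi + (d + e).
  rewrite LyP//.
  have /andP[_ +] := h (Ly m2 xi); have := Ly_ge f2 xi.
  have : cumul m1 (Ly m2 xi + d) <= cumul m1 (Ly m2 xi + (d + e)) by apply: cumul_homo => //; lra.
  lra.
by rewrite ler_norml; apply/andP; split; lra.
Qed.

(** * The slope of y and the change of variables along y *)

Section lagrangian_density.
Context (R : realType) (m ms : {measure set (measurableTypeR R) -> \bar R}).
Context (v : R -> R) (N : set (measurableTypeR R)).
Notation mu := (@lebesgue_measure R).
Hypothesis mfin : (m setT < +oo)%E.
Hypothesis mv : measurable_fun setT v.
Hypothesis v0 : forall x, 0 <= v x.
Hypothesis mN : measurable N.
Hypothesis N0 : mu N = 0%E.
Hypothesis msN : ms (~` N) = 0%E.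
Hypothesis mE : forall A : set (measurableTypeR R), measurable A ->
  m A = (\int[mu]_(x in A) (v x)%:E + ms A)%E.
Implicit Types (f g : R -> R) (a b x xi : R).

(** The Radon-Nikodym density of Lebesgue measure with respect to dx + m: off [N] that measure is (1
    + v) dx, and [N] has Lebesgue measure zero. *)
Definition Ly_slope x := \1_(~` N) x / (1 + v x).
Let q := Ly_slope.
Let y := Ly m.

Lemma Ly_slope_ge0 x : 0 <= q x.
Proof. by rewrite divr_ge0// addr_ge0. Qed.

Lemma Ly_slope_le1 x : q x <= 1.
Proof.
have := v0 x; rewrite /q /Ly_slope ler_pdivrMr ?ltr_wpDr// mul1r indicE.
by case: (_ \in _) => /=; lra.
Qed.

Lemma Ly_slope_measurable : measurable_fun setT q.
Proof.
apply: measurable_funM; first by apply: measurable_indic; exact: measurableC.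
have mV : measurable_fun setT (fun x => 1 + v x) by exact: measurable_funD.
rewrite (_ : (fun x => _) = (fun x => (1 + v x) `^ (-1))).
  exact: (measurableT_comp (measurable_powR _) mV).
by apply/funext => x; rewrite powR_inv1// addr_ge0.
Qed.

Lemma measurable_Ly_comp (f : R -> R) : measurable_fun setT f -> measurable_fun setT (f \o y).
Proof. by move=> mf; apply: (measurableT_comp mf); exact: Ly_measurable. Qed.

Lemma ae_notin : {ae mu, forall x, ~ N x}.
Proof. by exists N; split => // x /= /contrapT. Qed.

Lemma ge0_integral_decomp (f : R -> \bar R) : measurable_fun setT f ->
  (forall x, (0 <= f x)%E) ->
  (\int[m]_x f x = \int[mu]_x (f x * (v x)%:E) + \int[ms]_x f x)%E.
Proof. exact: (@ge0_integral_density _ (measurableTypeR R) R mu m ms v mv v0 mE). Qed.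

(** The image of Lebesgue measure under y is (1 + v) dx + ms. Here q (1 + v) = 1 off [N], and q = 0
    on [N], which carries [ms]. *)
Lemma ge0_integral_Ly_density (f : R -> R) : measurable_fun setT f -> (forall x, 0 <= f x) ->
  (\int[mu]_xi (f (y xi) * q (y xi))%:E = \int[mu]_x (f x)%:E)%E.
Proof.
move=> mf f0; have mq := Ly_slope_measurable.
have mfq : measurable_fun setT (fun x => f x * q x) by exact: measurable_funM.
have fq0 x : 0 <= f x * q x by rewrite mulr_ge0// Ly_slope_ge0.
have mfqe : measurable_fun setT (fun x => (f x * q x)%:E) by exact/measurable_EFinP.
have fq0e x : (0 <= (f x * q x)%:E)%E by rewrite lee_fin.
rewrite (@ge0_integral_Ly _ _ mfin (fun x => (f x * q x)%:E))//.
rewrite (ge0_integral_decomp mfqe)//.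
have -> : (\int[ms]_x (f x * q x)%:E = 0)%E.
  rewrite -(integral0 ms setT); apply: ae_eq_integral => //.
  exists (~` N); split => //; first exact: measurableC.
  move=> x /= /not_implyP[_ fqx]; apply: contrapT => /contrapT Nx; apply: fqx.
  by rewrite /q /Ly_slope indicE memNset ?mul0r ?mulr0//; apply.
rewrite adde0 -ge0_integralD//; last 2 first.
- by move=> x _; rewrite -EFinM lee_fin mulr_ge0.
- apply/measurable_EFinP; exact: measurable_funM.
apply: ae_eq_integral => //.
- apply: emeasurable_funD => //; apply/measurable_EFinP; exact: measurable_funM.
- exact/measurable_EFinP.
have := ae_notin; apply: filterS; first exact: (ae_filter_ringOfSetsType mu).
move=> x Nx _; rewrite -EFinM -EFinD; congr EFin.
rewrite /q /Ly_slope indicE mem_set// div1r; field.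
by rewrite gt_eqF// ltr_wpDr.
Qed.

(** Off [N], (1 - q)(1 + v) = v; on [N], 1 - q = 1. Integration against (1 + v) dx + ms thus returns
    both parts of m. *)
Lemma integral_Ly_slopeC : (\int[mu]_xi (1 - q (y xi))%:E = m setT)%E.
Proof.
have mq := Ly_slope_measurable.
have mq1 : measurable_fun setT (fun x => 1 - q x) by exact: measurable_funB.
have mq1e : measurable_fun setT (fun x => (1 - q x)%:E) by exact/measurable_EFinP.
have q10 x : 0 <= 1 - q x by rewrite subr_ge0 Ly_slope_le1.
have q10e x : (0 <= (1 - q x)%:E)%E by rewrite lee_fin.
rewrite (@ge0_integral_Ly _ _ mfin (fun x => (1 - q x)%:E))//.
rewrite (ge0_integral_decomp mq1e)// addeA -ge0_integralD//; last 2 first.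
- by move=> x _; rewrite -EFinM lee_fin mulr_ge0.
- apply/measurable_EFinP; exact: measurable_funM.
rewrite mE//; congr (_ + _)%E.
  apply: ae_eq_integral => //.
  - apply: emeasurable_funD => //; apply/measurable_EFinP; exact: measurable_funM.
  - exact/measurable_EFinP.
  have := ae_notin; apply: filterS; first exact: (ae_filter_ringOfSetsType mu).
  move=> x Nx _; rewrite -EFinM -EFinD; congr EFin.
  rewrite /q /Ly_slope indicE mem_set// div1r; field.
  by rewrite gt_eqF// ltr_wpDr.
rewrite -[RHS]mul1e -integral_cst//; apply: ae_eq_integral => //.
exists (~` N); split => //; first exact: measurableC.
move=> x /= /not_implyP[_ fqx]; apply: contrapT => /contrapT Nx; apply: fqx.
by rewrite /q /Ly_slope indicE memNset ?mul0r ?subr0//; apply.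
Qed.

(** Since y may have plateaus, the preimage of [y a, y b] can exceed [a, b]. It contains [a, b],
    which gives one inequality; the preimage of the open interval is contained in [a, b], which
    gives the other, as the endpoints are null. *)
Lemma ge0_integral_Ly_itv (f : R -> R) a b : a <= b ->
  measurable_fun setT f -> (forall x, 0 <= f x) ->
  (\int[mu]_(xi in `[a, b]) (f (y xi) * q (y xi))%:E = \int[mu]_(x in `[y a, y b]) (f x)%:E)%E.
Proof.
move=> ab mf f0; have mq := Ly_slope_measurable.
have mfyq : measurable_fun setT (fun xi => f (y xi) * q (y xi)).
  by apply: measurable_funM; exact: measurable_Ly_comp.
have fyq0 xi : 0 <= f (y xi) * q (y xi) by rewrite mulr_ge0// Ly_slope_ge0.
have E (B : set (measurableTypeR R)) : measurable B ->
    (\int[mu]_xi (\1_B (y xi) * (f (y xi) * q (y xi)))%:E = \int[mu]_(x in B) (f x)%:E)%E.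
  move=> mB; have i0 x : 0 <= \1_B x :> R by rewrite indicE.
  have mI : measurable_fun setT (\1_B : R -> R) by exact: measurable_indic.
  have := @ge0_integral_Ly_density (fun x => \1_B x * f x) (measurable_funM mI mf)
    (fun x => mulr_ge0 (i0 x) (f0 x)).
  under eq_integral do rewrite -mulrA.
  move=> ->; rewrite [RHS]integral_mkcond; apply: eq_integral => x _.
  by rewrite patchE indicE; case: ifP => _; rewrite ?mul1r ?mul0r.
have mE' (B : set (measurableTypeR R)) : measurable B ->
    measurable_fun setT (fun xi => (\1_B (y xi) * (f (y xi) * q (y xi)))%:E).
  move=> mB; apply/measurable_EFinP/measurable_funM => //.
  by apply: (measurable_Ly_comp (f := \1_B)); exact: measurable_indic.
apply/eqP; rewrite eq_le; apply/andP; split.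
- rewrite -E// integral_mkcond; apply: ge0_le_integral => //.
  + by move=> x _; rewrite patchE; case: ifP => // _; rewrite lee_fin.
  + by apply/(measurable_restrictT _ _).1 => //; apply: measurable_funTS; exact/measurable_EFinP.
  + exact: mE'.
  move=> x _; rewrite patchE; case: ifPn => xab; last first.
    by rewrite lee_fin mulr_ge0.
  rewrite indicE mem_set ?mul1r//=.
  move: xab; rewrite mem_setE/= !in_itv/= => /andP[ax xb].
  by rewrite !Ly_homo.
- have [yab|yab] : y a < y b \/ y a = y b.
    by have := Ly_homo mfin ab; rewrite le_eqVlt => /predU1P[]; [right|left].
  + rewrite (_ : (\int[mu]_(x in `[y a, y b]) _)%E = \int[mu]_(x in `]y a, y b[) (f x)%:E)%E; last first.
      by rewrite integral_itv_bndoo//; apply: measurable_funTS; exact/measurable_EFinP.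
    rewrite -E// [leRHS]integral_mkcond; apply: ge0_le_integral => //.
    * by move=> x _; rewrite lee_fin mulr_ge0.
    * exact: mE'.
    * by apply/(measurable_restrictT _ _).1 => //; apply: measurable_funTS; exact/measurable_EFinP.
    move=> x _; rewrite patchE indicE.
    case: (boolP (y x \in _)) => [|_]; last first.
      by rewrite mul0r; case: ifP => // _; rewrite lee_fin.
    rewrite mem_setE/= in_itv/= => /andP[yax yxb]; rewrite mul1r mem_set//=.
    rewrite in_itv/=; apply/andP; split; rewrite leNgt; apply/negP => /ltW/(Ly_homo mfin); rewrite leNgt.
      by rewrite yax.
    by rewrite yxb.
  + rewrite yab set_itv1 integral_set1; apply: integral_ge0 => x _; rewrite lee_fin.
    exact: fyq0.
Qed.

Lemma integral_Ly_itv g a b : a <= b -> measurable_fun setT g ->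
  (\int[mu]_(xi in `[a, b]) (g (y xi) * q (y xi))%:E = \int[mu]_(x in `[y a, y b]) (g x)%:E)%E.
Proof.
move=> ab mg; rewrite integralE [RHS]integralE.
have p := @ge0_integral_Ly_itv (fun x => Num.max (g x) 0) a b ab.
have n := @ge0_integral_Ly_itv (fun x => Num.max (- g x) 0) a b ab.
have m0 : measurable_fun setT (cst 0 : R -> R) by exact: measurable_cst.
congr (_ - _)%E.
  transitivity (\int[mu]_(x in `[a, b]) (Num.max (g (y x)) 0 * q (y x))%:E)%E.
    apply: eq_integral => x _; rewrite funeposE /= maxr_pMl ?Ly_slope_ge0// mul0r.
    by rewrite EFin_max.
  rewrite p//.
  - by apply: eq_integral => x _; rewrite funeposE /= EFin_max.
  - exact: measurable_maxr.
  - by move=> x; rewrite le_max lexx orbT.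
transitivity (\int[mu]_(x in `[a, b]) (Num.max (- g (y x)) 0 * q (y x))%:E)%E.
  apply: eq_integral => x _; rewrite funenegE /= maxr_pMl ?Ly_slope_ge0// mul0r mulNr.
  by rewrite EFin_max EFinN.
rewrite n//.
- by apply: eq_integral => x _; rewrite funenegE /= EFin_max EFinN.
- by apply: measurable_maxr => //; exact: measurableT_comp.
- by move=> x; rewrite le_max lexx orbT.
Qed.

Lemma locally_integrable_Ly g : locally_integrable setT g ->
  locally_integrable setT (fun xi => g (y xi) * q (y xi)).
Proof.
move=> lg; have [mg _ _] := lg.
have mgy : measurable_fun setT (fun xi => g (y xi) * q (y xi)).
  by apply: measurable_funM; [exact: measurable_Ly_comp|apply: measurable_Ly_comp; exact: Ly_slope_measurable].
apply: locally_integrable_itv => // M; apply/integrableP; split.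
  by apply/measurable_EFinP; exact: measurable_funTS.
have [M0|M0] := leP (- M) M; last first.
  by rewrite set_itv_ge ?integral_set0// bnd_simp -ltNge.
rewrite (_ : (\int[mu]_(x in _) _)%E =
    \int[mu]_(x in `[(- M)%R, M]) (`|g (y x)| * q (y x))%:E)%E; last first.
  by apply: eq_integral => x _ /=; rewrite normrM (ger0_norm (Ly_slope_ge0 _)).
rewrite (@ge0_integral_Ly_itv (fun x => `|g x|))//; last exact: measurableT_comp.
by have /integrableP[] := integrable_itv (y (- M)) (y M) lg.
Qed.

(** The chain rule along y in integrated form. With f the identity it says that y has slope
    [q \o y]; with f = u it gives the derivative of U. *)
Lemma is_primitive_Ly f g : is_primitive f g ->
  is_primitive (f \o y) (fun xi => g (y xi) * q (y xi)).
Proof.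
move=> [lg fg]; split; first exact: locally_integrable_Ly.
move=> a b ab /=; rewrite fg; last exact: Ly_homo.
by rewrite /Rintegral integral_Ly_itv//; case: lg.
Qed.

End lagrangian_density.

(** * Square integrable functions and displacements *)

Section L2_tools.
Context (R : realType).
Notation mu := (@lebesgue_measure R).
Implicit Types (f g h : R -> R) (D : set R).

Lemma integrable_bound f g : measurable_fun setT f -> (forall x, `|f x| <= g x) ->
  mu.-integrable setT (EFin \o g) -> mu.-integrable setT (EFin \o f).
Proof.
move=> mf fg ig; apply: (le_integrable _ _ _ ig) => //; first exact/measurable_EFinP.
by move=> x _ /=; rewrite lee_fin (le_trans (fg x))// ler_norm.
Qed.

Lemma integrable_lincomb (a b : R) f g : mu.-integrable setT (EFin \o f) ->
  mu.-integrable setT (EFin \o g) ->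
  mu.-integrable setT (EFin \o (fun x => a * f x + b * g x)).
Proof.
move=> fi gi; have fa := integrableZl measurableT a fi.
have gb := integrableZl measurableT b gi; exact: (integrableD _ fa gb).
Qed.

Lemma L2_measurable f : L2 f -> measurable_fun setT f.
Proof. by move=> /L2P[]. Qed.

Lemma L2_integrable f : L2 f -> mu.-integrable setT (EFin \o (fun x => f x ^+ 2)).
Proof. by move=> /L2P[]. Qed.

Lemma L2_bound f g : measurable_fun setT f -> (forall x, f x ^+ 2 <= g x) ->
  mu.-integrable setT (EFin \o g) -> L2 f.
Proof.
move=> mf fg ig; apply/L2P; split => //; apply: integrable_bound ig.
  exact: measurable_funX.
by move=> x; rewrite ger0_norm// sqr_ge0.
Qed.

Lemma L2B f g : L2 f -> L2 g -> L2 (fun x => f x - g x).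
Proof.
move=> f2 g2; have [mf fi] := (L2P f).1 f2; have [mg gi] := (L2P g).1 g2.
apply: (L2_bound (g := fun x => 2 * f x ^+ 2 + 2 * g x ^+ 2)).
- exact: measurable_funB.
- by move=> x; have := sqr_ge0 (f x + g x); nra.
- exact: integrable_lincomb.
Qed.

Lemma L2M f g : L2 f -> L2 g -> mu.-integrable setT (EFin \o (fun x => f x * g x)).
Proof.
move=> /L2P[mf fi] /L2P[mg gi].
apply: (integrable_bound (g := fun x => 1 * f x ^+ 2 + 1 * g x ^+ 2)).
- exact: measurable_funM.
- move=> x; rewrite normrM -(real_normK (num_real (f x))) -(real_normK (num_real (g x))).
  have := sqr_ge0 (`|f x| - `|g x|); have := normr_ge0 (f x); have := normr_ge0 (g x); nra.
- exact: integrable_lincomb.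
Qed.

Lemma ae_integral_sqr f g : measurable_fun setT f -> measurable_fun setT g ->
  {ae mu, forall x, f x = g x} ->
  (\int[mu]_x (f x ^+ 2)%:E = \int[mu]_x (g x ^+ 2)%:E)%E.
Proof.
move=> mf mg fg; apply: ae_eq_integral => //; try by apply/measurable_EFinP; exact: measurable_funX.
by move: fg; apply: filterS; [exact: (ae_filter_ringOfSetsType mu)|move=> x -> _].
Qed.

Lemma L2_ae f g : L2 g -> measurable_fun setT f ->
  {ae mu, forall x, f x = g x} -> L2 f.
Proof.
move=> /L2P[mg /integrableP[_ gi]] mf fg; apply/L2P; split => //; apply/integrableP; split.
  by apply/measurable_EFinP; exact: measurable_funX.
move: gi; under eq_integral => x _ do rewrite /= ger0_norm ?sqr_ge0//.
by under [in X in _ -> X]eq_integral => x _ do rewrite /= ger0_norm ?sqr_ge0//;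
  rewrite (ae_integral_sqr mf mg fg).
Qed.

Lemma normL2_le f (A : R) : 0 <= A -> (\int[mu]_x (f x ^+ 2)%:E <= A%:E)%E ->
  (normL2 f <= (Num.sqrt A)%:E)%E.
Proof.
move=> A0 fA; rewrite normL2E -powR12_sqrt// -poweR_EFin.
rewrite gt0_ler_poweR// ?in_itv/= ?leey ?andbT//.
by apply: integral_ge0 => x _; rewrite lee_fin sqr_ge0.
Qed.

Lemma L2_cst_eq0 (c : R) : L2 (cst c) -> c = 0.
Proof.
move=> /L2P[_ /integrableP[_]]; apply: contraPP => /eqP c0.
under eq_integral do rewrite /= ger0_norm ?sqr_ge0//.
rewrite integral_cst//= => /lt_geF.
have -> : mu setT = +oo%E.
  by have := @lebesgue_measure_itv R `]-oo, +oo[; rewrite set_itvNyy /= => ->.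
by rewrite gt0_muley ?leey// lte_fin exprn_even_gt0.
Qed.

Lemma kpart_eq f (k : R) : L2 (fun x => f x - k) -> kpart f = k.
Proof.
move=> fk; have : L2 (fun x => f x - kpart f).
  by apply: (@xgetPex _ 0 [set k : R | L2 (fun x => f x - k)]); exists k.
move=> /(L2B fk) h; apply/eqP; rewrite -subr_eq0; apply/eqP; apply: L2_cst_eq0.
rewrite (_ : cst _ = fun x => f x - k - (f x - kpart f))//.
by apply/funext => x /=; ring.
Qed.

End L2_tools.

(** * Displacement estimates by local energy *)

Section displacement.
Context (R : realType) (u w : R -> R).
Notation mu := (@lebesgue_measure R).
Hypothesis uw : is_primitive u w.
Hypothesis w2 : L2 w.
Implicit Types (a b c d x xi : R).

(** The energy in a window around xi, kept in place of the total energy so that bounds for squared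
    displacements remain integrable in xi. *)
Definition local_energy c xi := \int[mu]_(x in `[xi - c, xi + c]) (w x ^+ 2).
Definition total_energy := \int[mu]_x (w x ^+ 2).
Let iw := L2_integrable w2.

Lemma sqr_itv_integrable a b : mu.-integrable `[a, b] (EFin \o (fun x => w x ^+ 2)).
Proof. by apply: integrableS iw. Qed.

(** Jensen with weight 1, of mass b - a; a = b is split off because the weight must have positive
    mass. *)
Lemma primitive_holder a b : a <= b ->
  (u b - u a) ^+ 2 <= (b - a) * \int[mu]_(x in `[a, b]) (w x ^+ 2).
Proof.
move=> ab; have [lw ->//] := uw.
move: ab; rewrite le_eqVlt => /predU1P[->|ab].
  by rewrite set_itv1 !Rintegral_set1 subrr mul0r expr0n.
have i1 : mu.-integrable `[a, b] (EFin \o (cst 1 : R -> R)).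
  by apply: integrable_itv; have [] := @is_primitive_id R.
have ab1 : \int[mu]_(x in `[a, b]) (1 : R) = b - a.
  by have [_ <-//] := @is_primitive_id R; exact: ltW.
have i2 : mu.-integrable `[a, b] (EFin \o (fun x => (cst 1 : R -> R) x * w x ^+ 2)).
  rewrite (_ : _ \o _ = EFin \o (fun x => w x ^+ 2)); first exact: sqr_itv_integrable.
  by apply/funext => x /=; rewrite mul1r.
have K0 : 0 < \int[mu]_(x in `[a, b]) (cst 1 : R -> R) x by rewrite ab1 subr_gt0.
have mw : measurable_fun `[a, b] w by case: lw => mw _ _; exact: measurable_funTS.
have := @Rintegral_jensen _ (measurableTypeR R) R mu `[a, b] w (cst 1)
  (measurable_itv _) mw (fun _ _ => ler01) i1 K0 i2.
rewrite ab1 (_ : \int[mu]_(x in _) (_ * w x) = \int[mu]_(x in `[a, b]) w x).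
  rewrite (_ : \int[mu]_(x in _) (_ * w x ^+ 2) = \int[mu]_(x in `[a, b]) (w x ^+ 2))//.
  by apply: eq_Rintegral => x _; rewrite mul1r.
by apply: eq_Rintegral => x _; rewrite mul1r.
Qed.

Lemma energy_mono a b a' b' : a' <= a -> b <= b' ->
  \int[mu]_(x in `[a, b]) (w x ^+ 2) <= \int[mu]_(x in `[a', b']) (w x ^+ 2).
Proof.
move=> aa bb; rewrite /Rintegral fine_le//; try by apply: integrable_fin_num => //; exact: sqr_itv_integrable.
apply: ge0_subset_integral => //.
- apply/measurable_EFinP; apply: measurable_funTS; exact: measurable_funX (L2_measurable w2).
- by move=> x _; rewrite lee_fin sqr_ge0.
- by move=> x /=; rewrite !in_itv/= => /andP[ax xb]; rewrite (le_trans aa ax) (le_trans xb bb).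
Qed.

Lemma energy_le_total a b : \int[mu]_(x in `[a, b]) (w x ^+ 2) <= total_energy.
Proof.
rewrite /Rintegral fine_le//; try by apply: integrable_fin_num => //; exact: sqr_itv_integrable.
apply: ge0_subset_integral => //.
- apply/measurable_EFinP; exact: measurable_funX (L2_measurable w2).
- by move=> x _; rewrite lee_fin sqr_ge0.
Qed.

Lemma local_energy_ge0 c xi : 0 <= local_energy c xi.
Proof. by apply: Rintegral_ge0 => x _; rewrite sqr_ge0. Qed.

Lemma total_energy_ge0 : 0 <= total_energy.
Proof. by apply: Rintegral_ge0 => x _; rewrite sqr_ge0. Qed.

Lemma displacement_sqr a b c d xi : `|a - xi| <= c -> `|b - xi| <= c -> `|a - b| <= d ->
  (u a - u b) ^+ 2 <= d * local_energy c xi.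
Proof.
wlog ab : a b / b <= a.
  move=> H ac bc; case: (leP b a) => [|/ltW] ab abd; first exact: H.
  by rewrite -sqrrN opprB; apply: H => //; rewrite distrC.
move=> ac bc abd; rewrite (le_trans (primitive_holder ab))// ler_pM//.
- by rewrite subr_ge0.
- by apply: Rintegral_ge0 => x _; rewrite sqr_ge0.
- by rewrite (le_trans (ler_norm _)).
- move: ac bc; rewrite !ler_norml => /andP[_ a1] /andP[b1 _].
  by apply: energy_mono; lra.
Qed.

Lemma displacement_norm a b c d xi : `|a - xi| <= c -> `|b - xi| <= c -> `|a - b| <= d ->
  `|u a - u b| <= Num.sqrt (d * local_energy c xi).
Proof.
by move=> ac bc abd; rewrite -sqrtr_sqr ler_sqrt ?displacement_sqr// ?(le_trans _ (displacement_sqr ac bc abd)) ?sqr_ge0.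
Qed.

(** By Tonelli, each x is counted for the xi in [x - c, x + c], a set of length 2c. *)
Lemma integral_local_energy c : 0 <= c ->
  measurable_fun setT (local_energy c) /\
  (\int[mu]_xi (local_energy c xi)%:E = (2 * c * total_energy)%:E)%E.
Proof.
move=> c0; have mw := L2_measurable w2.
pose k (z : R * R) := (((`|z.2 - z.1| <= c)%R : nat)%:R * w z.2 ^+ 2)%:E.
have mk : measurable_fun setT k.
  apply/measurable_EFinP/measurable_funM.
    rewrite (_ : (fun z : R * R => _) = \1_[set z : R * R | `|z.2 - z.1| <= c]); last first.
      by apply/funext => z; rewrite indicE mem_setE.
    apply: measurable_indic; rewrite -[X in measurable X]setTI.
    apply: measurable_fun_le => //; apply: measurableT_comp => //.
    exact: measurable_funB.
  by apply: measurable_funX; exact: (measurableT_comp mw measurable_snd).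
have k0 z : (0 <= k z)%E by rewrite lee_fin mulr_ge0// sqr_ge0.
have kE xi : (\int[mu]_x k (xi, x) = (local_energy c xi)%:E)%E.
  rewrite /local_energy /Rintegral fineK; last first.
    by apply: integrable_fin_num => //; exact: sqr_itv_integrable.
  rewrite [RHS]integral_mkcond; apply: eq_integral => x _.
  rewrite patchE /k mem_setE/= in_itv/= ler_distl.
  by case: ifP; rewrite ?mul1r ?mul0r.
have mF : measurable_fun setT (fubini_F mu k).
  exact: measurable_fun_fubini_tonelli_F.
have mW : measurable_fun setT (local_energy c).
  apply/measurable_EFinP; rewrite (_ : _ \o _ = fubini_F mu k)//.
  by apply/funext => xi; rewrite /fubini_F kE.
split; first exact: mW.
transitivity (\int[mu]_xi \int[mu]_x k (xi, x))%E.
  by apply: eq_integral => xi _; rewrite kE.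
have FT := @fubini_tonelli _ _ _ _ R mu mu k mk k0.
transitivity (\int[mu]_x \int[mu]_xi k (xi, x))%E; first exact: FT.
transitivity (\int[mu]_x ((2 * c)%:E * (w x ^+ 2)%:E))%E.
  apply: eq_integral => x _.
  transitivity (\int[mu]_xi ((w x ^+ 2)%:E * (\1_`[(x - c)%R, (x + c)%R] xi)%:E))%E.
    apply: eq_integral => xi _; rewrite /k /= -EFinM mulrC; congr EFin; congr (_ * _).
    rewrite indicE mem_setE/= in_itv/=; congr (_%:R); congr nat_of_bool.
    by rewrite ler_norml; apply/idP/idP => /andP[h1 h2]; apply/andP; split; lra.
  have s0 : (0 <= (w x ^+ 2)%:E)%E by rewrite lee_fin sqr_ge0.
  rewrite ge0_integralZl//; last by apply/measurable_EFinP; exact: measurable_indic.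
  rewrite integral_indic// setIT muleC; congr (_ * _)%E.
  apply: etrans (lebesgue_measure_itv _) _; rewrite /= lte_fin.
  case: ltP => [_|xc]; first by rewrite -EFinD; congr EFin; ring.
  by rewrite (_ : c = 0) ?mulr0//; lra.
have mw2 : measurable_fun setT (fun x => (w x ^+ 2)%:E).
  by apply/measurable_EFinP; exact: measurable_funX.
have c20 : (0 <= (2 * c)%:E)%E by rewrite lee_fin mulr_ge0.
rewrite ge0_integralZl//; last by move=> x _; rewrite lee_fin sqr_ge0.
rewrite [RHS]EFinM /total_energy /Rintegral fineK//.
exact: (integrable_fin_num _ iw).
Qed.

(** Turns pointwise displacement bounds into L^2 bounds. It is applied to u - u o y, to u_n - u and
    to U_n - U. *)
Lemma local_energy_L2 (f : R -> R) c d : 0 <= c -> 0 <= d -> measurable_fun setT f ->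
  (forall xi, f xi ^+ 2 <= d * local_energy c xi) ->
  L2 f /\ (\int[mu]_x (f x ^+ 2)%:E <= (d * (2 * c * total_energy))%:E)%E.
Proof.
move=> c0 d0 mf fW; have [mW iW] := integral_local_energy c0.
have mWe : measurable_fun setT (fun x => (local_energy c x)%:E) by exact/measurable_EFinP.
have W0 x : (0 <= (local_energy c x)%:E)%E by rewrite lee_fin local_energy_ge0.
have E : (\int[mu]_x (f x ^+ 2)%:E <= (d * (2 * c * total_energy))%:E)%E.
  rewrite EFinM -iW -ge0_integralZl//; apply: ge0_le_integral => //.
  - by move=> x _; rewrite lee_fin sqr_ge0.
  - by apply/measurable_EFinP; exact: measurable_funX.
  - by apply: emeasurable_funM => //; exact: measurable_cst.
  - by move=> x _; rewrite -EFinM lee_fin.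
split => //; apply/L2P; split => //; apply/integrableP; split.
  by apply/measurable_EFinP; exact: measurable_funX.
under eq_integral do rewrite /= ger0_norm ?sqr_ge0//.
by apply: le_lt_trans E _; rewrite ltry.
Qed.

Lemma primitive_continuous : continuous u.
Proof.
move=> x; apply/cvgrPdist_le => e e0.
(* Hölder gives (u x - u z)^2 <= d times the energy; the added 1 keeps the divisor positive when the
   energy is zero. *)
pose d := e ^+ 2 / (total_energy + 1).
have T0 := total_energy_ge0.
have d0 : 0 < d by rewrite divr_gt0 ?exprn_gt0// ltr_wpDl.
have /cvgrPdist_le /(_ _ d0) N : z @[z --> x] --> x by exact: cvg_id.
near=> z.
have xz : `|x - z| <= d by near: z; exact: N.
have := @displacement_sqr x z `|z - x| `|x - z| x _ (lexx _) (lexx _).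
rewrite subrr normr0 => /(_ (normr_ge0 _)) H.
apply: (@le_trans _ _ (Num.sqrt (e ^+ 2))); last by rewrite sqrtr_sqr gtr0_norm.
rewrite -sqrtr_sqr ler_sqrt ?sqr_ge0//.
rewrite (le_trans H)//; apply: (@le_trans _ _ (d * (total_energy + 1))).
  apply: ler_pM => //; first exact: local_energy_ge0.
  by rewrite (le_trans (energy_le_total _ _))// lerDl.
by rewrite /d divfK// gt_eqF// ltr_wpDl.
Unshelve. all: by end_near. Qed.

End displacement.

(** * Lagrangian coordinates *)

Section norm_bounds.
Context (R : realType).
Notation mu := (@lebesgue_measure R).
Implicit Types (f g : R -> R).

Lemma normLinf_le f (d : R) : 0 <= d -> (forall x, `|f x| <= d) -> (normLinf f <= d%:E)%E.
Proof.
move=> d0 fd; rewrite /normLinf unlock; case: ifP => _; last by rewrite lee_fin.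
by apply/ess_supP; apply: aeW => x /=; rewrite lee_fin.
Qed.

Lemma sqr_normL2_le f (A : R) : 0 <= A -> (\int[mu]_x (f x ^+ 2)%:E <= A%:E)%E ->
  (normL2 f ^+ 2 <= A%:E)%E.
Proof.
move=> A0 /(normL2_le A0) fA; rewrite expe2.
rewrite -(sqr_sqrtr A0) expr2 EFinM; apply: lee_pmul => //; exact: Lnorm_ge0.
Qed.

Lemma normH1_le f (A B : R) : 0 <= A -> 0 <= B ->
  (\int[mu]_x (f x ^+ 2)%:E <= A%:E)%E ->
  (\int[mu]_x (wderiv f x ^+ 2)%:E <= B%:E)%E ->
  (normH1 f <= (Num.sqrt (A + B))%:E)%E.
Proof.
move=> A0 B0 fA fB; rewrite /normH1 -powR12_sqrt ?addr_ge0// -poweR_EFin.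
have sq0 (g : R -> R) : (0 <= normL2 g ^+ 2)%E by rewrite expe2 mule_ge0// Lnorm_ge0.
have h1 : (0 <= normL2 f ^+ 2 + normL2 (wderiv f) ^+ 2)%E by rewrite adde_ge0.
have h2 : (0 <= (A + B)%:E)%E by rewrite lee_fin addr_ge0.
apply: gt0_ler_poweR; rewrite ?in_itv/= ?h1 ?h2 ?leey//.
by rewrite EFinD; apply: leeD; exact: sqr_normL2_le.
Qed.

End norm_bounds.

Section lagrangian_coordinates.
Context (R : realType) (phi : R -> R) (hphi : friedrichs phi).
Notation mu := (@lebesgue_measure R).
Implicit Types (u rho p f g : R -> R) (m : {measure set (measurableTypeR R) -> \bar R}).

Lemma H1_is_primitive u : H1 u -> is_primitive u (wderiv u).
Proof.
move=> [cu _ [g ug _]]; have pg := wderiv_is_primitive hphi cu ug.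
by have [] := wderivP hphi cu pg.
Qed.

Lemma is_primitive_measurable f g : is_primitive f g -> measurable_fun setT g.
Proof. by move=> [[]]. Qed.

Lemma H1_wderiv_L2 u : H1 u -> L2 (wderiv u).
Proof.
move=> [cu _ [g ug g2]]; have pg := wderiv_is_primitive hphi cu ug.
have [_ pw wg] := wderivP hphi cu pg.
by apply: (L2_ae g2 _ wg); exact: is_primitive_measurable pw.
Qed.

Lemma wderiv_L2 f g : continuous f -> is_primitive f g -> L2 g ->
  exists2 g', is_wderiv f g' & L2 g'.
Proof. by move=> cf pf g2; exists g => //; exact: is_primitive_wderiv. Qed.

Lemma barpart_L2 rho : L2const rho -> L2 (barpart rho).
Proof.
by move=> [k rk]; apply: (@xgetPex _ 0 [set k : R | L2 (fun x => rho x - k)]); exists k.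
Qed.

(** What the convergence argument retains of the slope of y: the singular part of m and its carrier
    do not appear beyond this point. The identity is pointwise because p is a function, not a
    class. *)
Definition is_slope u rho m p :=
  [/\ forall xi, 0 <= p xi <= 1,
      is_primitive (Ly m) p,
      is_primitive (u \o Ly m) (fun xi => wderiv u (Ly m xi) * p xi),
      forall xi, (1 - p xi) ^+ 2 + (wderiv u (Ly m xi) * p xi) ^+ 2
        + (barpart rho (Ly m xi) * p xi) ^+ 2 = 1 - p xi &
      (\int[mu]_xi (1 - p xi)%:E = m setT)%E].

Lemma ex_slope u rho m : (m setT < +oo)%E -> H1 u -> L2const rho ->
  ac_part_density m (fun x => wderiv u x ^+ 2 + barpart rho x ^+ 2) ->
  exists p, is_slope u rho m p.
Proof.
move=> mfin hu hrho [ms [[N [mN N0 msN]] mE]].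
pose v (x : R) : R := wderiv u x ^+ 2 + barpart rho x ^+ 2.
have mv : measurable_fun setT v.
  apply: measurable_funD; apply: measurable_funX; apply: L2_measurable.
    exact: H1_wderiv_L2.
  exact: barpart_L2.
have v0 x : 0 <= v x by rewrite addr_ge0// sqr_ge0.
have prim := is_primitive_Ly mfin mv v0 mN N0 msN mE.
exists (fun xi => Ly_slope v N (Ly m xi)); split.
- by move=> xi; rewrite Ly_slope_ge0// Ly_slope_le1.
- have := prim _ _ (is_primitive_id R); rewrite (_ : id \o _ = Ly m)//.
  by congr is_primitive; apply/funext => xi /=; rewrite mul1r.
- exact: prim (H1_is_primitive hu).
- move=> xi; move: (Ly m xi) => x; rewrite /Ly_slope indicE.
  (* On [N] the slope is 0 and the identity reads 1 = 1. Off [N], p = 1/(1 + V) and it reduces to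
     V^2 + V = V (1 + V). *)
  case: (x \in _) => /=; last by rewrite mul0r !mulr0 subr0 expr1n expr0n !addr0.
  have : v x = wderiv u x ^+ 2 + barpart rho x ^+ 2 by [].
  have : 1 + v x != 0 by rewrite gt_eqF// ltr_wpDr.
  move: (v x) (wderiv u x) (barpart rho x) => V W B V1 VE.
  rewrite !exprMn -addrA -mulrDl -VE div1r; field.
  by [].
- exact: (integral_Ly_slopeC mfin mv v0 mN N0 msN mE).
Qed.

Section slope.
Context u rho m p.
Hypotheses (mfin : (m setT < +oo)%E) (hu : H1 u) (hrho : L2const rho).
Hypothesis hp : is_slope u rho m p.
Let y := Ly m.

Lemma slope_measurable : measurable_fun setT p.
Proof. by case: hp => _ /is_primitive_measurable. Qed.

Lemma slopeC_measurable : measurable_fun setT (fun xi => 1 - p xi).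
Proof. by apply: measurable_funB => //; exact: slope_measurable. Qed.

Lemma slopeC_integrable : mu.-integrable setT (EFin \o (fun xi => 1 - p xi)).
Proof.
case: hp => p01 _ _ _ ip; apply/integrableP; split.
  by apply/measurable_EFinP; exact: slopeC_measurable.
rewrite (_ : (\int[mu]_x _)%E = m setT)// -ip.
apply: eq_integral => x _ /=; rewrite ger0_norm// subr_ge0.
by case/andP: (p01 x).
Qed.

(** Every square in the energy identity is at most the integrable [1 - p]; the next two lemmas use
    the same fact. *)
Lemma slopeC_L2 : L2 (fun xi => 1 - p xi).
Proof.
apply: L2_bound slopeC_integrable; first exact: slopeC_measurable.
case: hp => _ _ _ E _ x; rewrite -[leRHS](E x) -addrA lerDl addr_ge0//; exact: sqr_ge0.
Qed.

Lemma slope_U_L2 : L2 (fun xi => wderiv u (y xi) * p xi).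
Proof.
apply: L2_bound slopeC_integrable.
  by case: hp => _ _ /is_primitive_measurable.
case: hp => _ _ _ E _ x; rewrite -[leRHS](E x) addrAC lerDr addr_ge0//; exact: sqr_ge0.
Qed.

Lemma slope_r_L2 : L2 (fun xi => barpart rho (y xi) * p xi).
Proof.
apply: L2_bound slopeC_integrable.
  apply: measurable_funM; last exact: slope_measurable.
  by apply: measurable_Ly_comp => //; exact: L2_measurable (barpart_L2 hrho).
case: hp => _ _ _ E _ x; rewrite -[leRHS](E x) lerDr addr_ge0//; exact: sqr_ge0.
Qed.

Lemma Ly_wderiv : is_primitive y (wderiv y) /\ {ae mu, forall xi, wderiv y xi = p xi}.
Proof.
case: hp => _ py _ _ _.
by have [] := wderivP hphi (Ly_continuous mfin) py.
Qed.

Lemma comp_Ly_continuous : continuous (u \o y).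
Proof.
move=> x; apply: continuous_comp; first exact: Ly_continuous.
by case: hu => + _ _; apply.
Qed.

Lemma zeta_is_primitive : is_primitive (fun xi => y xi - xi) (fun xi => p xi - 1).
Proof. by case: hp => _ py _ _ _; exact: is_primitiveB py (is_primitive_id R). Qed.

Lemma Ly_dist_id xi : `|y xi - xi| <= fine (m setT).
Proof.
have := Ly_le mfin xi; have := Ly_lower mfin xi; rewrite -/y => h1 h2.
by rewrite ler_norml; apply/andP; split; have := fine_ge0 (measure_ge0 m setT); lra.
Qed.

Lemma Lmap_in_lagE : in_lagE (Lmap u rho m).
Proof.
have [pwy wyp] := Ly_wderiv.
have mwy := is_primitive_measurable pwy.
have mp := slope_measurable.
have M0 : 0 <= fine (m setT) by exact: fine_ge0.
split => /=.
- split.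
  + by move=> x; apply: cvgB; [exact: Ly_continuous|exact: cvg_id].
  + exists (fine (m setT)); split; first exact: num_real.
    by move=> M MM x _ /=; rewrite (le_trans (Ly_dist_id x))// ltW.
  + apply: (@wderiv_L2 _ (fun xi => p xi - 1)).
    * by move=> x; apply: cvgB; [exact: Ly_continuous|exact: cvg_id].
    * exact: zeta_is_primitive.
    * apply: (L2_bound (g := fun xi => (1 - p xi) ^+ 2)).
      - by apply: measurable_funB.
      - by move=> x; rewrite -sqrrN opprB.
      - exact: L2_integrable slopeC_L2.
- split.
  + exact: comp_Ly_continuous.
  (* Square integrability of u o y follows from that of u, since y moves points by at most m(R) and
     u - u o y is then controlled by local energy. *)
  + have [||uy _] := local_energy_L2 (H1_wderiv_L2 hu) (f := fun xi => u xi - u (y xi)) M0 M0.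
    * apply: measurable_funB; first by apply: continuous_measurable_fun; case: hu.
      exact: continuous_measurable_fun comp_Ly_continuous.
    * move=> xi; apply: (displacement_sqr (H1_is_primitive hu) (H1_wderiv_L2 hu)).
      - by rewrite subrr normr0.
      - exact: Ly_dist_id.
      - by rewrite distrC; exact: Ly_dist_id.
    have u2 : L2 u by case: hu.
    have := L2B u2 uy; congr L2; apply/funext => x /=; ring.
  + apply: (wderiv_L2 comp_Ly_continuous _ slope_U_L2).
    by case: hp.
- apply: (L2_ae slopeC_L2); first exact: measurable_funB.
  by move: wyp; apply: filterS; [exact: (ae_filter_ringOfSetsType mu)|move=> x ->].
- apply: (L2_ae slope_r_L2).
    apply: measurable_funM => //.
    by apply: measurable_Ly_comp => //; exact: L2_measurable (barpart_L2 hrho).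
  by move: wyp; apply: filterS; [exact: (ae_filter_ringOfSetsType mu)|move=> x ->].
Qed.

End slope.

(** Replaces each [wderiv] in the norm of E by an explicit slope. The single constant E bounds the
    squared distances of y_xi, U_xi, h and rbar together; A is that of U. *)
Lemma normE_Lmap_le u1 rho1 m1 p1 u2 rho2 m2 p2 (d A E : R) :
  (m1 setT < +oo)%E -> (m2 setT < +oo)%E -> H1 u1 -> H1 u2 -> L2const rho1 -> L2const rho2 ->
  is_slope u1 rho1 m1 p1 -> is_slope u2 rho2 m2 p2 ->
  0 <= d -> 0 <= A -> 0 <= E ->
  (forall xi, `|Ly m1 xi - Ly m2 xi| <= d) ->
  (\int[mu]_xi ((u1 (Ly m1 xi) - u2 (Ly m2 xi)) ^+ 2)%:E <= A%:E)%E ->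
  (\int[mu]_xi ((p1 xi - p2 xi) ^+ 2)%:E <= E%:E)%E ->
  (\int[mu]_xi ((wderiv u1 (Ly m1 xi) * p1 xi - wderiv u2 (Ly m2 xi) * p2 xi) ^+ 2)%:E <= E%:E)%E ->
  (\int[mu]_xi ((barpart rho1 (Ly m1 xi) * p1 xi - barpart rho2 (Ly m2 xi) * p2 xi) ^+ 2)%:E <= E%:E)%E ->
  (normE (lag_sub (Lmap u1 rho1 m1) (Lmap u2 rho2 m2)) <=
   (d + Num.sqrt E + Num.sqrt (A + E) + Num.sqrt E + Num.sqrt E + `|kpart rho1 - kpart rho2|)%:E)%E.
Proof.
move=> f1 f2 hu1 hu2 hr1 hr2 hp1 hp2 d0 A0 E0 yd uA pE wE rE.
have [pw1 ae1] := Ly_wderiv f1 hp1; have [pw2 ae2] := Ly_wderiv f2 hp2.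
have mw1 := is_primitive_measurable pw1; have mw2 := is_primitive_measurable pw2.
have mp1 := slope_measurable hp1; have mp2 := slope_measurable hp2.
have cd (f g : R -> R) : continuous f -> continuous g -> continuous (fun x => f x - g x).
  by move=> cf cg x; apply: cvgB; [exact: cf|exact: cg].
rewrite /normE /= /normV !EFinD; do !apply: leeD => //.
- by apply: normLinf_le => // x; rewrite opprB addrA subrK.
- have pz := is_primitiveB (zeta_is_primitive hp1) (zeta_is_primitive hp2).
  have cz m : (m setT < +oo)%E -> continuous (fun xi => Ly m xi - xi).
    by move=> fm x; apply: cvgB; [exact: Ly_continuous|exact: cvg_id].
  have [_ pz' aez] := wderivP hphi (cd _ _ (cz _ f1) (cz _ f2)) pz.
  apply: normL2_le => //.
  rewrite (ae_integral_sqr (is_primitive_measurable pz') (is_primitive_measurable pz) aez).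
  by under eq_integral do rewrite opprB addrA subrK.
- have [_ _ pU1 _ _] := hp1; have [_ _ pU2 _ _] := hp2.
  have pU := is_primitiveB pU1 pU2.
  have [_ pU' aeU] := wderivP hphi (cd _ _ (comp_Ly_continuous f1 hu1) (comp_Ly_continuous f2 hu2)) pU.
  apply: normH1_le => //.
  by rewrite (ae_integral_sqr (is_primitive_measurable pU') (is_primitive_measurable pU) aeU).
- apply: normL2_le => //.
  rewrite (@ae_integral_sqr _ _ (fun x => p2 x - p1 x)).
  + by under eq_integral do rewrite -sqrrN opprB.
  + have mc (f : R -> R) : measurable_fun setT f -> measurable_fun setT (fun x => 1 - f x).
      by move=> mf; apply: measurable_funB.
    exact: measurable_funB (mc _ mw1) (mc _ mw2).
  + exact: measurable_funB.
  + move: ae1 ae2; apply: filterS2; first exact: (ae_filter_ringOfSetsType mu).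
    by move=> x -> ->; ring.
- apply: normL2_le => //.
  have mr rho m : (m setT < +oo)%E -> L2const rho -> measurable_fun setT (barpart rho \o Ly m).
    by move=> fm hr; apply: measurable_Ly_comp => //; exact: L2_measurable (barpart_L2 hr).
  have m1' := mr _ _ f1 hr1; have m2' := mr _ _ f2 hr2.
  rewrite (ae_integral_sqr _ _ _ : _ = (\int[mu]_x ((barpart rho1 (Ly m1 x) * p1 x - barpart rho2 (Ly m2 x) * p2 x) ^+ 2)%:E)%E)//.
  + exact: measurable_funB (measurable_funM m1' mw1) (measurable_funM m2' mw2).
  + exact: measurable_funB (measurable_funM m1' mp1) (measurable_funM m2' mp2).
  + move: ae1 ae2; apply: filterS2; first exact: (ae_filter_ringOfSetsType mu).
    by move=> x -> ->.
Qed.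

End lagrangian_coordinates.

(** * Weak convergence of derivatives *)

Section shift.
Context (R : realType).
Notation mu := (@lebesgue_measure R).
Implicit Types (f g : R -> R) (a b c : R).

Lemma patch_shift g a b c x :
  ((fun x => g (x + c)) \_ `[a, b]) x = (g \_ `[a + c, b + c]) (1 * x + c).
Proof. by rewrite !patchE mul1r !mem_setE/= !in_itv/= !lerD2r. Qed.

Lemma locally_integrable_shift g c : locally_integrable setT g ->
  locally_integrable setT (fun x => g (x + c)).
Proof.
move=> lg; have [mg _ _] := lg.
have mc : measurable_fun setT (fun x : R => x + c) by exact: measurable_funD.
have ms : measurable_fun setT (fun x : R => g (x + c)) by exact: (measurableT_comp mg mc).
apply: locally_integrable_itv => // M.
have i1 := integrable_patch (measurable_itv _) (integrable_itv (- M + c) (M + c) lg).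
have i2 := integrable_affine c (oner_neq0 R) i1.
have : mu.-integrable setT ((EFin \o (fun x => g (x + c))) \_ `[- M, M]).
  apply: eq_integrable i2 => // x _ /=.
  by rewrite restrict_EFin /= patch_shift.
by move=> H; apply/integrable_mkcond.
Qed.

Lemma is_primitive_shift f g c : is_primitive f g ->
  is_primitive (fun x => f (x + c)) (fun x => g (x + c)).
Proof.
move=> [lg fg]; split; first exact: locally_integrable_shift.
move=> a b ab; rewrite fg ?lerD2r// Rintegral_mkcond [RHS]Rintegral_mkcond.
have i1 := integrable_patch (measurable_itv _) (integrable_itv (a + c) (b + c) lg).
have := Rintegral_affine c (oner_neq0 R) i1.
rewrite normr1 invr1 mul1r => <-.
by apply: eq_Rintegral => x _; rewrite patch_shift.
Qed.

Lemma is_primitiveZ f g c : is_primitive f g ->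
  is_primitive (fun x => c * f x) (fun x => c * g x).
Proof.
move=> [lg fg]; have [mg _ _] := lg; split.
  apply: locally_integrable_itv; first exact: measurable_funM.
  by move=> M; apply: (integrableZl _ c (integrable_itv _ _ lg)).
move=> a b ab; rewrite RintegralZl//; last exact: integrable_itv.
by rewrite -fg// mulrBr.
Qed.

Lemma Rintegral_cst_itv c a b : a <= b -> \int[mu]_(x in `[a, b]) c = c * (b - a).
Proof.
move=> ab; have [_ E] := is_primitiveZ c (@is_primitive_id R).
by rewrite mulrBr (E _ _ ab); apply: eq_Rintegral => x _; rewrite mulr1.
Qed.

End shift.

(** * Weak convergence tested on a bounded square integrable derivative *)

Section weak_convergence.
Context (R : realType) (psi Psi : R -> R).
Notation mu := (@lebesgue_measure R).
Hypothesis pPsi : is_primitive Psi psi.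
Hypothesis psi1 : forall x, `|psi x| <= 1.
Hypothesis psi2 : L2 psi.

Let quot (k : nat) x := k.+1%:R * (Psi (x + k.+1%:R^-1) - Psi x).
Let dquot (k : nat) x := k.+1%:R * (psi (x + k.+1%:R^-1) - psi x).

Lemma bounded_primitive_lipschitz a b : a <= b -> `|Psi b - Psi a| <= b - a.
Proof.
move=> ab; have [lpsi ->//] := pPsi.
have ii := integrable_itv a b lpsi.
rewrite (le_trans (le_normr_Rintegral _ ii))//.
have [l1 i1] := @is_primitive_id R; rewrite (i1 _ _ ab).
by apply: le_Rintegral => //; [exact: (integrable_abse ii)|exact: integrable_itv].
Qed.

Lemma quot_le1 k x : `|quot k x| <= 1.
Proof.
have k0 : 0 < k.+1%:R :> R by [].
have xk : x <= x + k.+1%:R^-1 by rewrite lerDl invr_ge0.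
rewrite /quot normrM gtr0_norm// -ler_pdivlMl// mulr1.
by rewrite (le_trans (bounded_primitive_lipschitz xk))// addrAC subrr add0r.
Qed.

Lemma quot_is_primitive k : is_primitive (quot k) (dquot k).
Proof. by apply: is_primitiveZ; apply: is_primitiveB => //; exact: is_primitive_shift. Qed.

Lemma dquot_le k x : `|dquot k x| <= k.+1%:R * 2.
Proof.
rewrite /dquot normrM ger0_norm// ler_wpM2l// (le_trans (ler_normB _ _))//.
by rewrite -[leRHS]/(1 + 1) lerD.
Qed.

Lemma quot_continuous k : continuous (quot k).
Proof.
have cP : continuous Psi.
  move=> x; apply/cvgrPdist_le => e e0.
  have /cvgrPdist_le /(_ _ e0) : z @[z --> x] --> x by exact: cvg_id.
  apply: filterS => z; apply: le_trans.
  have [zx|/ltW xz] := leP z x.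
    by rewrite [leRHS]ger0_norm ?subr_ge0//; exact: bounded_primitive_lipschitz.
  rewrite distrC (distrC x) [leRHS]ger0_norm ?subr_ge0//.
  exact: bounded_primitive_lipschitz.
move=> x; apply: cvgM; first exact: cvg_cst.
apply: cvgB; last exact: cP.
have ca : {for x, continuous (fun x : R => x + k.+1%:R^-1)}.
  by apply: cvgD; [exact: cvg_id|exact: cvg_cst].
exact: (continuous_comp ca (cP _)).
Qed.

Lemma quot_measurable k : measurable_fun setT (quot k).
Proof. exact: continuous_measurable_fun (@quot_continuous k). Qed.

Let mpsi := L2_measurable psi2.

Lemma tail_cvg : (fun M : nat => \int[mu]_x (psi x ^+ 2 * (1 - \1_`[- M%:R, M%:R] x))%:E)%E @ \oo --> 0%E.
Proof.
have mI (M : nat) : measurable_fun setT (\1_`[- M%:R, M%:R] : R -> R) by exact: measurable_indic.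
have [||||_ _] := @dominated_convergence _ _ _ mu _ measurableT
  (fun M x => (psi x ^+ 2 * (1 - \1_`[- M%:R, M%:R] x))%:E) (cst 0%E)
  (EFin \o (fun x => psi x ^+ 2)) _ _ _ (L2_integrable psi2).
- move=> M; apply/measurable_EFinP; apply: measurable_funM; first exact: measurable_funX.
  exact: measurable_funB.
- exact: measurable_cst.
- apply: aeW => x _; apply: cvg_near_cst.
  exists (Num.bound `|x|) => // M /= xM; congr EFin.
  rewrite indicE mem_set /= ?subrr ?mulr0// in_itv/= -ler_norml.
  by rewrite (le_trans (ltW (archi_boundP _)))// ler_nat.
- apply: aeW => x M _ /=; rewrite lee_fin normrM (ger0_norm (sqr_ge0 _)) ler_piMr ?sqr_ge0//.
  by rewrite indicE; case: (_ \in _) => /=; rewrite ?subrr ?subr0 ?normr0 ?normr1.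
by rewrite integral_cst//= mul0e.
Qed.

Lemma mid_cvg (M : R) : (fun k : nat => \int[mu]_x (\1_`[- M, M] x * (psi x - quot k x) ^+ 2)%:E)%E @ \oo --> 0%E.
Proof.
have mI : measurable_fun setT (\1_`[- M, M] : R -> R) by exact: measurable_indic.
(* Domination with 4 = (1 + 1)^2, since [psi] and its difference quotients are bounded by 1. *)
have iI : mu.-integrable setT (EFin \o (fun x => 4 * (\1_`[- M, M] : R -> R) x)).
  have i1 : mu.-integrable setT (EFin \o (\1_`[- M, M] : R -> R)) by exact: integrable_indic_itv.
  exact: (integrableZl measurableT (4 : R) i1).
have [||||_ _] := @dominated_convergence _ _ _ mu _ measurableT
  (fun k x => (\1_`[- M, M] x * (psi x - quot k x) ^+ 2)%:E) (cst 0%E) _ _ _ _ iI.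
- move=> k; apply/measurable_EFinP; apply: measurable_funM => //; apply: measurable_funX.
  by apply: measurable_funB => //; exact: quot_measurable.
- exact: measurable_cst.
- have := is_primitive_ae_cvg pPsi; apply: filterS; first exact: (ae_filter_ringOfSetsType mu).
  move=> x cx _; apply: cvg_EFin; first exact: nearW.
  rewrite (_ : 0%R = \1_`[- M, M] x * ((psi x - psi x) * (psi x - psi x)) :> R); last by rewrite subrr !mulr0.
  apply: cvgM; first exact: cvg_cst.
  by apply: cvgM; (apply: cvgB; [exact: cvg_cst|exact: cx]).
- apply: aeW => x k _ /=; rewrite lee_fin.
  have p0 : 0 <= \1_`[- M, M] x * (psi x - quot k x) ^+ 2 by rewrite mulr_ge0 ?sqr_ge0.
  rewrite ger0_norm// mulrC.
  apply: ler_wpM2r => //; have := psi1 x; have := quot_le1 k x.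
  by rewrite !ler_norml => /andP[h1 h2] /andP[h3 h4]; nra.
by rewrite integral_cst//= mul0e.
Qed.

(** The constant bound on the quotients is integrable only on bounded intervals, hence the cut-off
    to [-M, M]. The square integrability of [psi] makes the part outside small. *)
Lemma step_approx (e : R) : 0 < e -> exists (M k : nat),
  (\int[mu]_x ((psi x - \1_`[- M%:R, M%:R] x * quot k x) ^+ 2)%:E <= e%:E)%E.
Proof.
move=> e0; have e20 : 0 < e / 2 by rewrite divr_gt0.
have H (s : nat -> \bar R) : s @ \oo --> 0%E -> exists n, (s n <= (e / 2)%:E)%E.
  move=> s0; have N : nbhs (0%E : \bar R) [set y | (y < (e / 2)%:E)%E].
    by apply: open_nbhs_nbhs; split; [exact: open_ereal_lt_ereal|rewrite /= lte_fin].
  have [n _ nP] := s0 _ N; by exists n; apply/ltW/nP => /=.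
have [M MP] := H _ tail_cvg; have [k kP] := H _ (mid_cvg M%:R).
exists M, k.
have mI : measurable_fun setT (\1_`[- M%:R, M%:R] : R -> R) by exact: measurable_indic.
have mq := quot_measurable k.
rewrite [X in (_ <= X%:E)%E](splitr e) EFinD; apply: le_trans (leeD MP kP).
rewrite -ge0_integralD//.
- rewrite le_eqVlt; apply/orP; left; apply/eqP; apply: eq_integral => x _.
  by rewrite -EFinD; congr EFin; rewrite indicE; case: (_ \in _) => /=; ring.
- by move=> x _; rewrite lee_fin mulr_ge0 ?sqr_ge0// indicE; case: (_ \in _); rewrite /= ?subrr ?subr0.
- by apply/measurable_EFinP; apply: measurable_funM; [exact: measurable_funX|exact: measurable_funB].
- by move=> x _; rewrite lee_fin mulr_ge0 ?sqr_ge0.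
- by apply/measurable_EFinP; apply: measurable_funM => //; apply: measurable_funX; exact: measurable_funB.
Qed.

(* The difference quotients of Psi approximate psi in L^2 and, unlike psi, are
   primitives, so that the derivatives can be moved off [D n]. *)
Lemma weak_cvg (D dD : nat -> R -> R) (delta : nat -> R) (C : R) :
  (forall n, is_primitive (D n) (dD n)) -> (forall n, continuous (D n)) ->
  (forall n x, `|D n x| <= delta n) -> delta @ \oo --> 0 ->
  (forall n, L2 (dD n)) -> (forall n, \int[mu]_x (dD n x ^+ 2) <= C) ->
  (fun n => \int[mu]_x (dD n x * psi x)) @ \oo --> 0.
Proof.
move=> pD cD Dd d0 dD2 dDC; apply/cvgrPdist_le => e e0.
have C0 : 0 <= C by apply: le_trans (dDC 0%N); apply: Rintegral_ge0 => x _; exact: sqr_ge0.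
(* The weight in Young's inequality for the remainder: it contributes at most e/2 + e/4, and the
   part with the quotients another e/4. *)
pose eta := e / (C + 1).
have eta0 : 0 < eta by rewrite divr_gt0// ltr_wpDl.
have ee0 : 0 < e / 2 * eta by rewrite mulr_gt0// divr_gt0.
have [M [k kP]] := step_approx ee0.
pose chi x := \1_`[- M%:R, M%:R] x * quot k x.
have mchi : measurable_fun setT chi.
  by apply: measurable_funM; [exact: measurable_indic|exact: quot_measurable].
pose r x := psi x - chi x.
have mr : measurable_fun setT r by exact: measurable_funB.
have r2 : L2 r.
  apply/L2P; split => //; apply/integrableP; split.
    by apply/measurable_EFinP; exact: measurable_funX.
  apply: le_lt_trans (ltry (e / 2 * eta)); apply: le_trans kP.
  by rewrite le_eqVlt; apply/orP; left; apply/eqP; apply: eq_integral => x _ /=; rewrite ger0_norm ?sqr_ge0.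
have rI : \int[mu]_x (r x ^+ 2) <= e / 2 * eta.
  rewrite -lee_fin /Rintegral fineK//; exact: (integrable_fin_num _ (L2_integrable r2)).
have chi2 : L2 chi.
  rewrite (_ : chi = fun x => psi x - r x); first exact: L2B.
  by apply/funext => x; rewrite /r; ring.
have K0 : 0 < 2 + M%:R * 2 * (k.+1%:R * 2) :> R by rewrite ltr_wpDr// !mulr_ge0.
(* M and k are now fixed, so [delta n] can be made small against the constant of the integration by
   parts. *)
have d1 : 0 < e / 4 / (2 + M%:R * 2 * (k.+1%:R * 2)) by rewrite !divr_gt0.
have /cvgrPdist_le /(_ _ d1) := d0; apply: filterS => n; rewrite sub0r normrN => dn.
have dn0 : 0 <= delta n by rewrite (le_trans _ (Dd n 0)).
rewrite sub0r normrN.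
have -> : \int[mu]_x (dD n x * psi x) = \int[mu]_x (dD n x * r x) + \int[mu]_x (dD n x * chi x).
  rewrite -RintegralD//; [|exact: L2M|exact: L2M].
  by apply: eq_Rintegral => x _; rewrite /r; ring.
have A : `|\int[mu]_x (dD n x * r x)| <= eta / 2 * C + (2 * eta)^-1 * (e / 2 * eta).
  have i1 := L2M (dD2 n) r2.
  rewrite (le_trans (le_normr_Rintegral _ i1))//.
  have i2 := integrable_lincomb (eta / 2) (2 * eta)^-1 (L2_integrable (dD2 n)) (L2_integrable r2).
  apply: (@le_trans _ _ (\int[mu]_x (eta / 2 * dD n x ^+ 2 + (2 * eta)^-1 * r x ^+ 2))).
    apply: le_Rintegral => //; first exact: (integrable_abse i1).
    move=> x _; rewrite normrM -(real_normK (num_real (dD n x))) -(real_normK (num_real (r x))).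
    (* Young's inequality with weight [eta], as a completed square. *)
    rewrite -subr_ge0 (_ : _ - _ = (2 * eta)^-1 * (eta * `|dD n x| - `|r x|) ^+ 2).
      by rewrite mulr_ge0 ?sqr_ge0// invr_ge0 mulr_ge0// ltW.
    by field; rewrite gt_eqF.
  have iZ c (f : R -> R) : L2 f -> mu.-integrable setT (EFin \o (fun x => c * f x ^+ 2)).
    by move=> f2; apply: (integrableZl measurableT c (L2_integrable f2)).
  rewrite RintegralD//; [|exact: iZ|exact: iZ].
  rewrite !RintegralZl//; [|exact: L2_integrable|exact: L2_integrable].
  have h1 : 0 <= eta / 2 by rewrite divr_ge0// ltW.
  have h2 : 0 <= (2 * eta)^-1 by rewrite invr_ge0 mulr_ge0// ltW.
  by apply: lerD; apply: ler_wpM2l.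
have B : `|\int[mu]_x (dD n x * chi x)| <= e / 4.
  have M0 : - M%:R <= M%:R :> R by rewrite ge0_cp.
  have iDq : mu.-integrable `[- M%:R, M%:R] (EFin \o (fun x => D n x * dquot k x)).
    by apply: integrableM_continuous => //; have [] := quot_is_primitive k.
  have idDq : mu.-integrable `[- M%:R, M%:R] (EFin \o (fun x => dD n x * quot k x)).
    rewrite (_ : _ \o _ = EFin \o (fun x => quot k x * dD n x)); last by apply/funext => x /=; rewrite mulrC.
    by apply: integrableM_continuous; [exact: quot_continuous|have [] := pD n].
  have -> : \int[mu]_x (dD n x * chi x) = \int[mu]_(x in `[- M%:R, M%:R]) (dD n x * quot k x).
    rewrite [RHS]Rintegral_mkcond; apply: eq_Rintegral => x _.
    by rewrite /chi patchE indicE; case: (_ \in _); rewrite /= ?mul1r ?mul0r ?mulr0.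
  have := Rintegral_by_parts M0 (pD n) (quot_is_primitive k) iDq idDq.
  move=> /(canRL (addKr _)) ->.
  have l1 : `|\int[mu]_(x in `[- M%:R, M%:R]) (D n x * dquot k x)| <= M%:R * 2 * (delta n * (k.+1%:R * 2)).
    rewrite (le_trans (le_normr_Rintegral _ iDq))//.
    apply: (@le_trans _ _ (\int[mu]_(x in `[- M%:R, M%:R]) (delta n * (k.+1%:R * 2)))).
      apply: le_Rintegral => //; first exact: (integrable_abse iDq).
        by apply: integrable_itv; apply: locally_integrable_continuous => x; exact: cvg_cst.
      by move=> x _; rewrite normrM ler_pM// dquot_le.
    by rewrite Rintegral_cst_itv// le_eqVlt; apply/orP; left; apply/eqP; ring.
  have t1 x : `|D n x * quot k x| <= delta n.
    by rewrite normrM -[leRHS]mulr1 ler_pM// quot_le1.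
  (* The two boundary terms give 2; the integral gives the length 2M times the bound 2(k + 1) on the
     density of the quotient. *)
  apply: (@le_trans _ _ (delta n * (2 + M%:R * 2 * (k.+1%:R * 2)))).
    rewrite (le_trans (ler_normD _ _))// normrN (le_trans (lerD l1 (ler_normB _ _)))//.
    have := t1 M%:R; have := t1 (- M%:R); nra.
  by rewrite -ler_pdivlMr// (le_trans (ler_norm _)).
rewrite (le_trans (ler_normD _ _))// (le_trans (lerD A B))//.
rewrite (_ : (2 * eta)^-1 * (e / 2 * eta) = e / 4); last by field; rewrite gt_eqF.
have : eta * C <= e.
  by rewrite /eta mulrAC ler_pdivrMr ?ltr_wpDl// ler_pM2l// lerDl.
lra.
Qed.

End weak_convergence.

(** * Mollification of a function *)

Section fubini.
Context d1 d2 (T1 : measurableType d1) (T2 : measurableType d2) (R : realType).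
Variables (m1 : {sigma_finite_measure set T1 -> \bar R}).
Variables (m2 : {sigma_finite_measure set T2 -> \bar R}).
Variables (h : T1 -> T2 -> R).
Hypothesis mh : measurable_fun setT (fun z : T1 * T2 => h z.1 z.2).

(** Tonelli applies to the positive and negative parts separately, and [fine] of their difference is
    measurable even where that difference is not finite. *)
Lemma measurable_Rintegral_param : measurable_fun setT (fun x => \int[m2]_y h x y).
Proof.
pose f (z : T1 * T2) := (h z.1 z.2)%:E.
have mf : measurable_fun setT f by exact/measurable_EFinP.
have mp : measurable_fun setT (fun x => \int[m2]_y (f^\+ (x, y)))%E.
  apply: (measurable_fun_fubini_tonelli_F f^\+%E) => //.
  exact: measurable_funepos.
have mn : measurable_fun setT (fun x => \int[m2]_y (f^\- (x, y)))%E.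
  apply: (measurable_fun_fubini_tonelli_F f^\-%E) => //.
  exact: measurable_funeneg.
rewrite (_ : (fun x => _) = fine \o (fun x => \int[m2]_y (f^\+ (x, y)) - \int[m2]_y (f^\- (x, y)))%E).
  by apply: measurableT_comp => //; exact: emeasurable_funB.
apply/funext => x; rewrite /Rintegral /= integralE; congr (fine (_ - _)%E).
  by apply: eq_integral => y _; rewrite !funeposE.
by apply: eq_integral => y _; rewrite !funenegE.
Qed.

Hypothesis i2 : forall x, m2.-integrable setT (EFin \o h x).
Hypothesis i1 : forall y, m1.-integrable setT (EFin \o (h ^~ y)).
Hypothesis ih : (\int[m2]_y \int[m1]_x `|h x y|%:E < +oo)%E.

Let imh : (m1 \x m2)%E.-integrable setT (fun z => (h z.1 z.2)%:E).
Proof.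
have mhe : measurable_fun setT (fun z : T1 * T2 => (h z.1 z.2)%:E) by exact/measurable_EFinP.
by apply/integrable21ltyP.
Qed.

(** Finiteness of the iterated integral of |h| takes the place of a dominating product: for w only
    in L^2, the kernel phi(z) w(s - z/N) has in general no bound of the form A(s) B(z). *)
Lemma Rintegral_fubini_tonelli :
  \int[m1]_x (\int[m2]_y h x y) = \int[m2]_y (\int[m1]_x h x y).
Proof.
rewrite /Rintegral; congr fine.
have := Fubini imh => /= E.
transitivity (\int[m1]_x \int[m2]_y (h x y)%:E)%E.
  by apply: eq_integral => x _; rewrite fineK//; apply: integrable_fin_num (i2 x).
by rewrite E; apply: eq_integral => y _; rewrite fineK//; apply: integrable_fin_num (i1 y).
Qed.

Lemma Rintegral_param_integrable :
  m1.-integrable setT (EFin \o (fun x => \int[m2]_y h x y)).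
Proof.
have := integrable_fubini_F imh.
by apply: eq_integrable => // x _ /=; rewrite fineK//; apply: integrable_fin_num (i2 x).
Qed.

End fubini.

Section mollified_function.
Context (R : realType) (phi u : R -> R) (hphi : friedrichs phi) (hu : H1 u).
Context (n : nat).
Hypothesis n0 : (0 < n)%N.
Notation mu := (@lebesgue_measure R).
Implicit Types (v : R -> R) (a b c x z xi : R).
Let w := wderiv u.
Let N : R := n%:R.

Let N0 : 0 < N. Proof. by rewrite ltr0n. Qed.

Lemma locally_integrable_affine v c b : c != 0 -> locally_integrable setT v ->
  locally_integrable setT (fun x => v (c * x + b)).
Proof.
move=> c0 lv; have [mv _ _] := lv.
have mva : measurable_fun setT (fun x : R => v (c * x + b)).
  exact: (measurableT_comp mv (measurable_affine c b)).
apply: locally_integrable_itv => // M.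
(* The affine map sends [-M, M] into [-K, K]. *)
pose K := `|c| * M + `|b|.
have i1 := integrable_patch (measurable_itv _) (integrable_itv (- K) K lv).
have i2 := integrable_affine b c0 i1.
have i3 : mu.-integrable `[- M, M] (EFin \o (fun x => (v \_ `[- K, K]) (c * x + b))).
  by apply: integrableS i2.
apply: eq_integrable i3 => // x; rewrite mem_setE/= in_itv/= -ler_norml => xM.
rewrite patchE mem_set//= in_itv/= -ler_norml (le_trans (ler_normD _ _))// normrM.
by rewrite /K lerD// ler_wpM2l.
Qed.

Lemma subr_divE x z : x - z / N = - N^-1 * z + x.
Proof. by rewrite mulNr mulrC addrC. Qed.

Lemma locally_integrable_subdiv v x : locally_integrable setT v ->
  locally_integrable setT (fun z => v (x - z / N)).
Proof.
move=> lv; rewrite (_ : (fun z => _) = fun z => v (- N^-1 * z + x)).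
  by apply: locally_integrable_affine => //; rewrite oppr_eq0 invr_eq0 gt_eqF.
by apply/funext => z; rewrite subr_divE.
Qed.

Lemma mollify_integrable v x : locally_integrable setT v ->
  mu.-integrable setT (EFin \o (fun z => phi z * v (x - z / N))).
Proof. by move=> lv; apply: (friedrichs_mul_integrable hphi); exact: locally_integrable_subdiv. Qed.

Lemma mollifyE v x : locally_integrable setT v ->
  \int[mu]_y (N * phi (N * (x - y)) * v y) = \int[mu]_z (phi z * v (x - z / N)).
Proof.
move=> lv; have i1 := mollify_integrable x lv.
have Nn0 : - N != 0 by rewrite oppr_eq0 gt_eqF.
have E := Rintegral_affine (N * x) Nn0 i1.
have i2 := integrable_affine (N * x) Nn0 i1.
have F y : x - (- N * y + N * x) / N = y by field; rewrite gt_eqF.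
have G y : - N * y + N * x = N * (x - y) by ring.
rewrite normrN gtr0_norm// in E; apply: (mulfI (lt0r_neq0 (_ : 0 < N^-1))); first by rewrite invr_gt0.
rewrite -E -RintegralZl//.
- by apply: eq_Rintegral => y _; rewrite F G; field; rewrite gt_eqF.
- have := integrableZl measurableT N i2.
  by apply: eq_integrable => // y _ /=; rewrite F G -EFinM mulrA.
Qed.

Definition mollify v x := \int[mu]_z (phi z * v (x - z / N)).

Lemma u_approxE : u_approx phi u n = mollify u.
Proof.
apply/funext => x; apply: mollifyE; apply: locally_integrable_continuous.
by case: hu.
Qed.

Lemma mollify_measurable v : measurable_fun setT v -> measurable_fun setT (mollify v).
Proof.
move=> mv; pose h (x z : R) := phi z * v (x - z / N).
have mh : measurable_fun setT (fun t : R * R => h t.1 t.2).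
  apply: measurable_funM.
    exact: (measurableT_comp (friedrichs_measurable hphi) measurable_snd).
  apply: (measurableT_comp mv); apply: measurable_funB => //.
  by apply: measurable_funM => //; exact: measurable_cst.
exact: (@measurable_Rintegral_param _ _ _ _ _ mu h mh).
Qed.

Lemma divN_le z : `|z| <= 1 -> `|z / N| <= N^-1.
Proof.
move=> z1; rewrite normrM (gtr0_norm (_ : 0 < N^-1)) ?invr_gt0//.
by rewrite -[leRHS]mul1r ler_wpM2r// invr_ge0 ltW.
Qed.

(** The left side is the square of a [phi]-average of u(x - z/N) - u(a), and all points x - z/N lie
    within 1/N of x; hence the extra [N^-1] in two of the hypotheses. *)
Lemma mollify_displacement x a xi c d : `|x - xi| + N^-1 <= c -> `|a - xi| <= c ->
  `|x - a| + N^-1 <= d ->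
  (mollify u x - u a) ^+ 2 <= d * local_energy w c xi.
Proof.
move=> xc ac xd.
have lu : locally_integrable setT u by apply: locally_integrable_continuous; case: hu.
have d0 : 0 <= d by apply: le_trans xd; rewrite addr_ge0// invr_ge0 ltW.
have H z : `|z| <= 1 -> `|u (x - z / N) - u a| <= Num.sqrt (d * local_energy w c xi).
  move=> z1; apply: (displacement_norm (H1_is_primitive hphi hu) (H1_wderiv_L2 hphi hu)) => //.
    rewrite addrAC (le_trans (ler_normB _ _))// (le_trans _ xc)// lerD2l; exact: divN_le.
  rewrite addrAC (le_trans (ler_normB _ _))// (le_trans _ xd)// lerD2l; exact: divN_le.
have := mollifier_average hphi (locally_integrable_subdiv x lu) H.
rewrite -/(mollify u x) => h.
rewrite -(real_normK (num_real _)) -[leRHS]sqr_sqrtr ?mulr_ge0 ?local_energy_ge0//.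
by rewrite ler_sqr ?nnegrE ?sqrtr_ge0.
Qed.

(** Fubini exchanges the average over z with the integral over [a, b], and each translate of u is a
    primitive of the same translate of w. *)
Lemma mollify_is_primitive : is_primitive (mollify u) (mollify w).
Proof.
have pu := H1_is_primitive hphi hu; have w2 := H1_wderiv_L2 hphi hu.
have [lw _] := pu; have mw := L2_measurable w2.
have lu : locally_integrable setT u by apply: locally_integrable_continuous; case: hu.
have step a b : a <= b -> mu.-integrable `[a, b] (EFin \o mollify w) /\
    mollify u b - mollify u a = \int[mu]_(x in `[a, b]) mollify w x.
  move=> ab.
  pose h s z := \1_`[a, b] s * (phi z * w (s - z / N)).
  have mI : measurable_fun setT (\1_`[a, b] : R -> R) by exact: measurable_indic.
  have mh : measurable_fun setT (fun t : R * R => h t.1 t.2).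
    apply: measurable_funM; first exact: (measurableT_comp mI measurable_fst).
    apply: measurable_funM.
      exact: (measurableT_comp (friedrichs_measurable hphi) measurable_snd).
    apply: (measurableT_comp mw); apply: measurable_funB => //.
    by apply: measurable_funM => //; exact: measurable_cst.
  have i2 s : mu.-integrable setT (EFin \o h s).
    by have := integrableZl measurableT (\1_`[a, b] s : R) (mollify_integrable s lw).
  have psh z := is_primitive_shift (- (z / N)) pu.
  have hE z : h ^~ z = (fun s => phi z * w (s - z / N)) \_ `[a, b].
    by apply/funext => s; rewrite /h patchE indicE; case: ifP; rewrite ?mul1r ?mul0r.
  have iz z : mu.-integrable `[a, b] (EFin \o (fun s => w (s - z / N))).
    by apply: integrable_itv; have [] := psh z.
  have iz' z : mu.-integrable `[a, b] (EFin \o (fun s => phi z * w (s - z / N))).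
    by apply: (integrableZl _ (phi z) (iz z)).
  have i1 z : mu.-integrable setT (EFin \o (h ^~ z)).
    by rewrite hE; apply: integrable_patch => //; exact: iz'.
  have ih : (\int[mu]_z \int[mu]_s `|h s z|%:E < +oo)%E.
    (* From [|w| <= 1 + w ^+ 2] on [a, b]: a bound of the integral in s that is the same for all
       translates. *)
    pose K := (b - a) + total_energy w.
    apply: (@le_lt_trans _ _ (\int[mu]_z (phi z * K)%:E)%E).
      apply: ge0_le_integral => //.
      - by move=> z _; exact: integral_ge0.
      - have mah : measurable_fun setT (fun t : R * R => `|h t.1 t.2|%:E).
          by apply/measurable_EFinP; exact: measurableT_comp.
        have ah0 (t : R * R) : (0 <= `|h t.1 t.2|%:E)%E by rewrite lee_fin.
        have mG : measurable_fun setT (fubini_G mu (fun t : R * R => `|h t.1 t.2|%:E)).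
          exact: measurable_fun_fubini_tonelli_G.
        exact: mG.
      - by apply/measurable_EFinP; apply: measurable_funM => //; exact: friedrichs_measurable.
      move=> z _; pose k s := phi z * (\1_`[a, b] s + w (s - z / N) ^+ 2).
      have iw : mu.-integrable setT (EFin \o (fun s => w (s - z / N) ^+ 2)).
        have := integrable_affine (- (z / N)) (oner_neq0 R) (L2_integrable w2).
        by apply: eq_integrable => // s _ /=; rewrite mul1r.
      have iI : mu.-integrable setT (EFin \o (\1_`[a, b] : R -> R)) by exact: integrable_indic_itv.
      have iIw := integrableD measurableT iI iw.
      have ik : mu.-integrable setT (EFin \o k) by exact: (integrableZl measurableT (phi z) iIw).
      have kI : \int[mu]_s k s = phi z * K.
        rewrite RintegralZl// RintegralD//; congr (_ * (_ + _)).
          rewrite -[RHS]mul1r -Rintegral_cst_itv// [RHS]Rintegral_mkcond.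
          by apply: eq_Rintegral => s _; rewrite patchE indicE; case: ifP.
        have := Rintegral_affine (- (z / N)) (oner_neq0 R) (L2_integrable w2).
        rewrite normr1 invr1 mul1r -/(total_energy w) => <-.
        by apply: eq_Rintegral => s _; rewrite mul1r.
      rewrite -kI /Rintegral fineK; last exact: integrable_fin_num.
      apply: ge0_le_integral => //.
      - by apply/measurable_EFinP; apply: measurableT_comp => //; apply/measurable_EFinP; exact: (measurable_int _ (i1 z)).
      - exact: (measurable_int _ ik).
      move=> s _; rewrite lee_fin /h /k normrM mulrC normrM (ger0_norm (friedrichs_ge0 hphi z)) -mulrA.
      apply: ler_wpM2l; first exact: friedrichs_ge0.
      rewrite indicE; case: (s \in _) => /=; last by rewrite normr0 mulr0 add0r sqr_ge0.
      rewrite normr1 mulr1 -(real_normK (num_real (w _))).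
      by have := normr_ge0 (w (s - z / N)); nra.
    have iK : mu.-integrable setT (EFin \o (fun z => phi z * K)).
      by have := integrableZr measurableT K (friedrichs_integrable hphi); apply.
    have K0 : 0 <= K by rewrite addr_ge0 ?subr_ge0// total_energy_ge0.
    have /integrableP[_] := iK; rewrite (_ : (\int[mu]_x _)%E = (\int[mu]_z (phi z * K)%:E)%E)//.
    by apply: eq_integral => z _ /=; rewrite ger0_norm// mulr_ge0// friedrichs_ge0.
  have pI : mu.-integrable setT (EFin \o (fun s => \int[mu]_z h s z)).
    exact: (@Rintegral_param_integrable _ _ _ _ _ mu mu h mh i2 ih).
  have hM : (fun s => \int[mu]_z h s z) = mollify w \_ `[a, b].
    apply/funext => s; rewrite patchE /h RintegralZl//; last exact: mollify_integrable.
    by rewrite indicE; case: ifP; rewrite ?mul1r ?mul0r.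
  split.
    apply/integrable_mkcond => //.
    by move: pI; rewrite hM -restrict_EFin.
  rewrite [RHS]Rintegral_mkcond -hM (@Rintegral_fubini_tonelli _ _ _ _ _ mu mu h mh i2 i1 ih).
  rewrite /mollify -RintegralB//; [|exact: mollify_integrable|exact: mollify_integrable].
  apply: eq_Rintegral => z _; rewrite -mulrBr hE -Rintegral_mkcond RintegralZl//.
  by have [_ <-//] := psh z.
split; last by move=> a b /step[].
apply: locally_integrable_itv; first exact: mollify_measurable.
move=> M; have [M0|M0] := leP (- M) M; first by have [] := step _ _ M0.
by rewrite set_itv_ge; [exact: integrable_set0|rewrite bnd_simp -ltNge].
Qed.

End mollified_function.

(** * Mollification of a measure *)

Section density_measure.
Context d (T : measurableType d) (R : realType) (m : {measure set T -> \bar R}).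
Context (f : T -> R) (mf : measurable_fun setT f) (f0 : forall x, 0 <= f x).

(** Measurability and nonnegativity are arguments so that the measure structure can be attached to
    the term itself. *)
Definition density_measure of measurable_fun setT f & (forall x, 0 <= f x) :=
  fun A : set T => (\int[m]_(x in A) (f x)%:E)%E.
Local Notation nu := (density_measure mf f0).

Let nu0 : nu set0 = 0%E. Proof. exact: integral_set0. Qed.

Let nu_ge0 A : (0 <= nu A)%E.
Proof. by apply: integral_ge0 => x _; rewrite lee_fin. Qed.

Let nu_sigma_additive : semi_sigma_additive nu.
Proof.
move=> F mF tF mUF; rewrite /density_measure ge0_integral_bigcup//.
- by apply: is_cvg_ereal_nneg_natsum => k _; apply: integral_ge0 => x _; rewrite lee_fin.
- by apply/measurable_EFinP; exact: measurable_funTS.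
- by move=> x _; rewrite lee_fin.
Qed.

HB.instance Definition _ := isMeasure.Build _ _ _ nu nu0 nu_ge0 nu_sigma_additive.
End density_measure.

Section mollified_measure.
Context (R : realType) (phi : R -> R) (hphi : friedrichs phi).
Context (m : {finite_measure set (measurableTypeR R) -> \bar R}).
Context (n : nat).
Hypothesis n0 : (0 < n)%N.
Notation mu := (@lebesgue_measure R).
Let N : R := n%:R.
Let N0 : 0 < N. Proof. by rewrite ltr0n. Qed.

Lemma friedrichs_derive1_support x : 1 < `|x| -> derive1 phi x = 0.
Proof. exact: (derive1_eq0 (friedrichs_support hphi)). Qed.

Lemma friedrichs_derive1_integrable : mu.-integrable setT (EFin \o derive1 phi).
Proof.
have c1 := smooth_continuous (smooth_derive1 (friedrichs_smooth hphi)).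
have := integrable_patch (measurable_itv _) (integrable_itv (-1) 1 (locally_integrable_continuous c1)).
apply: eq_integrable => // x _ /=; rewrite patchE; case: ifPn => //.
rewrite mem_setE/= in_itv/= -ler_norml -ltNge => x1.
by rewrite friedrichs_derive1_support.
Qed.

Lemma friedrichs_FTC b : \int[mu]_z (derive1 phi z * ((z <= b)%R : nat)%:R) = phi b.
Proof.
have c1 := smooth_continuous (smooth_derive1 (friedrichs_smooth hphi)).
have [_ E] := is_primitive_derive1 (fun x => smooth_derivable (x := x) (friedrichs_smooth hphi)) c1.
(* A lower limit that lies below b and strictly to the left of the support of [phi]. *)
have Kb : - (`|b| + 2) <= b by have := lerNnormlW (lexx `|b|); lra.
have := E _ _ Kb; rewrite [phi (- _)](friedrichs_support hphi); last first.
  by rewrite normrN ger0_norm ?addr_ge0//; have := normr_ge0 b; lra.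
rewrite subr0 => ->; rewrite [RHS]Rintegral_mkcond; apply: eq_Rintegral => z _.
rewrite patchE mem_setE/= in_itv/=; case: (leP z b) => zb; last by rewrite andbF mulr0.
rewrite andbT; case: (leP (- (`|b| + 2)) z) => zK; rewrite mulr1//.
rewrite friedrichs_derive1_support// ler0_norm; have := normr_ge0 b; lra.
Qed.

Lemma friedrichs_bounded : exists B, forall x, phi x <= B.
Proof.
have [M [_ MP]] : bounded_set (phi @` `[(-1 : R), 1]).
  apply/compact_bounded/continuous_compact; last exact: segment_compact.
  by apply: continuous_subspaceT; exact: friedrichs_continuous hphi.
exists (`|M| + 1) => x; have [x1|x1] := leP `|x| 1.
  rewrite (le_trans (ler_norm _))//; apply: MP; first by rewrite (le_lt_trans (ler_norm _))// ltrDl.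
  by exists x => //=; rewrite in_itv/= -ler_norml.
by rewrite (friedrichs_support hphi (ltW x1)) addr_ge0.
Qed.

Definition mollify_measure x := \int[mu]_z (N * derive1 phi z * cumul m (x - z / N)).
Let g := mollify_measure.

Let ker (x t : R) : R := N * phi (N * (x - t)).

Let ker_ge0 x t : 0 <= ker x t.
Proof. by apply: mulr_ge0; [exact: ltW N0|exact: friedrichs_ge0]. Qed.

Let indic_ker_ge0 (S : set R) x s t : 0 <= \1_S x * ker s t.
Proof. by rewrite indicE; apply: mulr_ge0. Qed.

Let ker_measurable2 : measurable_fun setT (fun z : R * R => ker z.1 z.2).
Proof.
apply: measurable_funM; first exact: measurable_cst.
apply: (measurableT_comp (friedrichs_measurable hphi)).
by apply: measurable_funM; [exact: measurable_cst|exact: measurable_funB].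
Qed.

Let ker_measurable x : measurable_fun setT (ker x).
Proof. exact: (measurableT_comp ker_measurable2 (measurable_pair1 x)). Qed.

Let ker_measurable1 t : measurable_fun setT (ker ^~ t).
Proof. exact: (measurableT_comp ker_measurable2 (measurable_pair2 t)). Qed.

Let m_cst c : m.-integrable setT (EFin \o (cst c : R -> R)).
Proof. by apply: finite_measure_integrable_cst. Qed.

Lemma mollify_kernel_integrable x : m.-integrable setT (EFin \o ker x).
Proof.
have [B phiB] := friedrichs_bounded.
apply: (le_integrable _ _ _ (m_cst (N * B))) => //.
  by apply/measurable_EFinP; exact: ker_measurable.
move=> t _ /=; rewrite lee_fin (ger0_norm (ker_ge0 x t)); apply: le_trans (ler_norm _).
by rewrite /ker ler_wpM2l// ltW.
Qed.

(** Write F(x - z/N) as the m-integral of the indicator of t <= x - z/N and exchange: the integral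
    of phi' over z <= N(x - t) is phi(N(x - t)). Thus g is the density of m convolved with the
    scaled mollifier. *)
Lemma mollify_measureE x : g x = \int[m]_t ker x t.
Proof.
pose h (z t : R) : R := N * derive1 phi z * ((t <= x - z / N)%R : nat)%:R.
have md : measurable_fun setT (derive1 phi).
  by apply/measurable_EFinP; exact: (measurable_int _ friedrichs_derive1_integrable).
have mh : measurable_fun setT (fun p : R * R => h p.1 p.2).
  apply: measurable_funM.
    apply: measurable_funM; first exact: measurable_cst.
    exact: (measurableT_comp md measurable_fst).
  rewrite (_ : (fun p : R * R => _) = \1_[set p : R * R | p.2 <= x - p.1 / N]); last first.
    by apply/funext => p; rewrite indicE mem_setE.
  apply: measurable_indic; rewrite -[X in measurable X]setTI.
  apply: measurable_fun_le => //; apply: measurable_funB => //.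
  by apply: measurable_funM => //; exact: measurable_cst.
have iA : mu.-integrable setT (EFin \o (fun z => `|N * derive1 phi z|)).
  exact: integrable_abse (integrableZl measurableT N friedrichs_derive1_integrable).
have hb z t : `|h z t| <= `|N * derive1 phi z| * (cst 1 : R -> R) t.
  rewrite /h normrM ler_wpM2l//.
  by case: (t <= _); rewrite /= ?normr1 ?normr0.
have := @Rintegral_fubini _ _ _ _ _ mu m h _ _ mh iA (m_cst 1) hb.
have -> : \int[mu]_z \int[m]_t h z t = g x.
  apply: eq_Rintegral => z _; rewrite /h RintegralZl//; last first.
    apply: (le_integrable _ _ _ (m_cst 1)) => //.
      apply/measurable_EFinP; rewrite (_ : (fun t : R => _) = \1_`]-oo, x - z / N]); last first.
        by apply/funext => t; rewrite indicE mem_setE /= in_itv.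
      exact: measurable_indic.
    by move=> t _ /=; rewrite lee_fin; case: (t <= _); rewrite /= ?normr1 ?normr0.
  congr (_ * _); rewrite /cumul /Rintegral; congr fine.
  transitivity (\int[m]_t (\1_`]-oo, (x - z / N)%R] t)%:E)%E; last first.
    by rewrite integral_indic// setIT.
  by apply: eq_integral => t _; rewrite indicE mem_setE /= in_itv.
move=> ->; apply: eq_Rintegral => t _.
rewrite /ker -friedrichs_FTC -RintegralZl//; last first.
  apply: (le_integrable _ _ _ friedrichs_derive1_integrable) => //.
    apply/measurable_EFinP; apply: measurable_funM => //.
    rewrite (_ : (fun z : R => _) = \1_`]-oo, N * (x - t)]); last first.
      by apply/funext => z; rewrite indicE mem_setE /= in_itv.
    exact: measurable_indic.
  by move=> z _ /=; rewrite lee_fin normrM ler_piMr//; case: (z <= _); rewrite /= ?normr1 ?normr0.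
apply: eq_Rintegral => z _; rewrite /h -mulrA; congr (_ * (_ * _%:R)); congr nat_of_bool.
by rewrite lerBrDr addrC -lerBrDr ler_pdivrMr// mulrC.
Qed.

Lemma mollify_measure_ge0 x : 0 <= g x.
Proof. by rewrite mollify_measureE; apply: Rintegral_ge0 => t _; exact: ker_ge0. Qed.

Lemma mollify_measure_measurable : measurable_fun setT g.
Proof.
rewrite (_ : g = fun x => \int[m]_t ker x t); last by apply/funext => x; exact: mollify_measureE.
exact: (@measurable_Rintegral_param _ _ _ _ _ m ker ker_measurable2).
Qed.

Let gE x : ((g x)%:E = \int[m]_t (ker x t)%:E)%E.
Proof.
rewrite mollify_measureE /Rintegral fineK//.
exact: (integrable_fin_num _ (mollify_kernel_integrable x)).
Qed.

Let ker_mass t : (\int[mu]_s (ker s t)%:E = 1)%E.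
Proof.
have fi : (\int[mu]_x (EFin \o phi) x = 1)%E := friedrichs_integral hphi.
have := @ge0_integral_affine R N (- (N * t)) (EFin \o phi) (lt0r_neq0 N0).
rewrite fi mule1 gtr0_norm// => E.
transitivity (N%:E * \int[mu]_s (EFin \o phi) (N * s + - (N * t))%R)%E.
  rewrite -ge0_integralZl//.
  - by apply: eq_integral => s _; rewrite /ker -EFinM mulrBr.
  - by apply/measurable_EFinP; apply: (measurableT_comp (friedrichs_measurable hphi)); exact: measurable_affine.
  - by move=> s _; rewrite lee_fin friedrichs_ge0.
  - by rewrite lee_fin ltW.
rewrite E; first by rewrite -EFinM mulfV ?gt_eqF.
- by apply/measurable_EFinP; exact: friedrichs_measurable.
- by move=> s; rewrite lee_fin friedrichs_ge0.
Qed.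

Let ker_support s t : ker s t != 0 -> `|s - t| <= N^-1.
Proof.
move=> k0; rewrite leNgt; apply/negP => st; move/negP: k0; apply; apply/eqP.
rewrite /ker (friedrichs_support hphi) ?mulr0// normrM gtr0_norm// ltW//.
by rewrite mulrC -ltr_pdivrMr// mul1r.
Qed.

Let tonelli (S : set R) : measurable S ->
  (\int[mu]_(s in S) (g s)%:E = \int[m]_t \int[mu]_s (\1_S s * ker s t)%:E)%E.
Proof.
move=> mS; have mI : measurable_fun setT (\1_S : R -> R) by exact: measurable_indic.
have mk : measurable_fun setT (fun p : R * R => (\1_S p.1 * ker p.1 p.2)%:E).
  by apply/measurable_EFinP; apply: measurable_funM => //; exact: (measurableT_comp mI measurable_fst).
have k0 (p : R * R) : (0 <= (\1_S p.1 * ker p.1 p.2)%:E)%E by rewrite lee_fin.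
have FT := @fubini_tonelli _ _ _ _ R mu m _ mk k0.
rewrite -[RHS]FT integral_mkcond; apply: eq_integral => s _ /=.
rewrite patchE indicE; case: (s \in S).
  by rewrite gE; apply: eq_integral => t _; rewrite mul1r.
by rewrite integral0_eq// => t _; rewrite mul0r.
Qed.

(** Inserting the unit mass of the kernel writes m S as the same double integral as in [tonelli],
    with the indicator read at t instead of s. Since the kernel vanishes for |s - t| > 1/N, the
    comparisons below are pointwise. *)
Let mass_indic (S : set R) : measurable S ->
  (m S = \int[m]_t \int[mu]_s (\1_S t * ker s t)%:E)%E.
Proof.
move=> mS; transitivity (\int[m]_t (\1_S t)%:E)%E; first by rewrite integral_indic// setIT.
apply: eq_integral => t _.
rewrite -[LHS]mule1 -(ker_mass t) -ge0_integralZl//.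
- by apply/measurable_EFinP; exact: ker_measurable1.
- by move=> s _; rewrite lee_fin.
Qed.

Let inner_measurable (A : R -> R -> R) :
  measurable_fun setT (fun p : R * R => A p.1 p.2) -> (forall s t, 0 <= A s t) ->
  measurable_fun setT (fun t => \int[mu]_s (A s t)%:E)%E.
Proof.
move=> mA A0.
have mAe : measurable_fun setT (fun p : R * R => (A p.1 p.2)%:E) by exact/measurable_EFinP.
have A0e (p : R * R) : (0 <= (A p.1 p.2)%:E)%E by rewrite lee_fin.
have mG : measurable_fun setT (fubini_G mu (fun p : R * R => (A p.1 p.2)%:E)).
  exact: measurable_fun_fubini_tonelli_G.
exact: mG.
Qed.

Let compare (A B : R -> R -> R) :
  measurable_fun setT (fun p : R * R => A p.1 p.2) -> (forall s t, 0 <= A s t) ->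
  measurable_fun setT (fun p : R * R => B p.1 p.2) -> (forall s t, 0 <= B s t) ->
  (forall s t, A s t <= B s t) ->
  (\int[m]_t \int[mu]_s (A s t)%:E <= \int[m]_t \int[mu]_s (B s t)%:E)%E.
Proof.
move=> mA A0 mB B0 AB; apply: ge0_le_integral => //.
- by move=> t _; apply: integral_ge0 => s _; rewrite lee_fin.
- exact: inner_measurable.
- exact: inner_measurable.
move=> t _; apply: ge0_le_integral => //.
- by move=> s _; rewrite lee_fin.
- by apply/measurable_EFinP; exact: (measurableT_comp mA (measurable_pair2 t)).
- by apply/measurable_EFinP; exact: (measurableT_comp mB (measurable_pair2 t)).
- by move=> s _; rewrite lee_fin.
Qed.

Let mS1 (S : set R) : measurable S -> measurable_fun setT (fun p : R * R => \1_S p.1 * ker p.1 p.2).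
Proof.
move=> mS; have mI : measurable_fun setT (\1_S : R -> R) by exact: measurable_indic.
by apply: measurable_funM => //; exact: (measurableT_comp mI measurable_fst).
Qed.

Let mS2 (S : set R) : measurable S -> measurable_fun setT (fun p : R * R => \1_S p.2 * ker p.1 p.2).
Proof.
move=> mS; have mI : measurable_fun setT (\1_S : R -> R) by exact: measurable_indic.
by apply: measurable_funM => //; exact: (measurableT_comp mI measurable_snd).
Qed.

Lemma mollify_measure_le (S S' : set R) : measurable S -> measurable S' ->
  (forall s t, S s -> `|s - t| <= N^-1 -> S' t) ->
  (\int[mu]_(s in S) (g s)%:E <= m S')%E.
Proof.
move=> mS mS' SS'; rewrite tonelli// mass_indic//; apply: compare.
- exact: mS1.
- by move=> s t; exact: indic_ker_ge0.
- exact: mS2.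
- by move=> s t; exact: indic_ker_ge0.
move=> s t; have [->|kn0] := eqVneq (ker s t) 0; first by rewrite !mulr0.
apply: ler_wpM2r => //; rewrite !indicE.
case: (boolP (s \in S)) => // /set_mem Ss.
by rewrite (mem_set (SS' _ _ Ss (ker_support kn0))).
Qed.

Lemma mollify_measure_ge (S S' : set R) : measurable S -> measurable S' ->
  (forall s t, S' t -> `|s - t| <= N^-1 -> S s) ->
  (m S' <= \int[mu]_(s in S) (g s)%:E)%E.
Proof.
move=> mS mS' SS'; rewrite tonelli// mass_indic//; apply: compare.
- exact: mS2.
- by move=> s t; exact: indic_ker_ge0.
- exact: mS1.
- by move=> s t; exact: indic_ker_ge0.
move=> s t; have [->|kn0] := eqVneq (ker s t) 0; first by rewrite !mulr0.
apply: ler_wpM2r => //; rewrite !indicE.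
case: (boolP (t \in S')) => // /set_mem St.
by rewrite (mem_set (SS' _ _ St (ker_support kn0))).
Qed.

(** By Jensen for the probability density [phi], the square of the mollified u_x is at most the
    mollification of u_x^2, and u_x^2 dx is dominated by m. This keeps the square root in
    [rho_approx] at or above 1/n. *)
Lemma mollify_sqr_le u : H1 u ->
  (forall f : R -> \bar R, measurable_fun setT f -> (forall x, (0 <= f x)%E) ->
    (\int[mu]_x (f x * (wderiv u x ^+ 2)%:E) <= \int[m]_x f x)%E) ->
  forall x, mollify phi n (wderiv u) x ^+ 2 <= g x.
Proof.
move=> hu wm x; have w2 := H1_wderiv_L2 hphi hu.
have lw := L2_locally_integrable w2.
have lw2 := locally_integrable_of_integrable (L2_integrable w2).
have mwx : measurable_fun setT (fun z : R => wderiv u (x - z / N)).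
  by have [] := locally_integrable_subdiv n0 x lw.
have iw2 := mollify_integrable hphi n0 x lw2.
have K0 : 0 < \int[mu]_z phi z by rewrite (friedrichs_Rintegral hphi).
have := @Rintegral_jensen _ (measurableTypeR R) R mu setT (fun z => wderiv u (x - z / N)) phi
  measurableT mwx (fun z _ => friedrichs_ge0 hphi z) (friedrichs_integrable hphi) K0 iw2.
rewrite (friedrichs_Rintegral hphi) mul1r => J; apply: (le_trans J).
rewrite -(mollifyE hphi n0 x lw2) mollify_measureE.
have mke : measurable_fun setT (fun t => (ker x t)%:E) by apply/measurable_EFinP; exact: ker_measurable.
have ke0 t : (0 <= (ker x t)%:E)%E by rewrite lee_fin.
have W := wm (fun t => (ker x t)%:E) mke ke0.
have fk := integrable_fin_num measurableT (mollify_kernel_integrable x).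
have E : (\int[mu]_t (N * phi (N * (x - t)) * wderiv u t ^+ 2)%:E =
    \int[mu]_t ((ker x t)%:E * (wderiv u t ^+ 2)%:E))%E.
  by apply: eq_integral => t _; rewrite -EFinM.
rewrite /Rintegral fine_le// E ge0_fin_numE; first by apply: le_lt_trans W _; rewrite ltey_eq fk.
by apply: integral_ge0 => t _; rewrite -EFinM lee_fin mulr_ge0 ?sqr_ge0.
Qed.

End mollified_measure.

(** * The approximating triples *)

Section approximation.
Context (R : realType) (phi u : R -> R) (hphi : friedrichs phi).
Context (m : {finite_measure set (measurableTypeR R) -> \bar R}).
Hypothesis hD : eulerian u (cst 0) m.
Notation mu := (@lebesgue_measure R).
Let w := wderiv u.

Lemma finite_measure_lty : (m setT < +oo)%E.
Proof. by rewrite -ge0_fin_numE// fin_num_measure. Qed.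

Lemma eulerian_H1 : H1 u.
Proof. by case: hD. Qed.

Lemma eulerian_sqr_le (f : R -> \bar R) : measurable_fun setT f -> (forall x, (0 <= f x)%E) ->
  (\int[mu]_x (f x * (w x ^+ 2)%:E) <= \int[m]_x f x)%E.
Proof.
move=> mf f0; case: hD => hu hrho [ms [_ mE]].
pose v (x : R) : R := wderiv u x ^+ 2 + barpart (cst 0) x ^+ 2.
have mw := L2_measurable (H1_wderiv_L2 hphi hu).
have mv : measurable_fun setT v.
  apply: measurable_funD; apply: measurable_funX => //; apply: L2_measurable.
  exact: barpart_L2.
have v0 x : 0 <= v x by rewrite addr_ge0// sqr_ge0.
rewrite (@ge0_integral_density _ (measurableTypeR R) R mu m ms v mv v0 mE f mf f0).
apply: (@le_trans _ _ (\int[mu]_x (f x * (v x)%:E))%E); last first.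
  by rewrite leeDl// integral_ge0.
apply: ge0_le_integral => //.
- by move=> x _; rewrite mule_ge0// lee_fin sqr_ge0.
- by apply: emeasurable_funM => //; apply/measurable_EFinP; exact: measurable_funX.
- by apply: emeasurable_funM => //; apply/measurable_EFinP.
by move=> x _; apply: lee_wpmul2l => //; rewrite lee_fin lerDl sqr_ge0.
Qed.

Context (n : nat).
Hypothesis n0 : (0 < n)%N.
Let N : R := n%:R.
Let N0 : 0 < N. Proof. by rewrite ltr0n. Qed.
Let g := mollify_measure phi m n.
Let wn := mollify phi n w.
Let un := u_approx phi u n.
Let hu := eulerian_H1.
Let mg : measurable_fun setT g.
Proof. exact (mollify_measure_measurable hphi m n0). Qed.
Let g0 x : 0 <= g x. Proof. exact: mollify_measure_ge0. Qed.

Lemma invN_le1 : N^-1 <= 1.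
Proof. by rewrite invf_le1// ler1n. Qed.

Lemma mollify_measure_total : (\int[mu]_x (g x)%:E <= m setT)%E.
Proof. exact: (@mollify_measure_le _ _ hphi m _ n0 setT setT). Qed.

Lemma mollify_measure_integrable : mu.-integrable setT (EFin \o g).
Proof.
apply/integrableP; split; first by apply/measurable_EFinP; exact: mg.
apply: le_lt_trans finite_measure_lty; apply: le_trans mollify_measure_total.
by rewrite le_eqVlt; apply/orP; left; apply/eqP; apply: eq_integral => x _ /=; rewrite ger0_norm.
Qed.

Lemma mollify_wderiv_sqr_le x : wn x ^+ 2 <= g x.
Proof. exact: (mollify_sqr_le hphi n0 hu eulerian_sqr_le). Qed.

Lemma mollify_wderiv_measurable : measurable_fun setT wn.
Proof.
by apply: mollify_measurable => //; exact: L2_measurable (H1_wderiv_L2 hphi hu).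
Qed.

Lemma mollify_wderiv_L2 : L2 wn.
Proof.
exact: L2_bound mollify_wderiv_measurable mollify_wderiv_sqr_le mollify_measure_integrable.
Qed.

Lemma u_approx_is_primitive : is_primitive un wn.
Proof. by rewrite /un (u_approxE hphi hu n0); exact: (mollify_is_primitive hphi hu n0). Qed.

Lemma u_approx_continuous : continuous un.
Proof. exact: primitive_continuous u_approx_is_primitive mollify_wderiv_L2. Qed.

Lemma u_approx_H1 : H1 un.
Proof.
split; first exact: u_approx_continuous.
- have cu : continuous u by case: hu.
  have [||ud _] := local_energy_L2 (H1_wderiv_L2 hphi hu) (f := fun x => un x - u x) ler01 ler01.
  + by apply: measurable_funB; apply: continuous_measurable_fun => //; exact: u_approx_continuous.
  + move=> x; rewrite /un (u_approxE hphi hu n0).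
    apply: (mollify_displacement hphi hu n0); rewrite ?subrr ?normr0 ?add0r//; exact: invN_le1.
  have u2 : L2 u by case: hu.
  (* Only differences are available: u_n = (u_n - u) - ((u - u) - u). *)
  have := L2B ud (L2B (L2B u2 u2) u2); congr L2; apply/funext => x /=; ring.
- exists wn; last exact: mollify_wderiv_L2.
  exact: is_primitive_wderiv u_approx_continuous u_approx_is_primitive.
Qed.

(** This is rhobar_n; that 1/n is indeed the constant [kpart] chooses follows once it is known to be
    in L^2. *)
Definition rho_excess x := rho_approx phi u m n x - N^-1.
Let e := rho_excess.

Let rhoE x : rho_approx phi u m n x = Num.sqrt ((N ^+ 2)^-1 + g x - wn x ^+ 2).
Proof. by []. Qed.

Let arg_ge x : (N^-1) ^+ 2 <= (N ^+ 2)^-1 + g x - wn x ^+ 2.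
Proof. by rewrite exprVn -addrA lerDl subr_ge0 mollify_wderiv_sqr_le. Qed.

Lemma rho_excess_ge0 x : 0 <= e x.
Proof.
rewrite subr_ge0 rhoE; have i0 : 0 <= N^-1 by rewrite invr_ge0 ltW.
rewrite -[leLHS](ger0_norm i0) -sqrtr_sqr ler_sqrt ?arg_ge//.
by apply: le_trans (arg_ge x); exact: sqr_ge0.
Qed.

(** Square 1/N + e and cancel 1/N^2. Nonnegativity of the three terms other than g then bounds both
    e^2 and (2/N) e by g. *)
Lemma rho_excess_eq x : e x ^+ 2 + 2 / N * e x = g x - wn x ^+ 2.
Proof.
have a0 : 0 <= (N ^+ 2)^-1 + g x - wn x ^+ 2 by apply: le_trans (arg_ge x); exact: sqr_ge0.
have := sqr_sqrtr a0; rewrite -rhoE /e /rho_excess => H.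
have -> : g x - wn x ^+ 2 = rho_approx phi u m n x ^+ 2 - (N ^+ 2)^-1 by rewrite H; ring.
by field; rewrite gt_eqF.
Qed.

Lemma rho_excess_measurable : measurable_fun setT e.
Proof.
apply: measurable_funB => //.
rewrite (_ : rho_approx _ _ _ _ = Num.sqrt \o (fun x => (N ^+ 2)^-1 + g x - wn x ^+ 2)); last first.
  by apply/funext => x /=; rewrite rhoE.
apply: measurableT_comp; first exact: continuous_measurable_fun (@sqrt_continuous R).
apply: measurable_funB; first by apply: measurable_funD => //; exact: mg.
by apply: measurable_funX; exact: mollify_wderiv_measurable.
Qed.

Let c0 x : 0 <= 2 / N * e x.
Proof. by rewrite mulr_ge0 ?rho_excess_ge0// divr_ge0// ltW. Qed.

Lemma rho_excess_sqr_le x : e x ^+ 2 <= g x.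
Proof. by have := rho_excess_eq x; have := c0 x; have := sqr_ge0 (wn x); lra. Qed.

Lemma rho_excess_le x : 2 / N * e x <= g x.
Proof. by have := rho_excess_eq x; have := sqr_ge0 (e x); have := sqr_ge0 (wn x); lra. Qed.

Lemma rho_excess_L2 : L2 e.
Proof. exact: L2_bound rho_excess_measurable rho_excess_sqr_le mollify_measure_integrable. Qed.

Lemma rho_approx_L2const : L2const (rho_approx phi u m n).
Proof. by exists N^-1; exact: rho_excess_L2. Qed.

Lemma rho_approx_kpart : kpart (rho_approx phi u m n) = N^-1.
Proof. by apply: kpart_eq; exact: rho_excess_L2. Qed.

Lemma rho_approx_barpart : barpart (rho_approx phi u m n) = e.
Proof. by apply/funext => x; rewrite /barpart rho_approx_kpart. Qed.

(** Kept in the form used by [mu_approx], with [wderiv] of u_n rather than the mollified u_x: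
    [approx_measure] is then that set function, equipped with its measure structure. *)
Definition approx_density x := wderiv un x ^+ 2 + (rho_approx phi u m n x - N^-1) ^+ 2.

Lemma approx_density_measurable : measurable_fun setT approx_density.
Proof.
apply: measurable_funD; apply: measurable_funX; last exact: rho_excess_measurable.
exact: L2_measurable (H1_wderiv_L2 hphi u_approx_H1).
Qed.

Lemma approx_density_ge0 x : 0 <= approx_density x.
Proof. by rewrite addr_ge0// sqr_ge0. Qed.

Definition approx_measure : {measure set (measurableTypeR R) -> \bar R} :=
  density_measure mu approx_density_measurable approx_density_ge0.

Lemma approx_ac_part : ac_part_density approx_measure
  (fun x => wderiv un x ^+ 2 + barpart (rho_approx phi u m n) x ^+ 2).
Proof.
exists mzero; split; first by exists set0; split => //; exact: measure0.
by move=> A mA; rewrite rho_approx_barpart /mzero adde0.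
Qed.

Lemma ae_approx_density : {ae mu, forall x, approx_density x = g x - 2 / N * e x}.
Proof.
have [_ _] := wderivP hphi u_approx_continuous u_approx_is_primitive.
apply: filterS; first exact: (ae_filter_ringOfSetsType mu).
move=> x wx; rewrite /approx_density wx.
by have := rho_excess_eq x; rewrite /e /rho_excess; lra.
Qed.

(** Stated as a sum, to avoid subtracting extended reals before finiteness is known. *)
Lemma approx_measureD (A : set (measurableTypeR R)) : measurable A ->
  (approx_measure A + \int[mu]_(x in A) (2 / N * e x)%:E = \int[mu]_(x in A) (g x)%:E)%E.
Proof.
move=> mA; rewrite /approx_measure /= /density_measure.
have mc : measurable_fun setT (fun x => 2 / N * e x).
  by apply: measurable_funM => //; exact: rho_excess_measurable.
rewrite -ge0_integralD//.
- apply: ae_eq_integral => //.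
  + apply: emeasurable_funD; apply/measurable_EFinP; apply: measurable_funTS => //.
    exact: approx_density_measurable.
  + by apply/measurable_EFinP; apply: measurable_funTS; exact: mg.
  have := ae_approx_density; apply: filterS; first exact: (ae_filter_ringOfSetsType mu).
  by move=> x -> _; rewrite -EFinD subrK.
- by move=> x _; rewrite lee_fin approx_density_ge0.
- by apply/measurable_EFinP; apply: measurable_funTS; exact: approx_density_measurable.
- by move=> x _; rewrite lee_fin.
- by apply/measurable_EFinP; apply: measurable_funTS.
Qed.

Lemma approx_measure_total : (approx_measure setT <= m setT)%E.
Proof.
apply: le_trans mollify_measure_total; rewrite -approx_measureD// leeDl//.
by apply: integral_ge0 => x _; rewrite lee_fin.
Qed.

Definition approx_error := \int[mu]_x (2 / N * e x).

Lemma approx_error_integrable : mu.-integrable setT (EFin \o (fun x => 2 / N * e x)).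
Proof.
apply: integrable_bound mollify_measure_integrable.
  by apply: measurable_funM => //; exact: rho_excess_measurable.
by move=> x; rewrite ger0_norm// rho_excess_le.
Qed.

Lemma approx_error_ge0 : 0 <= approx_error.
Proof. by apply: Rintegral_ge0. Qed.

Lemma approx_cumul x :
  cumul m (x - N^-1) - approx_error <= cumul approx_measure x <= cumul m (x + N^-1) + approx_error.
Proof.
have fm := finite_measure_lty.
have fa : (approx_measure setT < +oo)%E by apply: le_lt_trans approx_measure_total fm.
pose S : set (measurableTypeR R) := `]-oo, x]%classic.
have mS : measurable S by exact: measurable_itv.
have D := approx_measureD mS.
have up : (\int[mu]_(s in S) (g s)%:E <= m `]-oo, (x + N^-1)%R]%classic)%E.
  apply: (mollify_measure_le hphi m n0) => // s t.
  by rewrite /S /= !in_itv/= ler_norml => sx /andP[h1 h2]; lra.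
have lo : (m `]-oo, (x - N^-1)%R]%classic <= \int[mu]_(s in S) (g s)%:E)%E.
  apply: (mollify_measure_ge hphi m n0) => // s t.
  by rewrite /S /= !in_itv/= ler_norml => sx /andP[h1 h2]; lra.
have E0 : (0 <= \int[mu]_(x in S) (2 / N * e x)%:E)%E.
  by apply: integral_ge0 => z _; rewrite lee_fin.
have E1 : (\int[mu]_(x in S) (2 / N * e x)%:E <= approx_error%:E)%E.
  rewrite /approx_error /Rintegral fineK; last exact: (integrable_fin_num _ approx_error_integrable).
  apply: ge0_subset_integral => //; last by move=> z _; rewrite lee_fin.
  by apply/measurable_EFinP; apply: measurable_funM => //; exact: rho_excess_measurable.
have Ef : (\int[mu]_(x in S) (2 / N * e x)%:E)%E \is a fin_num.
  by rewrite ge0_fin_numE//; apply: le_lt_trans E1 (ltry _).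
rewrite -D in up lo.
have aS := finite_measure_fin_num fa mS.
have m1 := finite_measure_fin_num fm (measurable_itv `]-oo, (x + N^-1)]).
have m2 := finite_measure_fin_num fm (measurable_itv `]-oo, (x - N^-1)]).
rewrite /cumul -/S; move: E0 E1 up lo.
rewrite -(fineK Ef) -(fineK aS) -(fineK m1) -(fineK m2) -EFinD !lee_fin => h1 h2 h3 h4.
by have := approx_error_ge0; move=> h5; apply/andP; split; lra.
Qed.

(** On [-M, M], 2e <= 1 + e^2 <= 1 + g gives the density (1 + g)/N. Outside, (2/N) e <= g, and
    mollification moves mass by at most 1/N <= 1, so the mass of g there comes from m outside
    [-(M - 1), M - 1]. *)
Lemma approx_error_le M : 0 <= M ->
  approx_error <= (2 * M + fine (m setT)) / N + fine (m (~` `[- (M - 1), M - 1]%classic)).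
Proof.
move=> M0; have fm := finite_measure_lty.
pose S : set R := `[- M, M]%classic.
have mS : measurable S by exact: measurable_itv.
have mSc : measurable (~` S) by exact: measurableC.
pose T : set (measurableTypeR R) := ~` `[- (M - 1), M - 1]%classic.
have mT : measurable T by apply: measurableC; exact: measurable_itv.
have iS : mu.-integrable setT (EFin \o (\1_S : R -> R)) by exact: integrable_indic_itv.
have iSc : mu.-integrable setT (EFin \o (g \_ (~` S))).
  by apply: integrable_patch => //; apply: integrableS mollify_measure_integrable.
have i1 := integrable_lincomb N^-1 N^-1 iS mollify_measure_integrable.
have i2 := integrableD measurableT i1 iSc.
have pw x : 2 / N * e x <= (N^-1 * \1_S x + N^-1 * g x) + (g \_ (~` S)) x.
  have i0 : 0 <= N^-1 by rewrite invr_ge0 ltW.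
  rewrite patchE indicE in_setC; case: (x \in S) => /=.
    rewrite addr0 mulr1 -[X in _ <= X + _]mulr1 -mulrDr mulrAC mulrC ler_wpM2l//.
    by have := rho_excess_sqr_le x; have := sqr_ge0 (e x - 1); nra.
  rewrite mulr0 add0r (le_trans (rho_excess_le x))// lerDr mulr_ge0//.
have : approx_error <= \int[mu]_x ((N^-1 * \1_S x + N^-1 * g x) + (g \_ (~` S)) x).
  by apply: le_Rintegral => //; exact: approx_error_integrable.
move/le_trans; apply.
rewrite RintegralD// RintegralD//; last 2 first.
- exact: (integrableZl measurableT N^-1 iS).
- exact: (integrableZl measurableT N^-1 mollify_measure_integrable).
rewrite !RintegralZl//; last exact: mollify_measure_integrable.
have -> : \int[mu]_x (\1_S x : R) = 2 * M.
  transitivity (\int[mu]_(x in `[- M, M]) (1 : R)).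
    by rewrite [RHS]Rintegral_mkcond; apply: eq_Rintegral => x _; rewrite patchE indicE; case: ifP.
  rewrite Rintegral_cst_itv; [ring|lra].
rewrite -mulrDr mulrC; apply: lerD.
  apply: ler_wpM2r; first by rewrite invr_ge0 ltW.
  rewrite lerD2l /Rintegral fine_le ?mollify_measure_total//.
    exact: (integrable_fin_num _ mollify_measure_integrable).
  exact: finite_measure_fin_num.
rewrite -Rintegral_mkcond /Rintegral fine_le//.
- have iSc' : mu.-integrable (~` S) (EFin \o g) by apply: integrableS mollify_measure_integrable.
  exact: (integrable_fin_num _ iSc').
- exact: finite_measure_fin_num.
apply: (mollify_measure_le hphi m n0) => // s t sM st tM; apply: sM; move: tM st.
rewrite /S /= !in_itv/= ler_norml => /andP[h1 h2] /andP[h3 h4].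
by have h5 := invN_le1; apply/andP; split; lra.
Qed.

End approximation.

(** * Convergence in E *)

Section convergence.
Context (R : realType) (phi u : R -> R) (hphi : friedrichs phi).
Context (m : {finite_measure set (measurableTypeR R) -> \bar R}).
Hypothesis hD : eulerian u (cst 0) m.
Notation mu := (@lebesgue_measure R).
Let w := wderiv u.
Let fm := finite_measure_lty m.
Let hu : H1 u := eulerian_H1 hD.
Let w2 : L2 w := H1_wderiv_L2 hphi hu.
Let mass := fine (m setT).
Let am n := approx_measure hphi hD (ltn0Sn n).
Let err n := approx_error phi u m n.+1.
Let ua n := u_approx phi u n.+1.
Let ra n := rho_approx phi u m n.+1.
Let dist n := n.+1%:R^-1 + err n.

Let mass_ge0 : 0 <= mass. Proof. exact: fine_ge0. Qed.

Let fam n : (am n setT < +oo)%E.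
Proof. exact: le_lt_trans (approx_measure_total _ _ _) fm. Qed.

Let err_ge0 n : 0 <= err n.
Proof. exact: (approx_error_ge0 hphi hD (ltn0Sn n)). Qed.

Let dist_ge0 n : 0 <= dist n.
Proof. by rewrite addr_ge0// invr_ge0. Qed.

(** The bound [k.+1 - 1] is M - 1 of [approx_error_le] at M = [k.+1]. *)
Lemma tail_measure_cvg :
  (fun k : nat => fine (m (~` `[- (k.+1%:R - 1), k.+1%:R - 1]%classic))) @ \oo --> 0.
Proof.
pose S (k : nat) : set (measurableTypeR R) := ~` `[- (k.+1%:R - 1), k.+1%:R - 1]%classic.
have mS k : measurable (S k) by apply: measurableC; exact: measurable_itv.
have capS : \bigcap_k S k = set0.
  apply/seteqP; split => // x xS; have := xS (Num.bound `|x|) I; apply.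
  rewrite /= in_itv/= -ler_norml -natr1 addrK.
  exact: ltW (archi_boundP (normr_ge0 x)).
have := @nonincreasing_cvg_mu _ _ _ m S.
rewrite capS measure0 => h; apply: fine_cvg; apply: h => //.
- by apply: le_lt_trans fm; apply: le_measure; rewrite ?inE.
- move=> i j ij; apply/subsetPset => z; apply: subsetC => t /=.
  rewrite !in_itv/= => /andP[h1 h2].
  have ij' : i.+1%:R <= j.+1%:R :> R by rewrite ler_nat.
  by apply/andP; split; lra.
Qed.

Lemma err_cvg : err @ \oo --> 0.
Proof.
apply/cvgrPdist_le => d d0; have d2 : 0 < d / 2 by rewrite divr_gt0.
(* The interval is fixed first, from the tails of m alone; n is taken large afterwards. *)
have /cvgrPdist_le /(_ _ d2) [k _ /(_ k (leqnn k))] := tail_measure_cvg.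
rewrite sub0r normrN => tk.
pose M : R := k.+1%:R.
have K0 : 0 < 2 * M + mass + 1 by rewrite ltr_wpDl// addr_ge0// mulr_ge0.
have dK : 0 < d / 2 / (2 * M + mass + 1) by rewrite divr_gt0.
have /cvgrPdist_le /(_ _ dK) := @cvg_harmonic R.
apply: filterS => n; rewrite sub0r normrN /harmonic ger0_norm ?invr_ge0// => nd.
rewrite sub0r normrN ger0_norm//.
have M0 : 0 <= M by [].
rewrite (le_trans (approx_error_le hphi hD (ltn0Sn n) M0))// (splitr d); apply: lerD.
  rewrite -/mass; apply: (@le_trans _ _ ((2 * M + mass + 1) * n.+1%:R^-1)).
    by apply: ler_wpM2r; rewrite ?invr_ge0// lerDl.
  by rewrite mulrC -ler_pdivlMr.
exact: le_trans (ler_norm _) tk.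
Qed.

Lemma dist_cvg : dist @ \oo --> 0.
Proof. by rewrite -[X in _ --> X]addr0; apply: cvgD; [exact: cvg_harmonic|exact: err_cvg]. Qed.

Lemma Ly_approx_dist n xi : `|Ly (am n) xi - Ly m xi| <= dist n.
Proof.
have i0 : 0 <= n.+1%:R^-1 :> R by rewrite invr_ge0.
rewrite distrC; apply: (Ly_close fm (fam n) i0 (err_ge0 n)) => x.
exact: (approx_cumul hphi hD (ltn0Sn n)).
Qed.

(** The window radius: y and y_n stay within [mass] of xi, and mollification reaches at most 1
    further. *)
Let c := mass + 1.
Let I := total_energy w.

Lemma approx_U_sqr n xi :
  (ua n (Ly (am n) xi) - u (Ly m xi)) ^+ 2 <= (dist n + n.+1%:R^-1) * local_energy w c xi.
Proof.
rewrite /ua (u_approxE hphi hu (ltn0Sn n)).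
have n1 : n.+1%:R^-1 <= 1 :> R by rewrite invf_le1// ler1n.
have am_mass : fine (am n setT) <= mass.
  rewrite /mass fine_le//; [exact: finite_measure_fin_num|exact: finite_measure_fin_num|].
  exact: approx_measure_total.
apply: (mollify_displacement hphi hu (ltn0Sn n)).
- by apply: lerD => //; apply: le_trans am_mass; exact: Ly_dist_id (fam n) xi.
- by rewrite (le_trans (Ly_dist_id fm xi))// lerDl.
- by rewrite lerD2r Ly_approx_dist.
Qed.

Context (p : R -> R) (pn : nat -> R -> R).
Hypothesis hp : is_slope u (cst 0) m p.
Hypothesis hpn : forall n, is_slope (ua n) (ra n) (am n) (pn n).

Let hr0 : L2const (cst 0 : R -> R). Proof. by case: hD. Qed.

Let bar0 x : barpart (cst 0 : R -> R) x = 0.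
Proof.
have z : L2 (cst 0 : R -> R).
  apply: (L2_bound (g := cst 0)); [exact: measurable_cst|by move=> ?; rewrite expr0n|].
  by apply: integrable0.
by rewrite /barpart (@kpart_eq _ _ 0) ?subr0//; move: z; congr L2; apply/funext => ?; rewrite /= subr0.
Qed.

Let hun n : H1 (ua n). Proof. exact (u_approx_H1 hphi hD (ltn0Sn n)). Qed.
Let hrn n : L2const (ra n). Proof. exact (rho_approx_L2const hphi hD (ltn0Sn n)). Qed.

Let V xi := wderiv u (Ly m xi) * p xi.
Let Vn n xi := wderiv (ua n) (Ly (am n) xi) * pn n xi.
Let rn n xi := barpart (ra n) (Ly (am n) xi) * pn n xi.

Let V2 : L2 V := slope_U_L2 fm hp.
Let Vn2 n : L2 (Vn n) := slope_U_L2 (fam n) (hpn n).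
Let h2 : L2 (fun xi => 1 - p xi) := slopeC_L2 fm hp.
Let hn2 n : L2 (fun xi => 1 - pn n xi) := slopeC_L2 (fam n) (hpn n).
Let ih := slopeC_integrable fm hp.
Let ihn n := slopeC_integrable (fam n) (hpn n).

Lemma slope_mass : \int[mu]_xi (1 - p xi) = mass.
Proof. by rewrite /Rintegral; case: hp => _ _ _ _ ->. Qed.

Lemma slope_approx_mass n : \int[mu]_xi (1 - pn n xi) <= mass.
Proof.
rewrite /Rintegral; case: (hpn n) => _ _ _ _ ->; rewrite /mass fine_le//.
- exact: (finite_measure_fin_num (fam n)).
- exact: (finite_measure_fin_num fm).
- exact: approx_measure_total.
Qed.

Let p01 x : 0 <= p x <= 1. Proof. by case: hp. Qed.
Let pn01 n x : 0 <= pn n x <= 1. Proof. by case: (hpn n). Qed.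

Let pE x : (1 - p x) ^+ 2 + V x ^+ 2 = 1 - p x.
Proof. by case: hp => _ _ _ E _; rewrite -[RHS](E x) bar0 mul0r expr0n addr0. Qed.

Let pnE n x : (1 - pn n x) ^+ 2 + Vn n x ^+ 2 + rn n x ^+ 2 = 1 - pn n x.
Proof. by case: (hpn n) => _ _ _ E _; exact: E. Qed.

Let dp n xi := pn n xi - p xi.
Let dV n xi := Vn n xi - V xi.

Let dp2 n : L2 (dp n).
Proof. by have := L2B h2 (hn2 n); congr L2; apply/funext => x; rewrite /dp; ring. Qed.

Let dV2 n : L2 (dV n). Proof. exact: L2B. Qed.

Let sqr_le2 n x : dp n x ^+ 2 <= 1 * (1 - pn n x) + 1 * (1 - p x).
Proof.
by have := p01 x; have := pn01 n x; rewrite /dp => /andP[a1 a2] /andP[a3 a4]; nra.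
Qed.

Let sqr_le4 n x : dV n x ^+ 2 <= 2 * (1 - pn n x) + 2 * (1 - p x).
Proof.
have := pE x; have := pnE n x; have := sqr_ge0 (rn n x); have := sqr_ge0 (1 - p x).
by have := sqr_ge0 (1 - pn n x); have := sqr_ge0 (Vn n x + V x); rewrite /dV; nra.
Qed.

(** Supplies the bound uniform in n that [weak_cvg] requires; uniformity comes from mu_n(R) <=
    mu(R). *)
Let int_le (f : R -> R) k n : 0 <= k -> L2 f ->
  (forall x, f x ^+ 2 <= k * (1 - pn n x) + k * (1 - p x)) ->
  \int[mu]_x (f x ^+ 2) <= 2 * k * mass.
Proof.
move=> k0 f2 fk; apply: (@le_trans _ _ (\int[mu]_x (k * (1 - pn n x) + k * (1 - p x)))).
  apply: le_Rintegral => //; first exact: L2_integrable.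
  exact: integrable_lincomb (ihn n) ih.
rewrite RintegralD//; last 2 first.
- exact: (integrableZl measurableT k (ihn n)).
- exact: (integrableZl measurableT k ih).
rewrite !RintegralZl//.
by rewrite slope_mass; have := slope_approx_mass n; nra.
Qed.

Let X n := \int[mu]_x (dp n x * (1 - p x)).
Let Y n := \int[mu]_x (dV n x * V x).

(** Weak convergence with [psi] = h, a derivative of xi - y(xi), applied to the uniformly small
    differences y_n - y. *)
Lemma slope_weak_cvg : X @ \oo --> 0.
Proof.
have pPsi : is_primitive (fun x => x - Ly m x) (fun x => 1 - p x).
  by apply: is_primitiveB; [exact: is_primitive_id|case: hp].
have b1 x : `|1 - p x| <= 1.
  by have /andP[a1 a2] := p01 x; rewrite ger0_norm; lra.
apply: (weak_cvg pPsi b1 h2 (D := fun n x => Ly (am n) x - Ly m x) (delta := dist) (C := 2 * 1 * mass)).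
- by move=> n; apply: is_primitiveB; [case: (hpn n)|case: hp].
- by move=> n x; apply: cvgB; exact: Ly_continuous.
- by move=> n x; exact: Ly_approx_dist.
- exact: dist_cvg.
- exact: dp2.
- by move=> n; apply: int_le => // x; exact: sqr_le2.
Qed.

Let K n := (dist n + n.+1%:R^-1).

Let K_cvg : K @ \oo --> 0.
Proof. by rewrite -[X in _ --> X]addr0; apply: cvgD; [exact: dist_cvg|exact: cvg_harmonic]. Qed.

Let K_ge0 n : 0 <= K n. Proof. by rewrite addr_ge0// invr_ge0. Qed.

Let I_ge0 : 0 <= I. Proof. exact: total_energy_ge0. Qed.

Let sqrt_cvg0 (s : nat -> R) : s @ \oo --> 0 -> (fun n => Num.sqrt (s n)) @ \oo --> 0.
Proof.
by move=> s0; rewrite -[X in _ --> X](sqrtr0 R); apply: continuous_cvg => //; exact: sqrt_continuous.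
Qed.

Lemma slope_U_weak_cvg : Y @ \oo --> 0.
Proof.
(* The energy identity gives V^2 <= 1 - p <= 1, so U' is an admissible [psi]. *)
have b1 x : `|V x| <= 1.
  rewrite -[leRHS](ger0_norm ler01) -ler_sqr ?nnegrE// !real_normK ?num_real//.
  by have := pE x; have /andP[a1 a2] := p01 x; have := sqr_ge0 (1 - p x); nra.
have pV : is_primitive (u \o Ly m) V by case: hp.
apply: (weak_cvg pV b1 V2 (D := fun n x => ua n (Ly (am n) x) - u (Ly m x))
  (delta := fun n => Num.sqrt (K n * I)) (C := 2 * 2 * mass)).
- by move=> n; apply: is_primitiveB => //; case: (hpn n).
- move=> n x; apply: cvgB.
    exact: (@comp_Ly_continuous _ (ua n) (am n) (fam n) (hun n)).
  exact: (@comp_Ly_continuous _ u m fm hu).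
- move=> n x; rewrite -sqrtr_sqr ler_sqrt ?mulr_ge0//.
  rewrite (le_trans (approx_U_sqr n x))//; apply: ler_wpM2l; first exact: K_ge0.
  exact: (energy_le_total w2).
- apply: sqrt_cvg0; rewrite -[X in _ --> X](mul0r I).
  by apply: cvgM; [exact: K_cvg|exact: cvg_cst].
- exact: dV2.
- by move=> n; apply: int_le => // x; exact: sqr_le4.
Qed.

Let E n := 2 * `|X n| + 2 * `|Y n|.

Let E_ge0 n : 0 <= E n. Proof. by rewrite addr_ge0// mulr_ge0. Qed.

Let E_cvg : E @ \oo --> 0.
Proof.
have c2 (s : nat -> R) : s @ \oo --> 0 -> (fun n => 2 * `|s n|) @ \oo --> 0.
  move=> s0; rewrite -[X in _ --> X](mulr0 2) -[X in _ * X](normr0 R).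
  by apply: cvgM; [exact: cvg_cst|exact: cvg_norm].
rewrite -[X in _ --> X]addr0; apply: cvgD; apply: c2.
  exact: slope_weak_cvg.
exact: slope_U_weak_cvg.
Qed.

(* The energy identity [h ^+ 2 + U' ^+ 2 + r ^+ 2 = h] of each system turns the
   squared distance into terms that are linear in the differences. *)
Let sqr_dist_le n (f : R -> R) : measurable_fun setT f ->
  (forall x, f x ^+ 2 <= dp n x ^+ 2 + dV n x ^+ 2 + rn n x ^+ 2) ->
  (\int[mu]_x (f x ^+ 2)%:E <= (E n)%:E)%E.
Proof.
move=> mf fle.
pose T x := (p x - pn n x) + 2 * (dp n x * (1 - p x)) - 2 * (dV n x * V x).
have TE x : dp n x ^+ 2 + dV n x ^+ 2 + rn n x ^+ 2 = T x.
  (* Replacing r_n^2 cancels the squares of h_n and U_n', and [pE] then trades U'^2 for terms in p;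
     what depends on n is linear. *)
  have -> : rn n x ^+ 2 = 1 - pn n x - (1 - pn n x) ^+ 2 - Vn n x ^+ 2.
    by rewrite -{1}(pnE n x); ring.
  have V2E : V x ^+ 2 = 1 - p x - (1 - p x) ^+ 2 by rewrite -{1}(pE x); ring.
  transitivity (dp n x ^+ 2 + (V x ^+ 2 - 2 * Vn n x * V x) + (1 - pn n x - (1 - pn n x) ^+ 2)).
    by rewrite /dV; ring.
  rewrite /T /dV (_ : 2 * ((Vn n x - V x) * V x) = 2 * Vn n x * V x - 2 * V x ^+ 2); last by ring.
  by rewrite V2E /dp; ring.
have iX := L2M (dp2 n) h2; have iY := L2M (dV2 n) V2.
have id : mu.-integrable setT (EFin \o (fun x => p x - pn n x)).
  have := integrableB measurableT (ihn n) ih.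
  by apply: eq_integrable => // x _ /=; rewrite -EFinB; congr EFin; ring.
have iX2 : mu.-integrable setT (EFin \o (fun x => 2 * (dp n x * (1 - p x)))).
  exact: (integrableZl measurableT (2 : R) iX).
have iY2 : mu.-integrable setT (EFin \o (fun x => 2 * (dV n x * V x))).
  exact: (integrableZl measurableT (2 : R) iY).
have iD := integrableD measurableT id iX2.
have iT : mu.-integrable setT (EFin \o T) by exact: (integrableB measurableT iD iY2).
have TI : \int[mu]_x T x <= E n.
  rewrite /T RintegralB// RintegralD// !RintegralZl//.
  have d0 : \int[mu]_x (p x - pn n x) <= 0.
    rewrite (_ : \int[mu]_x _ = \int[mu]_x ((1 - pn n x) - (1 - p x))).
      by rewrite RintegralB// slope_mass subr_le0 slope_approx_mass.
    by apply: eq_Rintegral => x _; ring.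
  have := ler_norm (X n); have := ler_norm (- Y n); rewrite normrN /E -/(X n) -/(Y n).
  by move: d0; rewrite -/(X n) -/(Y n); lra.
apply: (@le_trans _ _ (\int[mu]_x (T x)%:E)%E).
  apply: ge0_le_integral => //.
  - by move=> x _; rewrite lee_fin sqr_ge0.
  - by apply/measurable_EFinP; exact: measurable_funX.
  - exact: (measurable_int _ iT).
  - by move=> x _; rewrite lee_fin -TE.
rewrite -lee_fin in TI; apply: le_trans TI; rewrite /Rintegral fineK//.
exact: (integrable_fin_num _ iT).
Qed.

Let A n := K n * (2 * c * I).

Lemma normE_approx_le n :
  (normE (lag_sub (Lmap (ua n) (ra n) (am n)) (Lmap u (cst 0%R) m)) <=
   (dist n + Num.sqrt (E n) + Num.sqrt (A n + E n) + Num.sqrt (E n) + Num.sqrt (E n)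
    + n.+1%:R^-1)%:E)%E.
Proof.
have c0 : 0 <= c by rewrite addr_ge0.
have k0 : kpart (cst 0 : R -> R) = 0.
  by have := bar0 0; rewrite /barpart sub0r => /eqP; rewrite oppr_eq0 => /eqP.
have A0 : 0 <= A n by rewrite !mulr_ge0.
have -> : n.+1%:R^-1 = `|kpart (ra n) - kpart (cst 0 : R -> R)| :> R.
  by rewrite k0 subr0 /ra (rho_approx_kpart hphi hD (ltn0Sn n)) ger0_norm// invr_ge0.
have mVn := L2_measurable (Vn2 n); have mV := L2_measurable V2.
have mr : measurable_fun setT (rn n) by exact: L2_measurable (slope_r_L2 (fam n) (hrn n) (hpn n)).
apply: (normE_Lmap_le hphi (fam n) fm (hun n) hu (hrn n) hr0 (hpn n) hp) => //.
- by move=> xi; exact: Ly_approx_dist.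
- have [||_] := local_energy_L2 w2 c0 (K_ge0 n)
    (f := fun xi => ua n (Ly (am n) xi) - u (Ly m xi)) => //.
    apply: measurable_funB; apply: continuous_measurable_fun.
      exact: (@comp_Ly_continuous _ (ua n) (am n) (fam n) (hun n)).
    exact: (@comp_Ly_continuous _ u m fm hu).
  by move=> xi; exact: approx_U_sqr.
- apply: (@sqr_dist_le n (dp n)); first exact: L2_measurable.
  by move=> x; rewrite -addrA lerDl addr_ge0// sqr_ge0.
- apply: (@sqr_dist_le n (dV n)); first exact: L2_measurable.
  by move=> x; rewrite addrAC lerDr addr_ge0// sqr_ge0.
- under eq_integral do rewrite bar0 mul0r subr0.
  apply: (@sqr_dist_le n (rn n)) => //.
  by move=> x; rewrite lerDr addr_ge0// sqr_ge0.
Qed.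

Lemma normE_approx_cvg :
  (fun n => normE (lag_sub (Lmap (ua n) (ra n) (am n)) (Lmap u (cst 0%R) m))) @ \oo --> 0%E.
Proof.
have b0 : (fun n => (dist n + Num.sqrt (E n) + Num.sqrt (A n + E n) + Num.sqrt (E n) + Num.sqrt (E n)
    + n.+1%:R^-1)%:E) @ \oo --> 0%E.
  apply: cvg_EFin; first exact: nearW.
  have sE := sqrt_cvg0 E_cvg.
  have sAE : (fun n => Num.sqrt (A n + E n)) @ \oo --> 0.
    apply: sqrt_cvg0; rewrite -[X in _ --> X]addr0; apply: cvgD; last exact: E_cvg.
    rewrite -[X in _ --> X](mul0r (2 * c * I)).
    by apply: cvgM; [exact: K_cvg|exact: cvg_cst].
  have := cvgD (cvgD (cvgD (cvgD (cvgD dist_cvg sE) sAE) sE) sE) (@cvg_harmonic R).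
  by rewrite !addr0 => H; apply: H.
apply: (squeeze_cvge _ (cvg_cst 0%E) b0).
apply: nearW => n; rewrite normE_approx_le andbT /normE /normV /normH1 /normL2 /normLinf.
by rewrite !adde_ge0 ?poweR_ge0 ?Lnorm_ge0.
Qed.

End convergence.

(* The sequence is indexed by the positive integers n.+1. *)
Theorem theorem3p4 (R : realType) (phi u : R -> R)
    (mu : {finite_measure set (measurableTypeR R) -> \bar R})
    (hphi : friedrichs phi) (hD : eulerian u (cst 0) mu) :
  cvgE (fun n : nat => Lmap (u_approx phi u n.+1) (rho_approx phi u mu n.+1)
                            (mu_approx phi u mu n.+1))
       (Lmap u (cst 0) mu).
Proof.
have fm := finite_measure_lty mu.
have hu := eulerian_H1 hD.
have [_ hr ac] := hD.
have [p hp] := ex_slope hphi fm hu hr ac.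
(* Its underlying set function is [mu_approx phi u mu n.+1], so results about [am n] apply to the
   goal by conversion. *)
pose am n := approx_measure hphi hD (ltn0Sn n).
have fam n : (am n setT < +oo)%E by exact: le_lt_trans (approx_measure_total _ _ _) fm.
have hun n := u_approx_H1 hphi hD (ltn0Sn n).
have hrn n := rho_approx_L2const hphi hD (ltn0Sn n).
have /choice[pn hpn] n : exists q, is_slope (u_approx phi u n.+1) (rho_approx phi u mu n.+1) (am n) q.
  exact: (ex_slope hphi (fam n) (hun n) (hrn n) (approx_ac_part hphi hD (ltn0Sn n))).
split.
- by move=> n; exact: (Lmap_in_lagE hphi (fam n) (hun n) (hrn n) (hpn n)).
- exact: (Lmap_in_lagE hphi fm hu hr hp).
- exact: (normE_approx_cvg hp hpn).
Qed.
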